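(* Suppose that for some $\varepsilon>0$ and some $\delta$ with $\frac12\le\delta<1$ $$\sup_{n\in\mathbb{Z}}\bigl\{\exp(\varepsilon|n|^{\delta})\,(|1-a_n|+|p_n|+|q_n|)\bigr\}<\infty .$$ Then the eigenvalues and spectral singularities of the operator $L_\lambda$ are finite in number, and each of them is of finite multiplicity.
   Context: Standing assumptions: $(a_n)$, $(p_n)$, $(q_n)$, $n\in\mathbb{Z}$, are complex sequences with $a_n\neq0$ for all $n$ (the standing condition $\sum_{n}|n|(|1-a_n|+|p_n|+|q_n|)<\infty$ is implied by the hypothesis). For $\lambda\in\mathbb{C}$, $L_\lambda$ is the operator in $\ell^2(\mathbb{Z})$ given by $(L_\lambda y)_n=\Delta(a_{n-1}\Delta y_{n-1})+(q_n+2\lambda p_n+\lambda^2)y_n$, with $\Delta y_n=y_{n+1}-y_n$. Jost solutions. For $\operatorname{Im}z\ge0$ and $\lambda=2\cos(z/2)$, the equation $L_\lambda y=0$ has the solutions $f_n^+(z)=\alpha_n^+e^{inz}(1+\sum_{m\ge1}K_{n,m}^+e^{imz/2})$ and $f_n^-(z)=\alpha_n^-e^{-inz}(1+\sum_{m\le-1}K_{n,m}^-e^{-imz/2})$, where, with $h_n=2-a_n-a_{n-1}+q_n$, $\alpha_n^+=(-1)^n(\prod_{r\ge n}a_r)^{-1}$, $K_{n,1}^+=2\sum_{r\ge n+1}p_r$, $K_{n,2}^+=\sum_{r\ge n+1}(h_r+2p_rK_{r,1}^+)$, $K_{n,3}^+=\sum_{r\ge n+1}(h_rK_{r,1}^++2p_r(K_{r,2}^++1))$,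 $K_{n,4}^+=\sum_{r\ge n+1}((1-a_r^2)+h_rK_{r,2}^++2p_r(K_{r,3}^++K_{r,1}^+))$, $K_{n,m+4}^+=K_{n+1,m}^++\sum_{r\ge n+1}((1-a_r^2)K_{r+1,m}^++h_rK_{r,m+2}^++2p_r(K_{r,m+1}^++K_{r,m+3}^+))$ for $m\ge1$; and $\alpha_n^-=(-1)^n(\prod_{r\le n-1}a_r)^{-1}$, $K_{n,-1}^-=2\sum_{r\le n-1}p_r$, $K_{n,-2}^-=\sum_{r\le n-1}(h_r+2p_rK_{r,-1}^-)$, $K_{n,-3}^-=\sum_{r\le n-1}(h_rK_{r,-1}^-+2p_r(K_{r,-2}^-+1))$, $K_{n,-4}^-=\sum_{r\le n-1}((1-a_{r-1}^2)+h_rK_{r,-2}^-+2p_r(K_{r,-3}^-+K_{r,-1}^-))$, $K_{n,m-4}^-=K_{n-1,m}^-+\sum_{r\le n-1}((1-a_{r-1}^2)K_{r-1,m}^-+h_rK_{r,m-2}^-+2p_r(K_{r,m-1}^-+K_{r,m-3}^-))$ for $m\le-1$. These are analytic in $z$ for $\operatorname{Im}z>0$ and continuous for $\operatorname{Im}z\ge0$. Put $\Phi(z)=W[f^-(z),f^+(z)]$ with $W[u,v]=a_n(u_nv_{n+1}-u_{n+1}v_n)$ (independent of $n$); $\Phi$ is $4\pi$-periodic. Let $P^+=\{\eta+i\varphi:\eta\in[-\pi,3\pi],\varphi>0\}$ and $P_0=(-\pi,3\pi)\setminus\{0,\pi,2\pi\}$. Eigenvalues are the $\lambda$ for which $L_\lambda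 y=0$ has a nonzero solution in $\ell^2(\mathbb{Z})$; they form the set $\{\lambda=2\cos\frac z2:z\in P^+,\Phi(z)=0\}$. The spectral singularities (poles of the resolvent kernel embedded in the continuous spectrum) form the set $\{\lambda=2\cos\frac z2:z\in P_0,\Phi(z)=0\}$. The multiplicity of an eigenvalue or spectral singularity is the multiplicity of the corresponding zero of $\Phi$ in $P^+\cup P_0$ (at a real zero, the order of vanishing in terms of the derivatives of $\Phi$, which extend continuously to the real axis under the hypothesis). *)

(* Defs.v *)
From Stdlib Require Export Reals ZArith Ensembles Finite_sets.
From Coquelicot Require Export Coquelicot.

Open Scope C_scope.

(** * Complex analysis missing from Coquelicot *)

Definition Cexp (z : C) : C :=
  RtoC (exp (Re z)) * (RtoC (cos (Im z)) + Ci * RtoC (sin (Im z))).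

Definition Ccos (z : C) : C := (Cexp (Ci * z) + Cexp (- (Ci * z))) / 2.

(** Like [Lim_seq] and [Series], the next two are total and only meaningful
    for convergent arguments. *)
Definition CLim_seq (u : nat -> C) : C :=
  (real (Lim_seq (fun k => Re (u k))), real (Lim_seq (fun k => Im (u k)))).

Definition CSeries (u : nat -> C) : C :=
  (Series (fun k => Re (u k)), Series (fun k => Im (u k))).

Fixpoint Cprod (u : nat -> C) (k : nat) : C :=
  match k with
  | O => 1
  | S k' => Cprod u k' * u k'
  end.

(** [sum_ge n u] is the sum of [u r] over [r >= n], [sum_le n u] the sum over
    [r <= n]; similarly for products. *)
Definition sum_ge (n : Z) (u : Z -> C) : C :=
  CSeries (fun j => u (n + Z.of_nat j)%Z).

Definition sum_le (n : Z) (u : Z -> C) : C :=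
  CSeries (fun j => u (n - Z.of_nat j)%Z).

Definition prod_ge (n : Z) (u : Z -> C) : C :=
  CLim_seq (Cprod (fun j => u (n + Z.of_nat j)%Z)).

Definition prod_le (n : Z) (u : Z -> C) : C :=
  CLim_seq (Cprod (fun j => u (n - Z.of_nat j)%Z)).

(** [|n|^delta] for [delta > 0]; the case [n = 0] is separate because
    [Rpower 0 delta = 1]. *)
Definition Zabs_power (n : Z) (delta : R) : R :=
  if Z.eq_dec n 0 then 0%R else Rpower (IZR (Z.abs n)) delta.

(** * The operator and its eigenvalues *)

Definition Delta (y : Z -> C) (n : Z) : C := y (n + 1)%Z - y n.

Definition L (a p q : Z -> C) (lambda : C) (y : Z -> C) (n : Z) : C :=
  Delta (fun k => a (k - 1)%Z * Delta y (k - 1)%Z) n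
  + (q n + 2 * lambda * p n + lambda * lambda) * y n.

Definition l2Z (y : Z -> C) : Prop :=
  ex_series (fun k : nat => (Cmod (y (Z.of_nat k)) ^ 2)%R) /\
  ex_series (fun k : nat => (Cmod (y (- Z.of_nat k)%Z) ^ 2)%R).

Definition eigenvalue (a p q : Z -> C) (lambda : C) : Prop :=
  exists y : Z -> C,
    l2Z y /\ (exists n, y n <> 0) /\ (forall n, L a p q lambda y n = 0).

(** * Jost solutions *)

Definition h (a q : Z -> C) (n : Z) : C := 2 - a n - a (n - 1)%Z + q n.

Definition alpha_plus (a : Z -> C) (n : Z) : C :=
  RtoC (powerRZ (-1) n) * / prod_ge n a.

Definition alpha_minus (a : Z -> C) (n : Z) : C :=
  RtoC (powerRZ (-1) n) * / prod_le (n - 1) a.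

(** [K_plus a p q m n] is the coefficient K^+_{n,m}, for [m >= 1]; the value at
    [m = 0] is never used.  In each branch [m1], [m2], ... stand for
    [m - 1], [m - 2], ... *)
Fixpoint K_plus (a p q : Z -> C) (m : nat) (n : Z) {struct m} : C :=
  match m with
  | 0%nat => 0
  | 1%nat => 2 * sum_ge (n + 1) p
  | S (1%nat as m1) =>
      sum_ge (n + 1) (fun r => h a q r + 2 * p r * K_plus a p q m1 r)
  | S (S (1%nat as m2) as m1) =>
      sum_ge (n + 1) (fun r =>
        h a q r * K_plus a p q m2 r + 2 * p r * (K_plus a p q m1 r + 1))
  | S (S (S (1%nat as m3) as m2) as m1) =>
      sum_ge (n + 1) (fun r =>
        (1 - a r * a r) + h a q r * K_plus a p q m2 r
        + 2 * p r * (K_plus a p q m1 r + K_plus a p q m3 r))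
  | S (S (S (S m4 as m3) as m2) as m1) =>
      K_plus a p q m4 (n + 1)%Z
      + sum_ge (n + 1) (fun r =>
          (1 - a r * a r) * K_plus a p q m4 (r + 1)%Z
          + h a q r * K_plus a p q m2 r
          + 2 * p r * (K_plus a p q m3 r + K_plus a p q m1 r))
  end.

(** [K_minus a p q m n] is the coefficient K^-_{n,-m}, for [m >= 1]. *)
Fixpoint K_minus (a p q : Z -> C) (m : nat) (n : Z) {struct m} : C :=
  match m with
  | 0%nat => 0
  | 1%nat => 2 * sum_le (n - 1) p
  | S (1%nat as m1) =>
      sum_le (n - 1) (fun r => h a q r + 2 * p r * K_minus a p q m1 r)
  | S (S (1%nat as m2) as m1) =>
      sum_le (n - 1) (fun r =>
        h a q r * K_minus a p q m2 r + 2 * p r * (K_minus a p q m1 r + 1))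
  | S (S (S (1%nat as m3) as m2) as m1) =>
      sum_le (n - 1) (fun r =>
        (1 - a (r - 1)%Z * a (r - 1)%Z) + h a q r * K_minus a p q m2 r
        + 2 * p r * (K_minus a p q m1 r + K_minus a p q m3 r))
  | S (S (S (S m4 as m3) as m2) as m1) =>
      K_minus a p q m4 (n - 1)%Z
      + sum_le (n - 1) (fun r =>
          (1 - a (r - 1)%Z * a (r - 1)%Z) * K_minus a p q m4 (r - 1)%Z
          + h a q r * K_minus a p q m2 r
          + 2 * p r * (K_minus a p q m3 r + K_minus a p q m1 r))
  end.

Definition f_plus (a p q : Z -> C) (z : C) (n : Z) : C :=
  alpha_plus a n * Cexp (Ci * RtoC (IZR n) * z)
  * (1 + CSeries (fun j =>
           K_plus a p q (S j) n * Cexp (Ci * RtoC (INR (S j)) * z / 2))).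

(** With [m = - S j], the exponential e^{-imz/2} is e^{i(S j)z/2}. *)
Definition f_minus (a p q : Z -> C) (z : C) (n : Z) : C :=
  alpha_minus a n * Cexp (- (Ci * RtoC (IZR n) * z))
  * (1 + CSeries (fun j =>
           K_minus a p q (S j) n * Cexp (Ci * RtoC (INR (S j)) * z / 2))).

Definition wronskian (a u v : Z -> C) (n : Z) : C :=
  a n * (u n * v (n + 1)%Z - u (n + 1)%Z * v n).

(** The Wronskian of two solutions of the same equation does not depend on the
    index; it is evaluated at 0. *)
Definition Phi (a p q : Z -> C) (z : C) : C :=
  wronskian a (f_minus a p q z) (f_plus a p q z) 0.

(** * Spectral singularities and multiplicities *)

Definition P_plus (z : C) : Prop :=
  (- PI <= Re z <= 3 * PI)%R /\ (0 < Im z)%R.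

Definition P_0 (z : C) : Prop :=
  Im z = 0%R /\ (- PI < Re z < 3 * PI)%R /\
  Re z <> 0%R /\ Re z <> PI /\ Re z <> (2 * PI)%R.

Definition spectral_singularity (a p q : Z -> C) (lambda : C) : Prop :=
  exists z : C, P_0 z /\ lambda = 2 * Ccos (z / 2) /\ Phi a p q z = 0.

(** [D k] is the [k]-th complex derivative of [F] on the open upper half-plane,
    extended by continuity to the real axis.  This determines every [D k] on
    the closed half-plane; values elsewhere are unconstrained. *)
Definition extended_derivatives (F : C -> C) (D : nat -> C -> C) : Prop :=
  (forall z, (0 <= Im z)%R -> D 0%nat z = F z) /\
  (forall (k : nat) z, (0 < Im z)%R ->
     is_derive (K := C_AbsRing) (V := C_NormedModule) (D k) z (D (S k) z)) /\
  (forall (k : nat) z, Im z = 0%R ->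
     filterlim (D k) (within (fun w => (0 < Im w)%R) (locally z))
       (locally (D k z))).

Definition zero_multiplicity (F : C -> C) (z : C) (k : nat) : Prop :=
  exists D, extended_derivatives F D /\
    (forall j, (j < k)%nat -> D j z = 0) /\ D k z <> 0.

Definition corresponding_zero (a p q : Z -> C) (lambda z : C) : Prop :=
  (P_plus z \/ P_0 z) /\ lambda = 2 * Ccos (z / 2) /\ Phi a p q z = 0.

(** Distinct points of [P_plus] or [P_0] may give the same [lambda]: the two
    vertical edges of [P_plus], and [z], [-z] (or [z], [4 PI - z]) in [P_0].
    Every zero of [Phi] corresponding to [lambda] is required to have finite
    multiplicity. *)
Definition finite_multiplicity (a p q : Z -> C) (lambda : C) : Prop :=
  (exists z, corresponding_zero a p q lambda z) /\
  (forall z, corresponding_zero a p q lambda z ->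
     exists k : nat, zero_multiplicity (Phi a p q) z k).

(* Main.v *)
Require Import Defs.
From Stdlib Require Import Lra Lia Psatz FunctionalExtensionality Classical.
From Stdlib Require Import ClassicalEpsilon List Finite_sets_facts.
From Stdlib Require Image.

(** With [w = e^{iz/2}], the function [w^2 Phi] is a power series [ev c w] whose
    coefficients satisfy [|c_m| <= B exp (- kappa sqrt m)] and whose constant
    term is not zero.  Dividing by [w - w0] repeatedly at a zero [w0] of the
    closed disc either stops, which gives a finite multiplicity and isolates
    [w0], or shows that [ev c] vanishes to infinite order at [w0].  The latter is
    excluded inside the disc by Blaschke factors, and on the circle because
    [|ev c w| <= A inf_k (Q |w - w0|)^k k!] decays like [exp (- C / |w - w0|)],
    whose logarithm is not integrable.  By compactness [ev c] has finitely many
    zeros in the closed disc.  Eigenvalues correspond to zeros with [|w| < 1],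
    because a square-summable solution is proportional to both Jost solutions,
    and there is no square-summable solution when [|w| = 1]. *)

(** * Power series with rapidly decreasing coefficients *)

(** All analysis takes place on Taylor coefficients in [w], because division by [w - w0] is then a
    tail sum of coefficients. It preserves decay faster than every power even for [|w0| = 1], so
    points inside the disc and on the circle are divided out in the same way and no contour integral
    occurs.

    The exponent [1 / 2] enters through one count. Decay like [exp (- kappa sqrt m)] gives decay of
    order [p] with a constant of size [q^p (2p)!]. Performing [k] divisions uses up [p = k + 2]
    orders, but each tail sum also divides the constant, by [(k + 1)!] in total. What remains has
    size [Q^k k!], and optimising over [k] gives the rate [1 / |w - w0|] in the exponent, the
    borderline at which integrability of the logarithm is lost.

    For the Jost kernels the obstacle is that [K_(n,m+4)] depends on [K_(n+1,m)]. The estimates are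
    therefore joint in [n] and [m] for large [n], and reach the remaining [n] through a three-term
    recurrence. The constant term is non-zero because it is, up to sign, the product of [a_0] and
    two reciprocals of convergent products with non-zero limits. *)

Definition abs_conv (u : nat -> C) : Prop := ex_series (fun k => Cmod (u k)).

Lemma C_ext (x y : C) : Re x = Re y -> Im x = Im y -> x = y.
Proof. destruct x, y; unfold Re, Im; simpl; intros; subst; reflexivity. Qed.

Lemma im_le_Cmod (z : C) : (Rabs (Im z) <= Cmod z)%R.
Proof. eapply Rle_trans; [| apply Rmax_Cmod]. apply Rmax_r. Qed.

Lemma abs_conv_Re (u : nat -> C) : abs_conv u -> ex_series (fun k => Re (u k)).
Proof.
  apply (@ex_series_le R_AbsRing R_CompleteNormedModule).
  intro n. apply re_le_Cmod.
Qed.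

Lemma abs_conv_Im (u : nat -> C) : abs_conv u -> ex_series (fun k => Im (u k)).
Proof.
  apply (@ex_series_le R_AbsRing R_CompleteNormedModule).
  intro n. apply im_le_Cmod.
Qed.

Lemma abs_conv_scal (c : C) (u : nat -> C) :
  abs_conv u -> abs_conv (fun k => c * u k).
Proof.
  intros Hu. apply ex_series_ext with (fun k => (Cmod c * Cmod (u k))%R).
  - intro n. now rewrite Cmod_mult.
  - apply (ex_series_scal (V := R_NormedModule)). assumption.
Qed.

Lemma CSeries_ext (u v : nat -> C) :
  (forall k, u k = v k) -> CSeries u = CSeries v.
Proof. intros H. f_equal. now apply functional_extensionality. Qed.

Lemma CSeries_plus (u v : nat -> C) :
  abs_conv u -> abs_conv v ->
  CSeries (fun k => u k + v k) = CSeries u + CSeries v.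
Proof.
  intros Hu Hv. unfold CSeries. apply C_ext; simpl.
  - rewrite <- Series_plus by now apply abs_conv_Re. now apply Series_ext.
  - rewrite <- Series_plus by now apply abs_conv_Im. now apply Series_ext.
Qed.

Lemma re_CSeries (u : nat -> C) : Re (CSeries u) = Series (fun k => Re (u k)).
Proof. reflexivity. Qed.

Lemma im_CSeries (u : nat -> C) : Im (CSeries u) = Series (fun k => Im (u k)).
Proof. reflexivity. Qed.

Lemma CSeries_scal (c : C) (u : nat -> C) :
  abs_conv u -> CSeries (fun k => c * u k) = c * CSeries u.
Proof.
  intros Hu. pose proof (abs_conv_Re u Hu) as HR. pose proof (abs_conv_Im u Hu) as HI.
  apply C_ext.
  - rewrite re_mult, !re_CSeries, im_CSeries.
    rewrite <- !Series_scal_l, <- Series_minus.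
    + apply Series_ext; intro; apply re_mult.
    + now apply (ex_series_scal (V := R_NormedModule)).
    + now apply (ex_series_scal (V := R_NormedModule)).
  - rewrite im_mult, !im_CSeries, re_CSeries.
    rewrite <- !Series_scal_l, <- Series_plus.
    + apply Series_ext; intro; apply im_mult.
    + now apply (ex_series_scal (V := R_NormedModule)).
    + now apply (ex_series_scal (V := R_NormedModule)).
Qed.

Lemma CSeries_incr_1 (u : nat -> C) :
  abs_conv u -> CSeries u = u 0%nat + CSeries (fun k => u (S k)).
Proof.
  intros Hu. unfold CSeries. apply C_ext; simpl.
  - apply (Series_incr_1 (fun k => Re (u k))). now apply abs_conv_Re.
  - apply (Series_incr_1 (fun k => Im (u k))). now apply abs_conv_Im.
Qed.

Lemma abs_conv_incr_1 (u : nat -> C) :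
  abs_conv u <-> abs_conv (fun k => u (S k)).
Proof. apply (ex_series_incr_1 (V := R_NormedModule) (fun k => Cmod (u k))). Qed.

(** Multiplying by the unimodular number [Cconj s / |s|] makes the sum real and non-negative, so
    only its real part has to be compared with the moduli. *)
Lemma Cmod_CSeries_le (u : nat -> C) :
  abs_conv u -> (Cmod (CSeries u) <= Series (fun k => Cmod (u k)))%R.
Proof.
  intros Hu. set (s := CSeries u).
  assert (Hpos : (0 <= Series (fun k => Cmod (u k)))%R).
  { assert (Habs : forall k, Rabs (Cmod (u k)) = Cmod (u k))
      by (intro; apply Rabs_pos_eq, Cmod_ge_0).
    rewrite <- (Series_ext _ _ Habs).
    eapply Rle_trans; [apply Rabs_pos | apply Series_Rabs].
    apply ex_series_ext with (fun k => Cmod (u k)); [| exact Hu].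
    intro. now rewrite Habs. }
  destruct (Req_dec (Cmod s) 0) as [H0 | H0]; [lra |].
  set (v := Cconj s / RtoC (Cmod s)).
  assert (Hs : RtoC (Cmod s) <> 0) by (intro H; apply H0; injection H; auto).
  assert (Hv : Cmod v = 1%R).
  { unfold v. rewrite Cmod_div by exact Hs. rewrite Cmod_conj, Cmod_R, Rabs_pos_eq.
    - now field.
    - apply Cmod_ge_0. }
  assert (E : CSeries (fun k => v * u k) = RtoC (Cmod s)).
  { rewrite CSeries_scal by exact Hu. fold s. unfold v.
    replace (Cconj s / RtoC (Cmod s) * s) with (s * Cconj s / RtoC (Cmod s)) by (field; exact Hs).
    rewrite <- Cmod2_conj. rewrite RtoC_pow. now field. }
  apply (f_equal Re) in E. rewrite re_RtoC in E. rewrite <- E. simpl Re.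
  apply Rle_trans with (Rabs (Series (fun k => Re (v * u k)))); [apply Rle_abs |].
  assert (Hvu : abs_conv (fun k => v * u k)) by now apply abs_conv_scal.
  eapply Rle_trans; [apply Series_Rabs |].
  - eapply (@ex_series_le R_AbsRing R_CompleteNormedModule); [| exact Hu].
    intro n. change (Rabs (Rabs (Re (v * u n))) <= Cmod (u n))%R.
    rewrite Rabs_Rabsolu. eapply Rle_trans; [apply re_le_Cmod |].
    rewrite Cmod_mult, Hv. lra.
  - apply Series_le; [| exact Hu]. intro n. split; [apply Rabs_pos |].
    eapply Rle_trans; [apply re_le_Cmod |]. rewrite Cmod_mult, Hv. lra.
Qed.

(** Majorants are always presented as differences: this yields convergence and an explicit bound at
    once, and the constants stay sharp enough for repeated division. *)
Lemma series_telescope (b s : nat -> R) :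
  (forall j, 0 <= b j <= s j - s (S j))%R -> (forall j, 0 <= s j)%R ->
  ex_series b /\ (Series b <= s 0%nat)%R.
Proof.
  intros Hb Hs.
  assert (Hsum : forall n, (sum_n b n <= s 0%nat - s (S n))%R).
  { induction n as [| n IH].
    - rewrite sum_O. apply Hb.
    - rewrite sum_Sn. unfold plus; simpl. specialize (Hb (S n)). lra. }
  assert (E : ex_finite_lim_seq (sum_n b)).
  { apply ex_finite_lim_seq_incr with (s 0%nat).
    - intro n. rewrite sum_Sn. unfold plus; simpl. specialize (Hb (S n)). lra.
    - intro n. specialize (Hsum n). specialize (Hs (S n)). lra. }
  split.
  - destruct E as [l Hl]. exists l. exact Hl.
  - destruct E as [l Hl]. rewrite (is_series_unique b l Hl).
    apply (is_lim_seq_le (sum_n b) (fun _ => s 0%nat) l (s 0%nat)).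
    + intro n. specialize (Hsum n). specialize (Hs (S n)). lra.
    + exact Hl.
    + apply is_lim_seq_const.
Qed.

Lemma CSeries_telescope (u : nat -> C) (s : nat -> R) :
  (forall j, Cmod (u j) <= s j - s (S j))%R -> (forall j, 0 <= s j)%R ->
  abs_conv u /\ (Cmod (CSeries u) <= s 0%nat)%R.
Proof.
  intros Hu Hs.
  destruct (series_telescope (fun k => Cmod (u k)) s) as [H1 H2]; auto.
  - intro j. split; [apply Cmod_ge_0 | apply Hu].
  - split; [exact H1 |]. eapply Rle_trans; [now apply Cmod_CSeries_le | exact H2].
Qed.

(** [gfrac p j = j! / (j + p)!], the discrete power whose tail sums telescope. *)
Fixpoint gfrac (p j : nat) : R :=
  match p with
  | O => 1
  | S p' => gfrac p' j / INR (j + S p')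
  end.

Lemma gfrac_S (p j : nat) : gfrac (S p) j = (gfrac p j / INR (j + S p))%R.
Proof. reflexivity. Qed.

Lemma gfrac_pos (p j : nat) : (0 < gfrac p j)%R.
Proof.
  induction p as [| p IH]; simpl; [lra |].
  apply Rdiv_lt_0_compat; [exact IH |]. apply lt_0_INR. lia.
Qed.

Lemma gfrac_shift (p j : nat) :
  (gfrac p (S j) * INR (j + S p) = gfrac p j * INR (S j))%R.
Proof.
  induction p as [| p IH].
  - simpl gfrac. rewrite Nat.add_1_r. lra.
  - rewrite !gfrac_S. replace (S j + S p)%nat with (j + S (S p))%nat by lia.
    assert (H1 : (INR (j + S (S p)) <> 0)%R) by (apply not_0_INR; lia).
    assert (H2 : (INR (j + S p) <> 0)%R) by (apply not_0_INR; lia).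
    replace (gfrac p (S j) / INR (j + S (S p)) * INR (j + S (S p)))%R
      with (gfrac p (S j) * INR (j + S p) / INR (j + S p))%R by (now field).
    rewrite IH. now field.
Qed.

Lemma gfrac_telescope (p j : nat) :
  (gfrac p j - gfrac p (S j) = INR p * gfrac (S p) j)%R.
Proof.
  assert (H2 : (INR (j + S p) <> 0)%R) by (apply not_0_INR; lia).
  rewrite gfrac_S. apply Rmult_eq_reg_r with (INR (j + S p)); [| exact H2].
  rewrite Rmult_minus_distr_r, gfrac_shift.
  replace (INR p * (gfrac p j / INR (j + S p)) * INR (j + S p))%R
    with (INR p * gfrac p j)%R by (now field).
  replace (j + S p)%nat with (p + S j)%nat by lia. rewrite plus_INR. ring.
Qed.

Lemma gfrac_decr (p j : nat) : (gfrac p (S j) <= gfrac p j)%R.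
Proof.
  pose proof (gfrac_telescope p j). pose proof (gfrac_pos (S p) j).
  pose proof (pos_INR p). nra.
Qed.

Lemma gfrac_le_shift (p j : nat) : (gfrac p j <= INR (S p) * gfrac p (S j))%R.
Proof.
  pose proof (gfrac_shift p j) as E. pose proof (gfrac_pos p (S j)) as H.
  pose proof (gfrac_pos p j) as H'.
  replace (j + S p)%nat with (S p + j)%nat in E by lia.
  rewrite plus_INR in E. rewrite !S_INR in *.
  pose proof (pos_INR p) as Hp. pose proof (pos_INR j) as Hj.
  apply Rmult_le_reg_r with (INR j + 1)%R; [lra |]. rewrite <- E.
  pose proof (Rmult_le_pos _ _ (Rlt_le _ _ H) (Rmult_le_pos _ _ Hp Hj)). lra.
Qed.

Lemma gfrac_INR_le (p j : nat) : (INR j * gfrac (S p) j <= gfrac p j)%R.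
Proof.
  rewrite gfrac_S. pose proof (gfrac_pos p j).
  assert (0 < INR (j + S p))%R by (apply lt_0_INR; lia).
  assert (INR j <= INR (j + S p))%R by (apply le_INR; lia).
  replace (INR j * (gfrac p j / INR (j + S p)))%R
    with (gfrac p j * (INR j / INR (j + S p)))%R by (field; lra).
  assert (INR j / INR (j + S p) <= 1)%R.
  { apply Rle_div_l; lra. }
  nra.
Qed.

Lemma gfrac_S_le (p j : nat) : (gfrac (S p) j <= gfrac p j)%R.
Proof.
  rewrite gfrac_S. pose proof (gfrac_pos p j).
  assert (1 <= INR (j + S p))%R by (apply (le_INR 1); lia).
  apply Rle_div_l; nra.
Qed.

Definition decay (A : R) (p : nat) (c : nat -> C) : Prop :=
  forall j, (Cmod (c j) <= A * gfrac p j)%R.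

(** These are the Taylor coefficients of functions that are holomorphic in the disc and smooth up to
    the circle. *)
Definition rapid (c : nat -> C) : Prop := forall p, exists A, decay A p c.

Lemma decay_nonneg (A : R) (p : nat) (c : nat -> C) : decay A p c -> (0 <= A)%R.
Proof.
  intros H. specialize (H 0%nat). pose proof (Cmod_ge_0 (c 0%nat)).
  pose proof (gfrac_pos p 0). nra.
Qed.

Definition ev (c : nat -> C) (w : C) : C := CSeries (fun m => c m * w ^ m).

Lemma Cmod_pow_le_1 (w : C) (m : nat) : (Cmod w <= 1)%R -> (Cmod (w ^ m) <= 1)%R.
Proof.
  intros H. rewrite Cmod_pow. pose proof (Cmod_ge_0 w).
  rewrite <- (pow1 m). apply pow_incr. lra.
Qed.

Lemma Cmod_mult_pow_le (x w : C) (m : nat) :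
  (Cmod w <= 1)%R -> (Cmod (x * w ^ m) <= Cmod x)%R.
Proof.
  intros H. rewrite Cmod_mult. pose proof (Cmod_pow_le_1 w m H).
  pose proof (Cmod_ge_0 x). nra.
Qed.

(** Order two telescopes to order one, and [gfrac 1 0 = 1] keeps the constant [A]. *)
Lemma ev_decay (A : R) (c : nat -> C) (w : C) :
  decay A 2 c -> (Cmod w <= 1)%R ->
  abs_conv (fun m => c m * w ^ m) /\ (Cmod (ev c w) <= A)%R.
Proof.
  intros Hc Hw. pose proof (decay_nonneg _ _ _ Hc) as HA.
  destruct (CSeries_telescope (fun m => c m * w ^ m)
              (fun j => A * gfrac 1 j)%R) as [H1 H2].
  - intro j. eapply Rle_trans; [now apply Cmod_mult_pow_le |].
    eapply Rle_trans; [apply Hc |]. rewrite <- Rmult_minus_distr_l.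
    rewrite gfrac_telescope. simpl INR. lra.
  - intro j. pose proof (gfrac_pos 1 j). nra.
  - split; [exact H1 |]. simpl in H2. unfold ev. lra.
Qed.

Lemma rapid_abs_conv (c : nat -> C) (w : C) :
  rapid c -> (Cmod w <= 1)%R -> abs_conv (fun m => c m * w ^ m).
Proof. intros Hc Hw. destruct (Hc 2%nat) as [A HA]. now apply (ev_decay A). Qed.

Definition sshift (c : nat -> C) (m : nat) : C :=
  match m with O => 0 | S m' => c m' end.
Definition sone (m : nat) : C := match m with O => 1 | _ => 0 end.
Definition splus (c d : nat -> C) (m : nat) : C := c m + d m.
Definition sscal (x : C) (c : nat -> C) (m : nat) : C := x * c m.
(** Coefficients of [w d/dw], which is [d/dz] up to the factor [i / 2] when [w = e^{iz/2}]. *)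
Definition seuler (c : nat -> C) (m : nat) : C := RtoC (INR m) * c m.

Lemma rapid_shift (c : nat -> C) : rapid c -> rapid (sshift c).
Proof.
  intros H p. destruct (H p) as [A HA]. exists (A * INR (S p))%R.
  pose proof (decay_nonneg _ _ _ HA) as H0.
  intros [| j].
  - simpl sshift. rewrite Cmod_0. apply Rmult_le_pos; [| left; apply gfrac_pos].
    apply Rmult_le_pos; [exact H0 | apply pos_INR].
  - simpl sshift. eapply Rle_trans; [apply HA |].
    rewrite Rmult_assoc. apply Rmult_le_compat_l; [exact H0 | apply gfrac_le_shift].
Qed.

Lemma rapid_plus (c d : nat -> C) : rapid c -> rapid d -> rapid (splus c d).
Proof.
  intros Hc Hd p. destruct (Hc p) as [A HA], (Hd p) as [B HB].
  exists (A + B)%R. intro j. eapply Rle_trans; [apply Cmod_triangle |].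
  rewrite Rmult_plus_distr_r. apply Rplus_le_compat; auto.
Qed.

Lemma rapid_scal (x : C) (c : nat -> C) : rapid c -> rapid (sscal x c).
Proof.
  intros Hc p. destruct (Hc p) as [A HA].
  exists (Cmod x * A)%R. intro j. unfold sscal. rewrite Cmod_mult, Rmult_assoc.
  apply Rmult_le_compat_l; [apply Cmod_ge_0 | auto].
Qed.

Lemma rapid_euler (c : nat -> C) : rapid c -> rapid (seuler c).
Proof.
  intros Hc p. destruct (Hc (S p)) as [A HA]. exists A. intro j.
  pose proof (decay_nonneg _ _ _ HA) as H0.
  unfold seuler. rewrite Cmod_mult, Cmod_R, Rabs_pos_eq by apply pos_INR.
  pose proof (pos_INR j). specialize (HA j).
  apply Rle_trans with (A * (INR j * gfrac (S p) j))%R; [nra |].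
  apply Rmult_le_compat_l; [exact H0 | apply gfrac_INR_le].
Qed.

Lemma rapid_one : rapid sone.
Proof.
  intros p. exists (/ gfrac p 0)%R. pose proof (gfrac_pos p 0) as H0.
  intros [| j]; simpl sone.
  - rewrite Cmod_1. rewrite Rinv_l; lra.
  - rewrite Cmod_0. pose proof (gfrac_pos p (S j)).
    apply Rmult_le_pos; [left; now apply Rinv_0_lt_compat | lra].
Qed.

Lemma ev_plus (c d : nat -> C) (w : C) :
  rapid c -> rapid d -> (Cmod w <= 1)%R -> ev (splus c d) w = ev c w + ev d w.
Proof.
  intros Hc Hd Hw. unfold ev. rewrite <- CSeries_plus.
  - apply CSeries_ext. intro k. unfold splus. ring.
  - now apply rapid_abs_conv.
  - now apply rapid_abs_conv.
Qed.

Lemma ev_scal (x : C) (c : nat -> C) (w : C) :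
  rapid c -> (Cmod w <= 1)%R -> ev (sscal x c) w = x * ev c w.
Proof.
  intros Hc Hw. unfold ev. rewrite <- CSeries_scal.
  - apply CSeries_ext. intro k. unfold sscal. ring.
  - now apply rapid_abs_conv.
Qed.

Lemma ev_shift (c : nat -> C) (w : C) :
  rapid c -> (Cmod w <= 1)%R -> ev (sshift c) w = w * ev c w.
Proof.
  intros Hc Hw. unfold ev. rewrite CSeries_incr_1.
  - simpl sshift. rewrite <- CSeries_scal by now apply rapid_abs_conv.
    rewrite Cmult_0_l, Cplus_0_l. apply CSeries_ext. intro k. simpl. ring.
  - apply rapid_abs_conv; [now apply rapid_shift | exact Hw].
Qed.

Lemma CSeries_0 : CSeries (fun _ => 0) = 0.
Proof.
  assert (H : abs_conv (fun _ => 0)).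
  { apply (CSeries_telescope (fun _ => 0) (fun _ => 0%R)); intros; [rewrite Cmod_0|]; lra. }
  pose proof (CSeries_scal 0 (fun _ => 0) H) as E. rewrite Cmult_0_l in E.
  etransitivity; [| exact E]. apply CSeries_ext. intro. ring.
Qed.

Lemma ev_at_0 (c : nat -> C) : rapid c -> ev c 0 = c 0%nat.
Proof.
  intros Hc. unfold ev. rewrite CSeries_incr_1.
  - rewrite (CSeries_ext _ (fun _ => 0)); [rewrite CSeries_0 |]; intros; simpl; ring.
  - apply rapid_abs_conv; [exact Hc | rewrite Cmod_0; lra].
Qed.

Lemma ev_one (w : C) : (Cmod w <= 1)%R -> ev sone w = 1.
Proof.
  intros Hw. unfold ev. rewrite CSeries_incr_1.
  - rewrite (CSeries_ext _ (fun _ => 0)); [rewrite CSeries_0 |]; intros; simpl; ring.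
  - apply rapid_abs_conv; [apply rapid_one | exact Hw].
Qed.

(** Coefficients of [(ev c w - ev c w0) / (w - w0)]. *)
Definition sdiv (w0 : C) (c : nat -> C) (m : nat) : C :=
  CSeries (fun j => c (S m + j)%nat * w0 ^ j).

(** A tail sum of [gfrac (p + 2)] is [gfrac (p + 1)] divided by [p + 1]. One order is lost, and the
    gained factor must be recorded: over [k] divisions it accumulates to a factorial. *)
Lemma sdiv_decay (A : R) (p : nat) (w0 : C) (c : nat -> C) :
  (Cmod w0 <= 1)%R -> decay A (S (S p)) c ->
  decay (A / INR (S p)) (S p) (sdiv w0 c).
Proof.
  intros Hw Hc m. pose proof (decay_nonneg _ _ _ Hc) as HA.
  assert (Hp : (0 < INR (S p))%R) by (apply lt_0_INR; lia).
  destruct (CSeries_telescope (fun j => c (S m + j)%nat * w0 ^ j)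
              (fun j => A / INR (S p) * gfrac (S p) (S m + j))%R) as [H1 H2].
  - intro j. eapply Rle_trans; [now apply Cmod_mult_pow_le |].
    eapply Rle_trans; [apply Hc |]. rewrite <- Rmult_minus_distr_l.
    replace (S m + S j)%nat with (S (S m + j)) by lia.
    rewrite gfrac_telescope. apply Req_le. field. lra.
  - intro j. pose proof (gfrac_pos (S p) (S m + j)).
    apply Rmult_le_pos; [| lra]. apply Rdiv_le_0_compat; lra.
  - unfold sdiv. eapply Rle_trans; [exact H2 |]. rewrite Nat.add_0_r.
    apply Rmult_le_compat_l; [apply Rdiv_le_0_compat; lra | apply gfrac_decr].
Qed.

Lemma decay_weaken (A : R) (p : nat) (c : nat -> C) :
  decay A (S p) c -> decay A p c.
Proof.
  intros H j. pose proof (decay_nonneg _ _ _ H).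
  eapply Rle_trans; [apply H |]. apply Rmult_le_compat_l; [assumption | apply gfrac_S_le].
Qed.

Lemma rapid_div (w0 : C) (c : nat -> C) :
  (Cmod w0 <= 1)%R -> rapid c -> rapid (sdiv w0 c).
Proof.
  intros Hw Hc p. destruct (Hc (S (S p))) as [A HA].
  exists (A / INR (S p))%R. apply decay_weaken. now apply sdiv_decay.
Qed.

Lemma rapid_abs_conv_tail (w0 : C) (c : nat -> C) (m : nat) :
  (Cmod w0 <= 1)%R -> rapid c -> abs_conv (fun j => c (m + j)%nat * w0 ^ j).
Proof.
  intros Hw Hc. destruct (Hc 2%nat) as [A HA].
  pose proof (decay_nonneg _ _ _ HA).
  apply (CSeries_telescope _ (fun j => A * gfrac 1 (m + j))%R).
  - intro j. eapply Rle_trans; [now apply Cmod_mult_pow_le |].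
    eapply Rle_trans; [apply HA |]. rewrite <- Rmult_minus_distr_l.
    replace (m + S j)%nat with (S (m + j)) by lia.
    rewrite gfrac_telescope. simpl INR. lra.
  - intro j. pose proof (gfrac_pos 1 (m + j)). nra.
Qed.

Definition slin (w0 : C) (c : nat -> C) : nat -> C :=
  splus (sshift c) (sscal (- w0) c).

Lemma rapid_lin (w0 : C) (c : nat -> C) : rapid c -> rapid (slin w0 c).
Proof. intros. apply rapid_plus; [now apply rapid_shift | now apply rapid_scal]. Qed.

Lemma ev_lin (w0 : C) (c : nat -> C) (w : C) :
  rapid c -> (Cmod w <= 1)%R -> ev (slin w0 c) w = (w - w0) * ev c w.
Proof.
  intros Hc Hw. unfold slin.
  rewrite ev_plus, ev_shift, ev_scal; auto using rapid_shift, rapid_scal. ring.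
Qed.

(** Synthetic division: the tail sum starting at [m] is [c m] plus [w0] times the tail sum starting
    at [m + 1]. *)
Lemma sdiv_spec (w0 : C) (c : nat -> C) :
  (Cmod w0 <= 1)%R -> rapid c ->
  c = splus (slin w0 (sdiv w0 c)) (sscal (ev c w0) sone).
Proof.
  intros Hw Hc. apply functional_extensionality. intro m.
  unfold slin, splus, sscal.
  assert (E : forall m, CSeries (fun j => c (m + j)%nat * w0 ^ j) = c m + w0 * sdiv w0 c m).
  { intro k. rewrite CSeries_incr_1 by now apply rapid_abs_conv_tail.
    rewrite Nat.add_0_r. unfold sdiv.
    rewrite <- CSeries_scal by now apply rapid_abs_conv_tail.
    f_equal; [simpl; ring |]. apply CSeries_ext. intro j.
    replace (k + S j)%nat with (S k + j)%nat by lia. simpl. ring. }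
  destruct m as [| m]; simpl sshift; simpl sone.
  - change (ev c w0) with (CSeries (fun j => c (0 + j)%nat * w0 ^ j)).
    rewrite (E 0%nat). ring.
  - change (sdiv w0 c m) with (CSeries (fun j => c (S m + j)%nat * w0 ^ j)).
    rewrite (E (S m)). ring.
Qed.

Lemma ev_div (w0 w : C) (c : nat -> C) :
  (Cmod w0 <= 1)%R -> (Cmod w <= 1)%R -> rapid c ->
  ev c w = ev c w0 + (w - w0) * ev (sdiv w0 c) w.
Proof.
  intros H0 H Hc. rewrite (sdiv_spec w0 c) at 1 by assumption.
  rewrite ev_plus, ev_lin, ev_scal, ev_one; auto using rapid_lin, rapid_div, rapid_scal, rapid_one.
  ring.
Qed.

Lemma ev_lipschitz (w0 : C) (c : nat -> C) :
  (Cmod w0 <= 1)%R -> rapid c ->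
  exists B, (0 <= B)%R /\ forall w, (Cmod w <= 1)%R ->
    (Cmod (ev c w - ev c w0) <= B * Cmod (w - w0))%R.
Proof.
  intros H0 Hc. destruct (rapid_div w0 c H0 Hc 2%nat) as [B HB].
  exists B. split; [now apply decay_nonneg in HB |].
  intros w Hw. rewrite (ev_div w0 w) by assumption.
  replace (ev c w0 + (w - w0) * ev (sdiv w0 c) w - ev c w0)
    with ((w - w0) * ev (sdiv w0 c) w) by ring.
  rewrite Cmod_mult, Rmult_comm. apply Rmult_le_compat_r; [apply Cmod_ge_0 |].
  now apply ev_decay.
Qed.

(** Leibniz rule for [w d/dw], which maps [w - w0] to [w]. *)
Lemma slin_euler (w0 : C) (d : nat -> C) :
  seuler (slin w0 d) = splus (slin w0 (seuler d)) (sshift d).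
Proof.
  apply functional_extensionality. intros [| m]; unfold seuler, slin, splus, sscal; simpl sshift.
  - simpl INR. ring.
  - rewrite S_INR, RtoC_plus. ring.
Qed.

Lemma ev_euler (w0 : C) (c : nat -> C) :
  (Cmod w0 <= 1)%R -> rapid c -> ev (seuler c) w0 = w0 * ev (sdiv w0 c) w0.
Proof.
  intros H0 Hc. set (d := sdiv w0 c).
  assert (Hd : rapid d) by now apply rapid_div.
  assert (E : seuler c = splus (slin w0 (seuler d)) (sshift d)).
  { rewrite <- slin_euler, (sdiv_spec w0 c) by assumption. fold d.
    apply functional_extensionality. intro m. unfold seuler, splus, sscal.
    destruct m; simpl sone; simpl INR; ring. }
  rewrite E, ev_plus, ev_lin, ev_shift; auto using rapid_lin, rapid_euler, rapid_shift.
  ring.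
Qed.

(** * The maximum principle and zeros of infinite order *)

Definition cis (t : R) : C := (cos t, sin t).

Lemma cis_plus (s t : R) : cis (s + t) = cis s * cis t.
Proof. unfold cis. rewrite cos_plus, sin_plus. apply C_ext; simpl; ring. Qed.

Lemma cis_pow (t : R) (n : nat) : cis t ^ n = cis (INR n * t).
Proof.
  induction n as [| n IH].
  - simpl. rewrite Rmult_0_l. unfold cis. now rewrite cos_0, sin_0.
  - rewrite Cpow_S, IH, <- cis_plus. f_equal. rewrite S_INR. ring.
Qed.

Lemma Cmod_cis (t : R) : Cmod (cis t) = 1%R.
Proof.
  unfold cis, Cmod; cbn [fst snd]. rewrite <- sqrt_1. f_equal.
  pose proof (sin2_cos2 t) as H. unfold Rsqr in H. simpl. lra.
Qed.

Fixpoint csum (f : nat -> C) (n : nat) : C :=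
  match n with O => 0 | S k => csum f k + f k end.

Lemma csum_ext (f g : nat -> C) (n : nat) :
  (forall k, f k = g k) -> csum f n = csum g n.
Proof. intros H. induction n; simpl; [| rewrite IHn, H]; reflexivity. Qed.

Lemma csum_plus (f g : nat -> C) (n : nat) :
  csum (fun k => f k + g k) n = csum f n + csum g n.
Proof. induction n as [| n IH]; simpl; [| rewrite IH]; ring. Qed.

Lemma csum_scal (a : C) (f : nat -> C) (n : nat) :
  csum (fun k => a * f k) n = a * csum f n.
Proof. induction n as [| n IH]; simpl; [| rewrite IH]; ring. Qed.

Lemma csum_const (a : C) (n : nat) : csum (fun _ => a) n = RtoC (INR n) * a.
Proof.
  induction n as [| n IH]; simpl csum; [simpl INR | rewrite IH, S_INR, RtoC_plus]; ring.
Qed.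

Lemma Cmod_csum_le (f : nat -> C) (B : R) (n : nat) :
  (forall k, Cmod (f k) <= B)%R -> (Cmod (csum f n) <= INR n * B)%R.
Proof.
  intros H. induction n as [| n IH].
  - simpl. rewrite Cmod_0. lra.
  - simpl csum. rewrite S_INR. eapply Rle_trans; [apply Cmod_triangle |].
    specialize (H n). lra.
Qed.

Lemma csum_geometric (q : C) (n : nat) : (1 - q) * csum (fun k => q ^ k) n = 1 - q ^ n.
Proof. induction n as [| n IH]; simpl; [ring |]. rewrite Cmult_plus_distr_l, IH. ring. Qed.

Fixpoint horner (l : list C) (w : C) : C :=
  match l with
  | nil => 0
  | a :: l' => a + w * horner l' w
  end.

Definition root_unity (n : nat) : C := cis (2 * PI / INR n).

Lemma root_unity_pow_neq_1 (n s : nat) : (0 < s < n)%nat -> root_unity n ^ s <> 1.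
Proof.
  intros Hs. assert (Hn : (0 < INR n)%R) by (apply lt_0_INR; lia).
  assert (Hsn : (INR s < INR n)%R) by (apply lt_INR; lia).
  assert (Hs0 : (0 < INR s)%R) by (apply lt_0_INR; lia).
  unfold root_unity. rewrite cis_pow. intro H. apply (f_equal Re) in H.
  simpl in H. set (t := (INR s / INR n * PI)%R).
  replace (INR s * (2 * PI / INR n))%R with (2 * t)%R in H by (unfold t; field; lra).
  rewrite cos_2a_sin in H.
  assert (Hr : (0 < INR s / INR n < 1)%R).
  { split; [now apply Rdiv_lt_0_compat |]. apply Rlt_div_l; lra. }
  pose proof PI_RGT_0.
  assert (0 < sin t)%R by (apply sin_gt_0; unfold t; nra).
  nra.
Qed.

Lemma root_unity_pow_n (n : nat) : (0 < n)%nat -> root_unity n ^ n = 1.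
Proof.
  intros Hn. unfold root_unity. rewrite cis_pow.
  replace (INR n * (2 * PI / INR n))%R with (2 * PI)%R
    by (field; apply not_0_INR; lia).
  unfold cis. now rewrite cos_2PI, sin_2PI.
Qed.

(** A monomial of degree strictly between [0] and [n] sums to zero over the [n]-th roots of unity,
    by the geometric sum. The extra power [s] makes the induction on the coefficient list
    possible. *)
Lemma horner_mean_aux (n : nat) (l : list C) (s : nat) :
  (0 < s)%nat -> (s + length l <= n)%nat ->
  csum (fun j => (root_unity n ^ j) ^ s * horner l (root_unity n ^ j)) n = 0.
Proof.
  revert s. induction l as [| a l IH]; intros s Hs Hl.
  - rewrite (csum_ext _ (fun _ => 0)) by (intro; simpl; ring).
    rewrite csum_const. ring.
  - simpl length in Hl.
    rewrite (csum_ext _ (fun j => a * (root_unity n ^ s) ^ j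
       + (root_unity n ^ j) ^ S s * horner l (root_unity n ^ j))).
    + rewrite csum_plus, IH, csum_scal by lia.
      assert (E : csum (fun k => (root_unity n ^ s) ^ k) n = 0);
        [| change (a * csum (fun k => (root_unity n ^ s) ^ k) n + 0 = 0); rewrite E; ring].
      assert (Hne : 1 - root_unity n ^ s <> 0).
      { intro H. apply (root_unity_pow_neq_1 n s); [lia |].
        replace (root_unity n ^ s) with (1 - (1 - root_unity n ^ s)) by ring.
        rewrite H. ring. }
      replace (csum (fun k => (root_unity n ^ s) ^ k) n)
        with (/ (1 - root_unity n ^ s)
              * ((1 - root_unity n ^ s) * csum (fun k => (root_unity n ^ s) ^ k) n))
        by (field; exact Hne).
      rewrite csum_geometric, <- Cpow_mult_r, Nat.mul_comm, Cpow_mult_r.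
      rewrite root_unity_pow_n, Cpow_1_l by lia. ring.
    + intro j. simpl horner. rewrite <- !Cpow_mult_r, (Nat.mul_comm s j).
      rewrite Nat.mul_succ_r, Cpow_add_r. ring.
Qed.

(** Discrete mean value property: averaging over more roots of unity than there are coefficients
    leaves only the constant term. It plays the role of Cauchy's formula in the maximum
    principle. *)
Lemma horner_mean (n : nat) (l : list C) :
  (length l < n)%nat ->
  csum (fun j => horner l (root_unity n ^ j)) n = RtoC (INR n) * horner l 0.
Proof.
  intros Hl. destruct l as [| a l].
  - simpl horner. apply csum_const.
  - simpl horner. simpl length in Hl. rewrite csum_plus, csum_const.
    rewrite (csum_ext _ (fun j => (root_unity n ^ j) ^ 1 * horner l (root_unity n ^ j)))
      by (intro; rewrite Cpow_1_r; reflexivity).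
    rewrite horner_mean_aux by lia. ring.
Qed.

Lemma horner_max (l : list C) (B : R) :
  (forall w, Cmod w = 1%R -> (Cmod (horner l w) <= B)%R) ->
  (Cmod (horner l 0) <= B)%R.
Proof.
  intros H. set (n := S (length l)).
  assert (Hn : (0 < INR n)%R) by (apply lt_0_INR; lia).
  apply Rmult_le_reg_l with (INR n); [exact Hn |].
  rewrite <- (Rabs_pos_eq (INR n)) at 1 by lra.
  rewrite <- Cmod_R, <- Cmod_mult, <- horner_mean by lia.
  apply Cmod_csum_le. intro k. apply H. rewrite Cmod_pow. unfold root_unity.
  rewrite Cmod_cis. apply pow1.
Qed.

(** * The disc algebra: uniform limits of polynomials on the closed disc *)

Definition is_poly (F : C -> C) : Prop := exists l, forall w, F w = horner l w.

Lemma is_poly_const (a : C) : is_poly (fun _ => a).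
Proof. exists (a :: nil). intro. simpl. ring. Qed.

Lemma is_poly_plus (F G : C -> C) : is_poly F -> is_poly G -> is_poly (fun w => F w + G w).
Proof.
  intros [l Hl] [l' Hl'].
  assert (H : exists l'', forall w, horner l'' w = horner l w + horner l' w).
  { clear. revert l'. induction l as [| a l IH]; intros [| b l'].
    - exists nil. intro. simpl. ring.
    - exists (b :: l'). intro. simpl. ring.
    - exists (a :: l). intro. simpl. ring.
    - destruct (IH l') as [l'' H]. exists (a + b :: l''). intro. simpl. rewrite H. ring. }
  destruct H as [l'' H]. exists l''. intro. now rewrite Hl, Hl', H.
Qed.

Lemma is_poly_shift (F : C -> C) : is_poly F -> is_poly (fun w => w * F w).
Proof. intros [l Hl]. exists (RtoC 0 :: l). intro w. rewrite Hl. simpl. ring. Qed.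

Lemma is_poly_scal (a : C) (F : C -> C) : is_poly F -> is_poly (fun w => a * F w).
Proof.
  intros [l Hl]. exists (map (fun b : C => a * b) l). intro w. rewrite Hl. clear.
  induction l as [| b l IH]; simpl; [| rewrite <- IH]; ring.
Qed.

Lemma is_poly_ext (F G : C -> C) : (forall w, F w = G w) -> is_poly F -> is_poly G.
Proof. intros H [l Hl]. exists l. intro. now rewrite <- H. Qed.

Lemma is_poly_mult (F G : C -> C) : is_poly F -> is_poly G -> is_poly (fun w => F w * G w).
Proof.
  intros [l Hl] HG. apply is_poly_ext with (fun w => horner l w * G w);
    [intro; now rewrite Hl |].
  clear F Hl. induction l as [| a l IH].
  - apply is_poly_ext with (fun _ => 0); [intro; simpl; ring | apply is_poly_const].
  - apply is_poly_ext with (fun w => a * G w + w * (horner l w * G w)).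
    + intro. simpl. ring.
    + apply is_poly_plus; [now apply is_poly_scal | now apply is_poly_shift].
Qed.

Lemma horner_bounded (l : list C) :
  exists B, (0 <= B)%R /\ forall w, (Cmod w <= 1)%R -> (Cmod (horner l w) <= B)%R.
Proof.
  induction l as [| a l [B [HB H]]].
  - exists 0%R. split; [lra |]. intros. simpl. rewrite Cmod_0. lra.
  - exists (Cmod a + B)%R. split; [pose proof (Cmod_ge_0 a); lra |].
    intros w Hw. simpl. eapply Rle_trans; [apply Cmod_triangle |].
    rewrite Cmod_mult. specialize (H w Hw). pose proof (Cmod_ge_0 w).
    pose proof (Cmod_ge_0 (horner l w)). nra.
Qed.

(** This class is closed under products and contains [ev c] as well as the kernels used at the
    boundary, while the bound at the centre passes to it directly from polynomials. *)
Definition poly_limit (F : C -> C) : Prop :=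
  forall eps, (0 < eps)%R -> exists P, is_poly P /\
    forall w, (Cmod w <= 1)%R -> (Cmod (F w - P w) <= eps)%R.

Lemma is_poly_limit (F : C -> C) : is_poly F -> poly_limit F.
Proof.
  intros H eps Heps. exists F. split; [exact H |]. intros w _.
  replace (F w - F w) with (RtoC 0) by ring. rewrite Cmod_0. lra.
Qed.

Lemma poly_limit_bounded (F : C -> C) :
  poly_limit F ->
  exists B, (0 <= B)%R /\ forall w, (Cmod w <= 1)%R -> (Cmod (F w) <= B)%R.
Proof.
  intros H. destruct (H 1%R Rlt_0_1) as [P [[l Hl] HP]].
  destruct (horner_bounded l) as [B [HB Hb]].
  exists (1 + B)%R. split; [lra |]. intros w Hw.
  replace (F w) with ((F w - P w) + horner l w) by (rewrite <- Hl; ring).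
  eapply Rle_trans; [apply Cmod_triangle |]. apply Rplus_le_compat; auto.
Qed.

Lemma poly_limit_plus (F G : C -> C) :
  poly_limit F -> poly_limit G -> poly_limit (fun w => F w + G w).
Proof.
  intros HF HG eps Heps.
  destruct (HF (eps / 2)%R) as [P [HP HFP]]; [lra |].
  destruct (HG (eps / 2)%R) as [Q [HQ HGQ]]; [lra |].
  exists (fun w => P w + Q w). split; [now apply is_poly_plus |].
  intros w Hw. replace (F w + G w - (P w + Q w)) with ((F w - P w) + (G w - Q w)) by ring.
  eapply Rle_trans; [apply Cmod_triangle |].
  specialize (HFP w Hw). specialize (HGQ w Hw). lra.
Qed.

Lemma poly_limit_mult (F G : C -> C) :
  poly_limit F -> poly_limit G -> poly_limit (fun w => F w * G w).
Proof.
  intros HF HG eps Heps.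
  destruct (poly_limit_bounded F HF) as [B [HB Hb]].
  destruct (HG (eps / (2 * (B + 1)))%R) as [Q [HQ HGQ]];
    [apply Rdiv_lt_0_compat; lra |].
  destruct (poly_limit_bounded Q (is_poly_limit Q HQ)) as [B' [HB' Hb']].
  destruct (HF (eps / (2 * (B' + 1)))%R) as [P [HP HFP]];
    [apply Rdiv_lt_0_compat; lra |].
  exists (fun w => P w * Q w). split; [now apply is_poly_mult |].
  intros w Hw.
  replace (F w * G w - P w * Q w) with (F w * (G w - Q w) + (F w - P w) * Q w) by ring.
  eapply Rle_trans; [apply Cmod_triangle |]. rewrite !Cmod_mult.
  specialize (HFP w Hw). specialize (HGQ w Hw). specialize (Hb w Hw). specialize (Hb' w Hw).
  assert (E1 : (eps / (2 * (B + 1)) * (B + 1) = eps / 2)%R) by (field; lra).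
  assert (E2 : (eps / (2 * (B' + 1)) * (B' + 1) = eps / 2)%R) by (field; lra).
  assert (Cmod (F w) * Cmod (G w - Q w) <= (B + 1) * (eps / (2 * (B + 1))))%R
    by (apply Rmult_le_compat; try apply Cmod_ge_0; lra).
  assert (Cmod (F w - P w) * Cmod (Q w) <= (eps / (2 * (B' + 1))) * (B' + 1))%R
    by (apply Rmult_le_compat; try apply Cmod_ge_0; lra).
  lra.
Qed.

Lemma poly_limit_const (a : C) : poly_limit (fun _ => a).
Proof. apply is_poly_limit, is_poly_const. Qed.

Lemma poly_limit_id : poly_limit (fun w => w).
Proof. apply is_poly_limit. exists (RtoC 0 :: RtoC 1 :: nil). intro. simpl. ring. Qed.

Lemma poly_limit_pow (F : C -> C) (n : nat) : poly_limit F -> poly_limit (fun w => F w ^ n).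
Proof.
  intros H. induction n as [| n IH]; simpl; [apply poly_limit_const |].
  now apply (poly_limit_mult F (fun w => F w ^ n)).
Qed.

Lemma poly_limit_csum (F : nat -> C -> C) (n : nat) :
  (forall k, poly_limit (F k)) -> poly_limit (fun w => csum (fun k => F k w) n).
Proof.
  intros H. induction n as [| n IH]; simpl; [apply poly_limit_const |].
  now apply (poly_limit_plus (fun w => csum (fun k => F k w) n) (F n)).
Qed.

Lemma poly_limit_max (F : C -> C) (B : R) :
  poly_limit F -> (forall w, Cmod w = 1%R -> (Cmod (F w) <= B)%R) ->
  (Cmod (F 0) <= B)%R.
Proof.
  intros HF HB. apply le_epsilon. intros eps Heps.
  destruct (HF (eps / 2)%R) as [P [[l Hl] HP]]; [lra |].
  assert (H : (Cmod (horner l 0) <= B + eps / 2)%R).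
  { apply horner_max. intros w Hw. rewrite <- Hl.
    replace (P w) with (F w + - (F w - P w)) by ring.
    eapply Rle_trans; [apply Cmod_triangle |]. rewrite Cmod_opp.
    specialize (HB w Hw). specialize (HP w (Req_le _ _ Hw)). lra. }
  rewrite <- Hl in H. replace (F 0) with ((F 0 - P 0) + P 0) by ring.
  eapply Rle_trans; [apply Cmod_triangle |].
  specialize (HP 0). rewrite Cmod_0 in HP. specialize (HP Rle_0_1). lra.
Qed.

Lemma pow_small_exists (x : R) (eps : R) :
  (0 <= x < 1)%R -> (0 < eps)%R -> exists N : nat, (x ^ N < eps)%R.
Proof.
  intros Hx Heps. destruct (pow_lt_1_zero x) with (y := eps) as [N HN]; auto.
  - rewrite Rabs_pos_eq; lra.
  - exists N. eapply Rle_lt_trans; [apply Rle_abs |]. apply HN. lia.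
Qed.

Lemma Cmod_rev_triangle (x y : C) : (Cmod x - Cmod y <= Cmod (x - y))%R.
Proof.
  pose proof (Cmod_triangle (x - y) y) as H.
  replace (x - y + y) with x in H by ring. lra.
Qed.

(** The approximants are the partial sums of the geometric series; each further term multiplies the
    error by [q w / b], of modulus at most [1 / b < 1]. *)
Lemma poly_limit_inv (b : R) (q : C) :
  (1 < b)%R -> (Cmod q <= 1)%R -> poly_limit (fun w => / (RtoC b - q * w)).
Proof.
  intros Hb Hq eps Heps.
  assert (Hb0 : RtoC b <> 0) by (intro H; injection H; lra).
  assert (Hib : (0 < / b < 1)%R).
  { split; [apply Rinv_0_lt_compat; lra |]. rewrite <- Rinv_1. apply Rinv_lt_contravar; lra. }
  set (P := fix P (n : nat) (w : C) : C :=
     match n with O => 0 | S n' => / RtoC b * (1 + w * (q * P n' w)) end).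
  assert (HP : forall n, is_poly (P n)).
  { induction n as [| n IH].
    - apply is_poly_const.
    - apply (is_poly_scal (/ RtoC b) (fun w => 1 + w * (q * P n w))).
      apply (is_poly_plus (fun _ => 1) (fun w => w * (q * P n w))); [apply is_poly_const |].
      apply (is_poly_shift (fun w => q * P n w)). now apply is_poly_scal. }
  assert (Hlow : forall w, (Cmod w <= 1)%R -> (b - 1 <= Cmod (RtoC b - q * w))%R).
  { intros w Hw. eapply Rle_trans; [| apply Cmod_rev_triangle].
    rewrite Cmod_R, Cmod_mult, Rabs_pos_eq by lra.
    pose proof (Cmod_ge_0 q). pose proof (Cmod_ge_0 w). nra. }
  assert (Herr : forall n w, (Cmod w <= 1)%R ->
     (Cmod (/ (RtoC b - q * w) - P n w) <= (/ b) ^ n * / (b - 1))%R).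
  { intros n w Hw. specialize (Hlow w Hw).
    assert (Hne : RtoC b - q * w <> 0).
    { intro H. rewrite H, Cmod_0 in Hlow. lra. }
    induction n as [| n IH].
    - simpl. replace (/ (RtoC b - q * w) - 0) with (/ (RtoC b - q * w)) by ring.
      rewrite Cmod_inv by exact Hne. rewrite Rmult_1_l.
      apply Rinv_le_contravar; lra.
    - simpl P.
      replace (/ (RtoC b - q * w) - / RtoC b * (1 + w * (q * P n w)))
        with (RtoC (/ b) * ((q * w) * (/ (RtoC b - q * w) - P n w))).
      + rewrite !Cmod_mult, Cmod_R, Rabs_pos_eq by lra. simpl pow. rewrite (Rmult_assoc (/ b) ((/ b) ^ n)).
        apply Rmult_le_compat_l; [lra |].
        pose proof (Cmod_ge_0 q). pose proof (Cmod_ge_0 w).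
        pose proof (Cmod_ge_0 (/ (RtoC b - q * w) - P n w)).
        assert (Cmod q * Cmod w <= 1)%R by nra. nra.
      + rewrite RtoC_inv by lra. field. split; assumption. }
  destruct (pow_small_exists (/ b) (eps * (b - 1))) as [N HN]; [lra | nra |].
  exists (P N). split; [apply HP |]. intros w Hw. eapply Rle_trans; [now apply Herr |].
  apply Rle_div_l; lra.
Qed.

Lemma rapid_tail (c : nat -> C) : rapid c -> rapid (fun j => c (S j)).
Proof.
  intros H p. destruct (H p) as [A HA]. exists A. intro j.
  pose proof (decay_nonneg _ _ _ HA).
  eapply Rle_trans; [apply HA |]. apply Rmult_le_compat_l; [assumption | apply gfrac_decr].
Qed.

Lemma poly_limit_ev (c : nat -> C) : rapid c -> poly_limit (ev c).
Proof.
  intros Hc.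
  assert (H : forall N c, rapid c -> exists P, is_poly P /\ forall w, (Cmod w <= 1)%R ->
     ev c w = P w + w ^ N * ev (fun j => c (N + j)%nat) w).
  { clear c Hc. induction N as [| N IH]; intros c Hc.
    - exists (fun _ => 0). split; [apply is_poly_const |]. intros w _.
      change (fun j => c (0 + j)%nat) with c. simpl. ring.
    - destruct (IH _ (rapid_tail c Hc)) as [P [HP H]].
      exists (fun w => c 0%nat + w * P w). split.
      + apply (is_poly_plus (fun _ => c 0%nat) (fun w => w * P w));
          [apply is_poly_const | now apply is_poly_shift].
      + intros w Hw. unfold ev at 1. rewrite CSeries_incr_1 by now apply rapid_abs_conv.
        rewrite (CSeries_ext _ (fun k => w * (c (S k) * w ^ k))) by (intro; simpl; ring).
        rewrite CSeries_scal.
        * fold (ev (fun j => c (S j)) w). rewrite (H w Hw).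
          change (fun j => c (S (N + j))) with (fun j => c (S N + j)%nat). simpl. ring.
        * apply (rapid_abs_conv (fun j => c (S j))); [now apply rapid_tail | exact Hw]. }
  intros eps Heps. destruct (Hc 2%nat) as [A HA].
  pose proof (decay_nonneg _ _ _ HA) as HA0.
  (* The tail from [N] on is at most [A / (N + 1)], hence this choice of [N]. *)
  destruct (nfloor_ex (A / eps)) as [N [_ HN]]; [apply Rdiv_le_0_compat; lra |].
  destruct (H N c Hc) as [P [HP HE]]. exists P. split; [exact HP |].
  intros w Hw. rewrite (HE w Hw).
  replace (P w + w ^ N * ev (fun j => c (N + j)%nat) w - P w)
    with (ev (fun j => c (N + j)%nat) w * w ^ N) by ring.
  eapply Rle_trans; [now apply Cmod_mult_pow_le |].
  destruct (CSeries_telescope (fun j => c (N + j)%nat * w ^ j)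
      (fun j => A * gfrac 1 (N + j))%R) as [_ H2].
  - intro j. eapply Rle_trans; [now apply Cmod_mult_pow_le |].
    eapply Rle_trans; [apply HA |]. rewrite <- Rmult_minus_distr_l.
    replace (N + S j)%nat with (S (N + j)) by lia. rewrite gfrac_telescope. simpl INR. lra.
  - intro j. pose proof (gfrac_pos 1 (N + j)). nra.
  - unfold ev. eapply Rle_trans; [exact H2 |]. rewrite gfrac_S. simpl gfrac.
    rewrite Nat.add_0_r, Nat.add_1_r, S_INR.
    apply Rlt_div_l in HN; [| lra]. pose proof (pos_INR N).
    unfold Rdiv. rewrite Rmult_1_l. apply Rle_div_l; nra.
Qed.

Lemma pow_bound_zero (x A y : R) :
  (0 <= x < 1)%R -> (forall k : nat, y <= A * x ^ k)%R -> (y <= 0)%R.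
Proof.
  intros Hx H. destruct (Rle_dec y 0) as [| Hy]; [assumption | exfalso].
  assert (HA : (0 < A)%R) by (specialize (H 0%nat); simpl in H; lra).
  destruct (pow_small_exists x (y / A)) as [N HN]; auto.
  - apply Rdiv_lt_0_compat; lra.
  - specialize (H N). apply Rlt_div_r in HN; lra.
Qed.

(** The Blaschke factor turns [(w - w0)^k] into a function of modulus [1] on
    the unit circle. *)
Lemma interior_zero_finite_order (c : nat -> C) (w0 : C) :
  rapid c -> (Cmod w0 < 1)%R ->
  (forall k, exists d, rapid d /\
     forall w, (Cmod w <= 1)%R -> ev c w = (w - w0) ^ k * ev d w) ->
  c 0%nat = 0.
Proof.
  intros Hc Hw0 H. destruct (Hc 2%nat) as [A HA].
  apply Cmod_eq_0. apply Rle_antisym; [| apply Cmod_ge_0].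
  apply (pow_bound_zero (Cmod w0) A); [split; [apply Cmod_ge_0 | exact Hw0] |].
  intro k. destruct (H k) as [d [Hd E]].
  set (F := fun w => (1 + - Cconj w0 * w) ^ k * ev d w).
  assert (HF : poly_limit F).
  { apply (poly_limit_mult (fun w => (1 + - Cconj w0 * w) ^ k) (ev d));
      [| now apply poly_limit_ev].
    apply (poly_limit_pow (fun w => 1 + - Cconj w0 * w)).
    apply (poly_limit_plus (fun _ => 1) (fun w => - Cconj w0 * w)); [apply poly_limit_const |].
    apply (poly_limit_mult (fun _ => - Cconj w0) (fun w => w));
      [apply poly_limit_const | apply poly_limit_id]. }
  assert (HB : (Cmod (F 0) <= A)%R).
  { apply poly_limit_max; [exact HF |]. intros w Hw.
    (* On the circle [1 = w * Cconj w], so the left side is the modulus of [Cconj (w - w0) * w]. *)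
    assert (E1 : Cmod (1 + - Cconj w0 * w) = Cmod (w - w0)).
    { replace (1 + - Cconj w0 * w) with (Cconj (w - w0) * w).
      - rewrite Cmod_mult, Cmod_conj, Hw. ring.
      - rewrite Cminus_conj.
        replace ((Cconj w - Cconj w0) * w) with (w * Cconj w + - Cconj w0 * w) by ring.
        rewrite <- Cmod2_conj, Hw. f_equal. f_equal. ring. }
    unfold F. rewrite Cmod_mult, Cmod_pow, E1, <- Cmod_pow, <- Cmod_mult, <- E by lra.
    apply ev_decay; [exact HA | lra]. }
  (* At the centre [F 0 = ev d 0], so [|c_0| = |w0|^k |F 0|], which tends to zero as [k] grows since
     [|w0| < 1]. *)
  rewrite <- (ev_at_0 c Hc), (E 0) by (rewrite Cmod_0; lra).
  rewrite Cmod_mult, Cmod_pow. replace (0 - w0) with (- w0) by ring.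
  rewrite Cmod_opp, Rmult_comm. unfold F in HB.
  replace ((1 + - Cconj w0 * 0) ^ k * ev d 0) with (ev d 0) in HB.
  - apply Rmult_le_compat_r; [apply pow_le, Cmod_ge_0 | exact HB].
  - replace (1 + - Cconj w0 * 0) with (RtoC 1) by ring. rewrite Cpow_1_l. ring.
Qed.

(** * Zeros of infinite order on the unit circle *)

Lemma fact_le_pow (k : nat) : (INR (fact k) <= INR k ^ k)%R.
Proof.
  induction k as [| k IH]; [simpl; lra |].
  rewrite fact_simpl, mult_INR, <- tech_pow_Rmult.
  apply Rmult_le_compat_l; [apply pos_INR |].
  eapply Rle_trans; [exact IH |]. apply pow_incr. split; [apply pos_INR |].
  rewrite S_INR. lra.
Qed.

(** Take [k] to be the integer part of [1 / (2 Q y)]. Then [(Q y)^k k! <= (Q y k)^k <= 2^-k],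
    whereas the exponential is at most [2^(k + 1)]. *)
Lemma flat_exp_bound (A Q y f : R) :
  (0 <= A)%R -> (0 < Q)%R -> (0 < y)%R ->
  (forall k : nat, f <= A * (Q * y) ^ k * INR (fact k))%R ->
  (f * exp (ln 2 / (2 * Q * y)) <= 2 * A)%R.
Proof.
  intros HA HQ Hy Hf.
  assert (HQy : (0 < 2 * Q * y)%R) by (apply Rmult_lt_0_compat; lra).
  destruct (nfloor_ex (/ (2 * Q * y))) as [k [Hk1 Hk2]];
    [left; now apply Rinv_0_lt_compat |].
  assert (Hln : (0 < ln 2)%R) by (rewrite <- ln_1; apply ln_increasing; lra).
  assert (He : (exp (ln 2 / (2 * Q * y)) <= 2 * 2 ^ k)%R).
  { replace (2 * 2 ^ k)%R with (exp (INR (S k) * ln 2)).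
    - destruct (Rle_lt_or_eq_dec (ln 2 / (2 * Q * y)) (INR (S k) * ln 2)) as [H | H].
      + unfold Rdiv. rewrite Rmult_comm. apply Rmult_le_compat_r; [lra |].
        rewrite S_INR. lra.
      + left. now apply exp_increasing.
      + rewrite H. lra.
    - change (2 * 2 ^ k)%R with (2 ^ S k)%R.
      rewrite <- (Rpower_pow (S k) 2) by lra. reflexivity. }
  assert (Hk : (Q * y * INR k <= / 2)%R).
  { apply Rmult_le_compat_r with (r := (2 * Q * y)%R) in Hk1; [| lra].
    rewrite Rinv_l in Hk1 by lra. lra. }
  pose proof (pos_INR k) as Hk0.
  assert (H1 : (f <= A * (/ 2) ^ k)%R).
  { eapply Rle_trans; [apply (Hf k) |]. rewrite Rmult_assoc.
    apply Rmult_le_compat_l; [exact HA |].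
    apply Rle_trans with ((Q * y) ^ k * INR k ^ k)%R.
    - apply Rmult_le_compat_l; [apply pow_le; nra | apply fact_le_pow].
    - rewrite <- Rpow_mult_distr. apply pow_incr. split; [| exact Hk].
      apply Rmult_le_pos; nra. }
  apply Rle_trans with (A * (/ 2) ^ k * (2 * 2 ^ k))%R.
  - apply Rle_trans with (A * (/ 2) ^ k * exp (ln 2 / (2 * Q * y)))%R.
    + apply Rmult_le_compat_r; [left; apply exp_pos | exact H1].
    + apply Rmult_le_compat_l; [| exact He].
      apply Rmult_le_pos; [exact HA | apply pow_le; lra].
  - rewrite pow_inv. apply Req_le. field. apply pow_nonzero. lra.
Qed.

Lemma exp_pow_nat (e : R) (M : nat) : (exp e ^ M = exp (INR M * e))%R.
Proof.
  induction M as [| M IH].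
  - simpl. rewrite Rmult_0_l. symmetry. apply exp_0.
  - simpl pow. rewrite IH, <- exp_plus. f_equal. rewrite S_INR. ring.
Qed.

(** The power replaces [exp x], so that a function built from [poly_limit] functions stays in that
    class. The bound is [1 + e <= exp e] applied to [|1 + x / M|^2 = 1 + e]. *)
Lemma Cmod_1_plus_pow_le (x : C) (M : nat) :
  (0 < M)%nat ->
  (Cmod ((1 + x / RtoC (INR M)) ^ M) <= exp (Re x + Cmod x ^ 2 / (2 * INR M)))%R.
Proof.
  intros HM. assert (H : (0 < INR M)%R) by (apply lt_0_INR; lia).
  apply Rsqr_incr_0; [| apply Cmod_ge_0 | left; apply exp_pos].
  unfold Rsqr. rewrite <- exp_plus, Cmod_pow, <- Rpow_mult_distr.
  set (e := (2 * Re x / INR M + Cmod x ^ 2 / INR M ^ 2)%R).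
  replace (Re x + Cmod x ^ 2 / (2 * INR M) + (Re x + Cmod x ^ 2 / (2 * INR M)))%R
    with (INR M * e)%R by (unfold e; field; lra).
  assert (E : (Cmod (1 + x / RtoC (INR M)) * Cmod (1 + x / RtoC (INR M)) = 1 + e)%R).
  { replace (Cmod (1 + x / INR M) * Cmod (1 + x / INR M))%R
      with (Cmod (1 + x / INR M) ^ 2)%R by ring.
    unfold e. rewrite !Cmod2_alt.
    replace (Re (1 + x / INR M)) with (1 + Re x / INR M)%R.
    - replace (Im (1 + x / INR M)) with (Im x / INR M)%R.
      + field. lra.
      + unfold Cdiv. rewrite <- RtoC_inv by lra. destruct x; simpl. field. lra.
    - unfold Cdiv. rewrite <- RtoC_inv by lra. destruct x; simpl. field. lra. }
  rewrite E.
  replace (exp (INR M * e)) with (exp e ^ M)%R.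
  - apply pow_incr. split; [rewrite <- E; apply Rle_0_sqr | apply exp_ineq1_le].
  - apply exp_pow_nat.
Qed.

(** Real part of the kernel [1 / (s + v) - 1 / 2] with [v = 1 - u] on the unit
    circle, and the telescoping majorant used to sum it over [s = 2^-i]. *)
Lemma Re_kernel_le (s : R) (u : C) :
  (0 < s)%R -> Cmod u = 1%R -> (0 < Cmod (1 - u))%R ->
  (Re (/ (RtoC (1 + s) - u) - / 2)
   <= 4 * (s / ((s + Cmod (1 - u)) * Cmod (1 - u))
           - (s / 2) / ((s / 2 + Cmod (1 - u)) * Cmod (1 - u))))%R.
Proof.
  intros Hs Hu Hy. set (y := Cmod (1 - u)) in *.
  assert (E1 : (y ^ 2 = 2 - 2 * Re u)%R).
  { unfold y. rewrite Cmod2_alt. pose proof (Cmod2_alt u) as H. rewrite Hu in H.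
    destruct u; simpl in *. lra. }
  pose proof (Cmod2_alt u) as E2. rewrite Hu in E2.
  assert (Hden : (0 < s ^ 2 + (1 + s) * y ^ 2)%R) by nra.
  assert (E3 : Re (/ (RtoC (1 + s) - u) - / 2)
               = ((s + y ^ 2 / 2) / (s ^ 2 + (1 + s) * y ^ 2) - / 2)%R).
  { rewrite <- RtoC_inv by lra.
    replace (Re (/ (RtoC (1 + s) - u) - RtoC (/ 2)))
      with ((1 + s - Re u) / ((1 + s - Re u) ^ 2 + (Im u) ^ 2) - / 2)%R.
    - replace ((1 + s - Re u) ^ 2 + Im u ^ 2)%R with (s ^ 2 + (1 + s) * y ^ 2)%R by (rewrite E1; lra).
      f_equal. f_equal. rewrite E1. lra.
    - destruct u as [a b]; simpl. unfold Rminus.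
      replace ((0 + - b) * ((0 + - b) * 1))%R with (b * (b * 1))%R by ring. reflexivity. }
  rewrite E3.
  (* Subtracting [/ 2] more than cancels the term [y ^ 2 / 2] of the numerator and leaves a
     Poisson-type kernel. *)
  apply Rle_trans with (s / (s ^ 2 + y ^ 2))%R.
  - apply Rle_trans with (s / (s ^ 2 + (1 + s) * y ^ 2))%R.
    + apply Rminus_le.
      replace ((s + y ^ 2 / 2) / (s ^ 2 + (1 + s) * y ^ 2) - / 2 - s / (s ^ 2 + (1 + s) * y ^ 2))%R
        with (- ((s ^ 2 + s * y ^ 2) / (2 * (s ^ 2 + (1 + s) * y ^ 2))))%R by (field; lra).
      apply Rge_le, Ropp_0_le_ge_contravar. apply Rdiv_le_0_compat; nra.
    + apply Rmult_le_compat_l; [lra |]. apply Rinv_le_contravar; nra.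
  (* The difference dominates the kernel because [(s + y) (s + 2 y) <= 4 (s^2 + y^2)]. *)
  - replace (4 * (s / ((s + y) * y) - s / 2 / ((s / 2 + y) * y)))%R
      with (4 * s / ((s + y) * (s + 2 * y)))%R by (field; lra).
    apply Rle_div_l; [nra |].
    replace (4 * s / ((s + y) * (s + 2 * y)) * (s ^ 2 + y ^ 2))%R
      with (s * (4 * (s ^ 2 + y ^ 2) / ((s + y) * (s + 2 * y))))%R by (field; lra).
    rewrite <- (Rmult_1_r s) at 1. apply Rmult_le_compat_l; [lra |].
    apply Rle_div_r; [nra |]. nra.
Qed.

(** A flat boundary zero would make [log |ev c|] tend to [-oo] like
    [- 1 / |w - w0|], which is not integrable on the circle.  The kernels
    [1 / (2^-i + 1 - u) - 1 / 2] build a function with real part at most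
    [4 / |1 - u|] on the circle but large at the centre. *)
Lemma flat_boundary_zero (c : nat -> C) (w0 : C) (A Q : R) :
  rapid c -> Cmod w0 = 1%R -> (0 <= A)%R -> (0 < Q)%R ->
  (forall (k : nat) w, (Cmod w <= 1)%R ->
     (Cmod (ev c w) <= A * (Q * Cmod (w - w0)) ^ k * INR (fact k))%R) ->
  c 0%nat = 0.
Proof.
  intros Hc Hw0 HA HQ Hflat.
  assert (Hln : (0 < ln 2)%R) by (rewrite <- ln_1; apply ln_increasing; lra).
  (* Chosen so that [g * (4 / y) = ln 2 / (2 Q y)], the exponent that [flat_exp_bound] can
     absorb. *)
  set (g := (ln 2 / (8 * Q))%R).
  assert (Hg : (0 < g)%R) by (apply Rdiv_lt_0_compat; lra).
  set (s := fun i : nat => ((/ 2) ^ S i)%R).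
  assert (Hs : forall i, (0 < s i <= / 2)%R).
  { intro i. unfold s. split; [apply pow_lt; lra |]. simpl.
    pose proof (pow_incr (/ 2) 1 i ltac:(lra)) as H. rewrite pow1 in H. nra. }
  set (X := fun (N : nat) (w : C) =>
     RtoC g * csum (fun i => / (RtoC (1 + s i) - Cconj w0 * w) - / 2) N).
  assert (HX : forall N, poly_limit (X N)).
  { intro N. apply (poly_limit_mult (fun _ => RtoC g)); [apply poly_limit_const |].
    apply (poly_limit_csum (fun i w => / (RtoC (1 + s i) - Cconj w0 * w) - / 2)).
    intro i. apply (poly_limit_plus (fun w => / (RtoC (1 + s i) - Cconj w0 * w)) (fun _ => - / 2)).
    - apply poly_limit_inv; [specialize (Hs i); lra |]. rewrite Cmod_conj. lra.
    - apply poly_limit_const. }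
  (* At the centre each kernel is [1 / (1 + s i) - 1 / 2 >= 2 / 3 - 1 / 2 = 1 / 6], so [X N 0] grows
     linearly in [N] while its bound on the circle does not depend on [N]. *)
  assert (HX0 : forall N, exists x : R, X N 0 = RtoC x /\ (g * INR N / 6 <= x)%R).
  { intro N.
    assert (E : exists r : R, csum (fun i => / (RtoC (1 + s i) - Cconj w0 * 0) - / 2) N = RtoC r
        /\ (INR N / 6 <= r)%R).
    { induction N as [| N [r [Er Hr]]].
      - exists 0%R. simpl. split; [reflexivity | lra].
      - specialize (Hs N). exists (r + (/ (1 + s N) - / 2))%R. split.
        + simpl csum. rewrite Er.
          replace (RtoC (1 + s N) - Cconj w0 * 0) with (RtoC (1 + s N)) by ring.
          rewrite (RtoC_plus r), (RtoC_minus (/ (1 + s N))), !RtoC_inv by lra. reflexivity.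
        + rewrite S_INR.
          assert (/ (1 + / 2) <= / (1 + s N))%R by (apply Rinv_le_contravar; lra). lra. }
    destruct E as [r [Er Hr]]. exists (g * r)%R. unfold X.
    rewrite Er, RtoC_mult. split; [reflexivity |].
    nra. }
  assert (HXb : forall N w, Cmod w = 1%R -> (0 < Cmod (w - w0))%R ->
     (Re (X N w) <= ln 2 / (2 * Q * Cmod (w - w0)))%R).
  { intros N w Hw Hy. set (u := Cconj w0 * w).
    assert (Hu : Cmod u = 1%R) by (unfold u; rewrite Cmod_mult, Cmod_conj, Hw, Hw0; ring).
    assert (Ey : Cmod (w - w0) = Cmod (1 - u)).
    { transitivity (Cmod (w0 * (1 - u))); [| rewrite Cmod_mult, Hw0; ring].
      replace (w0 * (1 - u)) with (w0 - (w0 * Cconj w0) * w) by (unfold u; ring).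
      rewrite <- Cmod2_conj, Hw0, pow1.
      rewrite <- Cmod_opp. f_equal. ring. }
    rewrite Ey in *. set (y := Cmod (1 - u)) in *.
    assert (H : (Re (csum (fun i => (/ (RtoC (1 + s i) - Cconj w0 * w) - / 2)%C) N)
       <= 4 * (/ 2 / ((/ 2 + y) * y) - s N / ((s N + y) * y)))%R).
    { induction N as [| N IH].
      - simpl csum. replace (s 0%nat) with (/ 2)%R by (unfold s; simpl; ring).
        rewrite re_RtoC. lra.
      - simpl csum. rewrite re_plus.
        pose proof (Re_kernel_le (s N) u (proj1 (Hs N)) Hu Hy) as H. fold y in H.
        fold u in IH |- *.
        replace (s (S N)) with (s N / 2)%R by (unfold s; simpl; field). lra. }
    unfold X. rewrite re_scal_l.
    assert (H4 : (4 * (/ 2 / ((/ 2 + y) * y) - s N / ((s N + y) * y)) <= 4 / y)%R).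
    { assert (0 <= s N / ((s N + y) * y))%R.
      { apply Rdiv_le_0_compat; [left; apply Hs |]. specialize (Hs N). nra. }
      assert (/ 2 / ((/ 2 + y) * y) <= 1 / y)%R; [| unfold Rdiv in *; lra].
      replace (/ 2 / ((/ 2 + y) * y))%R with ((/ 2 / (/ 2 + y)) * (1 / y))%R by (field; lra).
      rewrite <- (Rmult_1_l (1 / y)) at 2. apply Rmult_le_compat_r.
      - apply Rdiv_le_0_compat; lra.
      - apply Rle_div_l; lra. }
    replace (ln 2 / (2 * Q * y))%R with (g * (4 / y))%R by (unfold g; field; lra).
    apply Rmult_le_compat_l; lra. }
  assert (Hmain : forall N, (Cmod (c 0%nat) * (1 + g * INR N / 6) <= 2 * A * exp 1)%R).
  { intros N. destruct (poly_limit_bounded (X N) (HX N)) as [B [HB Hb]].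
    (* With [M >= B^2] the error [|X|^2 / (2 M)] of [Cmod_1_plus_pow_le] is at most [1]; this is the
       origin of the factor [exp 1]. *)
    destruct (nfloor_ex (B ^ 2)) as [M' [_ HM']]; [nra |].
    set (M := S M'). assert (HM : (B ^ 2 <= INR M)%R) by (unfold M; rewrite S_INR; lra).
    assert (HM0 : (0 < INR M)%R) by (apply lt_0_INR; unfold M; lia).
    set (F := fun w => ev c w * (1 + X N w / RtoC (INR M)) ^ M).
    assert (HF : poly_limit F).
    { apply (poly_limit_mult (ev c)); [now apply poly_limit_ev |].
      apply (poly_limit_pow (fun w => 1 + X N w / RtoC (INR M))).
      apply (poly_limit_plus (fun _ => 1)); [apply poly_limit_const |].
      apply (poly_limit_mult (X N) (fun _ => / RtoC (INR M))); [apply HX | apply poly_limit_const]. }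
    assert (HFb : (Cmod (F 0) <= 2 * A * exp 1)%R).
    { apply poly_limit_max; [exact HF |]. intros w Hw. unfold F. rewrite Cmod_mult.
      (* At [w0] itself the exponent [1 / |w - w0|] is meaningless, but the flatness bound with
         [k = 1] shows that [ev c] vanishes there. *)
      destruct (Req_dec (Cmod (w - w0)) 0) as [H0 | H0].
      - specialize (Hflat 1%nat w (Req_le _ _ Hw)). rewrite H0 in Hflat. simpl in Hflat.
        pose proof (Cmod_ge_0 (ev c w)).
        replace (Cmod (ev c w)) with 0%R by lra. rewrite Rmult_0_l.
        pose proof (exp_pos 1). nra.
      - assert (Hy : (0 < Cmod (w - w0))%R) by (pose proof (Cmod_ge_0 (w - w0)); lra).
        pose proof (flat_exp_bound A Q _ (Cmod (ev c w)) HA HQ Hy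
          (fun k => Hflat k w (Req_le _ _ Hw))) as H.
        apply Rle_trans with (Cmod (ev c w) * (exp (ln 2 / (2 * Q * Cmod (w - w0))) * exp 1))%R.
        + apply Rmult_le_compat_l; [apply Cmod_ge_0 |].
          eapply Rle_trans; [apply Cmod_1_plus_pow_le; unfold M; lia |].
          rewrite <- exp_plus.
          assert (Hle : (Re (X N w) + Cmod (X N w) ^ 2 / (2 * INR M)
             <= ln 2 / (2 * Q * Cmod (w - w0)) + 1)%R).
          { apply Rplus_le_compat; [now apply HXb |]. apply Rle_div_l; [lra |].
            specialize (Hb w (Req_le _ _ Hw)). pose proof (Cmod_ge_0 (X N w)). nra. }
          destruct Hle as [Hlt | Heq]; [left; now apply exp_increasing | rewrite Heq; lra].
        + rewrite <- Rmult_assoc. apply Rmult_le_compat_r; [left; apply exp_pos | exact H]. }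
    destruct (HX0 N) as [x [Ex Hx]].
    assert (Hx0 : (0 <= x)%R).
    { eapply Rle_trans; [| exact Hx]. pose proof (pos_INR N). nra. }
    unfold F in HFb. rewrite Cmod_mult, Ex, (ev_at_0 c Hc) in HFb.
    eapply Rle_trans; [| exact HFb]. apply Rmult_le_compat_l; [apply Cmod_ge_0 |].
    rewrite Cmod_pow. unfold Cdiv. rewrite <- RtoC_inv by lra. rewrite <- RtoC_mult, <- RtoC_plus, Cmod_R.
    assert (Hxm : (0 <= x * / INR M)%R) by (apply Rdiv_le_0_compat; lra).
    rewrite Rabs_pos_eq by lra.
    (* Bernoulli's inequality ([poly]) leaves [1 + x], and linear growth in [N] is enough to force
       [c_0 = 0]. *)
    apply Rle_trans with (1 + INR M * (x * / INR M))%R.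
    - replace (INR M * (x * / INR M))%R with x by (field; lra). lra.
    - destruct Hxm as [Hxm | Hxm]; [now apply poly |].
      rewrite <- Hxm, Rplus_0_r, pow1. lra. }
  apply Cmod_eq_0. destruct (Req_dec (Cmod (c 0%nat)) 0) as [| Hne]; [assumption | exfalso].
  assert (Hc0 : (0 < Cmod (c 0%nat) * g / 6)%R).
  { pose proof (Cmod_ge_0 (c 0%nat)). assert (0 < Cmod (c 0%nat))%R by lra. nra. }
  destruct (INR_unbounded (2 * A * exp 1 / (Cmod (c 0%nat) * g / 6))) as [N HN].
  apply Rlt_gt, Rlt_div_l in HN; [| exact Hc0].
  specialize (Hmain N). pose proof (Cmod_ge_0 (c 0%nat)). lra.
Qed.

(** * Finiteness of the zeros in the closed disc *)

Definition sdivn (w0 : C) (k : nat) (c : nat -> C) : nat -> C := Nat.iter k (sdiv w0) c.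

Lemma rapid_divn (w0 : C) (k : nat) (c : nat -> C) :
  (Cmod w0 <= 1)%R -> rapid c -> rapid (sdivn w0 k c).
Proof.
  intros Hw Hc. induction k as [| k IH]; [exact Hc |]. simpl. now apply rapid_div.
Qed.

Lemma slin_divn (w0 : C) (k : nat) (c : nat -> C) :
  (Cmod w0 <= 1)%R -> rapid c ->
  (forall j, (j < k)%nat -> ev (sdivn w0 j c) w0 = 0) ->
  c = Nat.iter k (slin w0) (sdivn w0 k c).
Proof.
  intros Hw Hc. induction k as [| k IH]; intros H; [reflexivity |].
  rewrite IH at 1 by (intros; apply H; lia). rewrite Nat.iter_succ_r. f_equal.
  rewrite (sdiv_spec w0 (sdivn w0 k c)) at 1 by auto using rapid_divn.
  rewrite H by lia. apply functional_extensionality. intro m.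
  unfold splus, sscal. simpl. ring.
Qed.

Lemma rapid_iter_lin (w0 : C) (k : nat) (c : nat -> C) :
  rapid c -> rapid (Nat.iter k (slin w0) c).
Proof. intros Hc. induction k; [exact Hc |]. now apply rapid_lin. Qed.

Lemma ev_iter_lin (w0 w : C) (k : nat) (c : nat -> C) :
  rapid c -> (Cmod w <= 1)%R ->
  ev (Nat.iter k (slin w0) c) w = (w - w0) ^ k * ev c w.
Proof.
  intros Hc Hw. induction k as [| k IH]; [simpl; ring |].
  simpl. rewrite ev_lin, IH by auto using rapid_iter_lin. ring.
Qed.

Lemma ev_divn (w0 w : C) (k : nat) (c : nat -> C) :
  (Cmod w0 <= 1)%R -> (Cmod w <= 1)%R -> rapid c ->
  (forall j, (j < k)%nat -> ev (sdivn w0 j c) w0 = 0) ->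
  ev c w = (w - w0) ^ k * ev (sdivn w0 k c) w.
Proof.
  intros Hw0 Hw Hc H. rewrite (slin_divn w0 k c) at 1 by assumption.
  apply ev_iter_lin; auto using rapid_divn.
Qed.

(** Passing from order [r + 1] to order [r] gains [1 / r], for [r] from [k + 1] down to [2]. *)
Lemma sdivn_decay (w0 : C) (k : nat) (A : R) (c : nat -> C) :
  (Cmod w0 <= 1)%R -> decay A (S (S k)) c ->
  decay (A / INR (fact (S k))) 2 (sdivn w0 k c).
Proof.
  intros Hw. revert A c. induction k as [| k IH]; intros A c Hc.
  - simpl. unfold Rdiv. rewrite Rinv_1, Rmult_1_r. exact Hc.
  - unfold sdivn. rewrite Nat.iter_succ_r. rewrite (fact_simpl (S k)), mult_INR.
    replace (A / (INR (S (S k)) * INR (fact (S k))))%R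
      with (A / INR (S (S k)) / INR (fact (S k)))%R.
    + apply IH. now apply sdiv_decay.
    + field. split; apply not_0_INR; [apply fact_neq_0 | lia].
Qed.

(** Only the exponent [1 / 2] is needed: it is the weakest hypothesis. *)
Definition sqrt_exp_decay (c : nat -> C) : Prop :=
  exists B kappa, (0 <= B)%R /\ (0 < kappa)%R /\
    forall m, (Cmod (c m) <= B * exp (- (kappa * sqrt (INR m))))%R.

Lemma gfrac_ge (p j : nat) : (/ INR (j + p) ^ p <= gfrac p j)%R.
Proof.
  destruct p as [| q]; [simpl; rewrite Rinv_1; lra |].
  assert (H : forall r, (r <= S q)%nat -> (/ INR (j + S q) ^ r <= gfrac r j)%R).
  { assert (H0 : (0 < INR (j + S q))%R) by (apply lt_0_INR; lia).
    induction r as [| r IH]; intros Hr; [simpl; rewrite Rinv_1; lra |].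
    rewrite gfrac_S, <- tech_pow_Rmult, Rinv_mult, Rmult_comm.
    apply Rmult_le_compat.
    - left. now apply Rinv_0_lt_compat, pow_lt.
    - left. now apply Rinv_0_lt_compat.
    - apply IH. lia.
    - apply Rinv_le_contravar; [apply lt_0_INR; lia | apply le_INR; lia]. }
  now apply H.
Qed.

Lemma pow_le_exp (x : R) (n : nat) : (0 <= x)%R -> (x ^ n <= INR (fact n) * exp x)%R.
Proof.
  intros Hx. assert (Hf : (0 < INR (fact n))%R) by apply INR_fact_lt_0.
  assert (H : (x ^ n / INR (fact n) <= exp x)%R).
  { eapply Rle_trans; [| apply (exp_ge_taylor x n Hx)].
    destruct n as [| n]; [simpl; lra |].
    simpl sum_f_R0. rewrite <- (Rplus_0_l (x ^ S n / _)) at 1.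
    apply Rplus_le_compat_r. apply cond_pos_sum. intro k.
    apply Rdiv_le_0_compat; [now apply pow_le | apply INR_fact_lt_0]. }
  apply Rle_div_l in H; [| exact Hf]. lra.
Qed.

Lemma exp_le (x y : R) : (x <= y)%R -> (exp x <= exp y)%R.
Proof. intros [H | ->]; [left; now apply exp_increasing | lra]. Qed.

(** With [x = sqrt (j + p)], the exponential series gives [(kappa x)^(2 p) <= (2 p)! exp (kappa x)].
    Replacing [sqrt j] by [x - p] costs [exp (kappa p)], and [gfrac p j] is at least
    [(j + p)^-p]. *)
Lemma sqrt_exp_decay_decay (B kappa : R) (c : nat -> C) (p : nat) :
  (0 <= B)%R -> (0 < kappa)%R ->
  (forall m, (Cmod (c m) <= B * exp (- (kappa * sqrt (INR m))))%R) ->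
  decay (B * (exp kappa / kappa ^ 2) ^ p * INR (fact (2 * p))) p c.
Proof.
  intros HB Hk Hc j. eapply Rle_trans; [apply Hc |].
  rewrite !Rmult_assoc. apply Rmult_le_compat_l; [exact HB |].
  set (x := sqrt (INR (j + p))). assert (Hx : (0 <= x)%R) by apply sqrt_pos.
  assert (Hxx : (x ^ 2 = INR (j + p))%R).
  { unfold x. rewrite pow2_sqrt; [reflexivity | apply pos_INR]. }
  pose proof (pos_INR p) as Hp0.
  assert (Hsq : (x - INR p <= sqrt (INR j))%R).
  { destruct (Rle_dec x (INR p)) as [H | H]; [pose proof (sqrt_pos (INR j)); lra |].
    destruct p as [| p].
    - simpl in Hxx |- *. unfold x. rewrite Nat.add_0_r. lra.
    - apply Rsqr_incr_0; [| lra | apply sqrt_pos].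
      rewrite Rsqr_sqrt by apply pos_INR. unfold Rsqr.
      rewrite plus_INR in Hxx. assert (1 <= INR (S p))%R by (apply (le_INR 1); lia).
      nra. }
  apply Rle_trans with (exp (- (kappa * x)) * exp (kappa * INR p))%R.
  { rewrite <- exp_plus. apply exp_le. nra. }
  rewrite <- (Rmult_1_r (exp (- (kappa * x)) * exp (kappa * INR p))).
  assert (Hkp : (0 < (kappa ^ 2) ^ p)%R) by (apply pow_lt, pow_lt, Hk).
  unfold Rdiv. rewrite Rpow_mult_distr, exp_pow_nat, pow_inv.
  rewrite (Rmult_comm (INR p)).
  pose proof (exp_pos (kappa * INR p)) as He.
  replace (exp (- (kappa * x)) * exp (kappa * INR p) * 1)%R
    with (exp (kappa * INR p) * exp (- (kappa * x)))%R by ring.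
  rewrite Rmult_assoc. apply Rmult_le_compat_l; [lra |].
  pose proof (pow_le_exp (kappa * x) (2 * p)) as H.
  assert (Hkx : (0 <= kappa * x)%R) by (apply Rmult_le_pos; lra).
  specialize (H Hkx).
  rewrite pow_mult, Rpow_mult_distr, Hxx, Rpow_mult_distr in H.
  rewrite exp_Ropp.
  destruct p as [| p].
  - pose proof (exp_ineq1_le (kappa * x)).
    apply Rle_trans with (/ 1)%R; [apply Rinv_le_contravar; lra |].
    simpl. rewrite Rinv_1. lra.
  - assert (HJ : (0 < INR (j + S p) ^ S p)%R) by (apply pow_lt, lt_0_INR; lia).
    pose proof (exp_pos (kappa * x)) as Hex.
    apply Rle_trans with (/ (kappa ^ 2) ^ S p * (INR (fact (2 * S p)) * / INR (j + S p) ^ S p))%R.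
    + apply Rmult_le_reg_r with (exp (kappa * x)); [exact Hex |]. rewrite Rinv_l by lra.
      apply Rmult_le_reg_l with ((kappa ^ 2) ^ S p * INR (j + S p) ^ S p)%R; [nra |].
      replace ((kappa ^ 2) ^ S p * INR (j + S p) ^ S p *
        (/ (kappa ^ 2) ^ S p * (INR (fact (2 * S p)) * / INR (j + S p) ^ S p) *
         exp (kappa * x)))%R with (INR (fact (2 * S p)) * exp (kappa * x))%R
        by (field; lra).
      lra.
    + apply Rmult_le_compat_l; [left; now apply Rinv_0_lt_compat |].
      apply Rmult_le_compat_l; [apply pos_INR |]. apply gfrac_ge.
Qed.

Lemma sqrt_exp_decay_rapid (c : nat -> C) : sqrt_exp_decay c -> rapid c.
Proof.
  intros (B & kappa & HB & Hk & H) p. eexists. exact (sqrt_exp_decay_decay B kappa c p HB Hk H).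
Qed.

Lemma fact_double_le (n : nat) : (INR (fact (2 * n)) <= 4 ^ n * INR (fact n) ^ 2)%R.
Proof.
  induction n as [| n IH]; [simpl; lra |].
  replace (2 * S n)%nat with (S (S (2 * n))) by lia.
  rewrite !fact_simpl, !mult_INR, <- (tech_pow_Rmult 4), !S_INR.
  rewrite mult_INR. simpl (INR 2). pose proof (pos_INR n) as Hn.
  set (F := INR (fact (2 * n))) in *. set (f := INR (fact n)) in *.
  assert (0 <= F)%R by apply pos_INR.
  apply Rle_trans with (4 * (INR n + 1) ^ 2 * F)%R; [nra |].
  replace (4 * 4 ^ n * ((INR n + 1) * f) ^ 2)%R
    with (4 * (INR n + 1) ^ 2 * (4 ^ n * f ^ 2))%R by ring.
  apply Rmult_le_compat_l; [nra | exact IH].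
Qed.

(** Applying [(2 n)! <= 4^n (n!)^2] with [n = k + 2] leaves [4^k k!] times a cubic polynomial in
    [k]. Since [k + 1 <= 2^k], the cubic is absorbed by [8^k], whence [32 = 4 * 8]. *)
Lemma fact_quotient_le (k : nat) :
  (INR (fact (2 * S (S k))) / INR (fact (S k)) <= 64 * 32 ^ k * INR (fact k))%R.
Proof.
  apply Rle_div_l; [apply INR_fact_lt_0 |].
  eapply Rle_trans; [apply fact_double_le |].
  rewrite (fact_simpl (S k)), (fact_simpl k), !mult_INR, <- !(tech_pow_Rmult 4).
  set (f := INR (fact k)). assert (Hf : (0 < f)%R) by apply INR_fact_lt_0.
  rewrite !S_INR. replace 32%R with (4 * (2 * (2 * 2)))%R by ring. rewrite !Rpow_mult_distr.
  assert (H2 : (INR k + 1 <= 2 ^ k)%R).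
  { clear. induction k as [| k IH]; [simpl; lra |]. rewrite S_INR, <- tech_pow_Rmult.
    pose proof (pos_INR k). lra. }
  pose proof (pos_INR k) as Hk. set (t := (2 ^ k)%R) in *.
  assert (H4 : (0 < 4 ^ k)%R) by (apply pow_lt; lra).
  replace (4 * (4 * 4 ^ k) * ((INR k + 1 + 1) ^ 2 * ((INR k + 1) ^ 2 * f ^ 2)))%R
    with (4 ^ k * ((INR k + 1) * f) * (f * (16 * (INR k + 1 + 1) ^ 2 * (INR k + 1))))%R by ring.
  replace (64 * (4 ^ k * (t * (t * t))) * f * ((INR k + 1) * f))%R
    with (4 ^ k * ((INR k + 1) * f) * (f * (64 * (t * (t * t)))))%R by ring.
  apply Rmult_le_compat_l; [apply Rmult_le_pos; nra |].
  apply Rmult_le_compat_l; [lra |].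
  replace (16 * (INR k + 1 + 1) ^ 2 * (INR k + 1))%R
    with (16 * ((INR k + 2) * (INR k + 2) * (INR k + 1)))%R by ring.
  replace (64 * (t * (t * t)))%R with (16 * ((2 * t) * (2 * t) * t))%R by ring.
  apply Rmult_le_compat_l; [lra |]. apply Rmult_le_compat; [nra | lra | | lra].
  apply Rmult_le_compat; lra.
Qed.

(** If all iterated quotients vanished at [w0], [ev c] would be divisible by every power of
    [w - w0]. On the circle the [k]-th quotient is then bounded by
    [q^(k + 2) (2 k + 4)! / (k + 1)!], which [fact_quotient_le] brings to the form required by
    [flat_boundary_zero]. *)
Lemma finite_order (c : nat -> C) (w0 : C) :
  sqrt_exp_decay c -> c 0%nat <> 0 -> (Cmod w0 <= 1)%R ->
  exists k, ev (sdivn w0 k c) w0 <> 0 /\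
    forall j, (j < k)%nat -> ev (sdivn w0 j c) w0 = 0.
Proof.
  intros Hs Hc0 Hw0. pose proof (sqrt_exp_decay_rapid c Hs) as Hc.
  apply NNPP. intros Hno. apply Hc0.
  assert (H : forall k j, (j < k)%nat -> ev (sdivn w0 j c) w0 = 0).
  { induction k as [| k IH]; intros j Hj; [lia |].
    apply NNPP. intros Hne. apply Hno. exists j. split; [exact Hne |].
    intros i Hi. apply IH. lia. }
  destruct (Rle_lt_or_eq_dec _ _ Hw0) as [Hlt | Heq].
  - apply (interior_zero_finite_order c w0 Hc Hlt). intro k.
    exists (sdivn w0 k c). split; [now apply rapid_divn |].
    intros w Hw. exact (ev_divn w0 w k c Hw0 Hw Hc (H k)).
  - destruct Hs as (B & kappa & HB & Hk & Hd).
    set (q := (exp kappa / kappa ^ 2)%R).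
    assert (Hq : (0 < q)%R) by (apply Rdiv_lt_0_compat; [apply exp_pos | now apply pow_lt]).
    apply (flat_boundary_zero c w0 (64 * B * q ^ 2) (32 * q)); auto; [| lra |].
    + apply Rmult_le_pos; nra.
    + intros k w Hw. rewrite (ev_divn w0 w k c Hw0 Hw Hc (H k)).
      rewrite Cmod_mult, Cmod_pow.
      assert (He : (Cmod (ev (sdivn w0 k c) w) <= 64 * B * q ^ 2 * (32 * q) ^ k * INR (fact k))%R).
      { eapply Rle_trans.
        - apply ev_decay; [| exact Hw]. apply sdivn_decay; [exact Hw0 |].
          exact (sqrt_exp_decay_decay B kappa c _ HB Hk Hd).
        - fold q. change (q ^ S (S k))%R with (q * (q * q ^ k))%R.
          replace (B * (q * (q * q ^ k)) * INR (fact (2 * S (S k))) / INR (fact (S k)))%R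
            with (B * (q * (q * q ^ k)) * (INR (fact (2 * S (S k))) / INR (fact (S k))))%R
            by (unfold Rdiv; ring).
          replace (64 * B * q ^ 2 * (32 * q) ^ k * INR (fact k))%R
            with (B * (q * (q * q ^ k)) * (64 * 32 ^ k * INR (fact k)))%R
            by (rewrite Rpow_mult_distr; ring).
          apply Rmult_le_compat_l; [| apply fact_quotient_le].
          apply Rmult_le_pos; [exact HB |]. left. pose proof (pow_lt q k Hq) as Hqk.
          apply Rmult_lt_0_compat; [exact Hq |]. now apply Rmult_lt_0_compat. }
      rewrite Rpow_mult_distr.
      replace (64 * B * q ^ 2 * ((32 * q) ^ k * Cmod (w - w0) ^ k) * INR (fact k))%R
        with (Cmod (w - w0) ^ k * (64 * B * q ^ 2 * (32 * q) ^ k * INR (fact k)))%R by ring.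
      apply Rmult_le_compat_l; [apply pow_le, Cmod_ge_0 | exact He].
Qed.

(** The last quotient has a value [e <> 0] at [w0] and is Lipschitz there, so it cannot vanish
    within distance [|e| / (B + 1)]. *)
Lemma isolated_zero (c : nat -> C) (w0 : C) :
  sqrt_exp_decay c -> c 0%nat <> 0 -> (Cmod w0 <= 1)%R ->
  exists r, (0 < r)%R /\ forall w, (Cmod w <= 1)%R -> (Cmod (w - w0) < r)%R ->
    ev c w = 0 -> w = w0.
Proof.
  intros Hs Hc0 Hw0. pose proof (sqrt_exp_decay_rapid c Hs) as Hc.
  destruct (finite_order c w0 Hs Hc0 Hw0) as [k [Hne H]].
  destruct (ev_lipschitz w0 (sdivn w0 k c) Hw0) as [B [HB HL]]; [now apply rapid_divn |].
  set (e := ev (sdivn w0 k c) w0) in *.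
  assert (He : (0 < Cmod e)%R) by now apply Cmod_gt_0.
  exists (Cmod e / (B + 1))%R. split; [apply Rdiv_lt_0_compat; lra |].
  intros w Hw Hr Hz. apply NNPP. intros Hww.
  rewrite (ev_divn w0 w k c) in Hz by auto.
  assert (Hd : w - w0 <> 0).
  { intros E. apply Hww. replace w with (w - w0 + w0) by ring. rewrite E. ring. }
  assert (E0 : ev (sdivn w0 k c) w = 0).
  { replace (ev (sdivn w0 k c) w)
      with (/ (w - w0) ^ k * ((w - w0) ^ k * ev (sdivn w0 k c) w))
      by (field; now apply Cpow_nz).
    rewrite Hz. ring. }
  specialize (HL w Hw). rewrite E0 in HL.
  replace (0 - e) with (- e) in HL by ring. rewrite Cmod_opp in HL.
  apply Rlt_div_r in Hr; [| lra]. pose proof (Cmod_ge_0 (w - w0)). nra.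
Qed.

Lemma Cmod_le_components (z : C) (d : R) :
  (Rabs (Re z) < d)%R -> (Rabs (Im z) < d)%R -> (Cmod z < 2 * d)%R.
Proof.
  intros H1 H2. apply Rsqr_incrst_0; [| apply Cmod_ge_0 |].
  - unfold Rsqr. replace (Cmod z * Cmod z)%R with (Cmod z ^ 2)%R by ring.
    rewrite Cmod2_alt. apply Rabs_def2 in H1. apply Rabs_def2 in H2. nra.
  - pose proof (Rabs_pos (Re z)). lra.
Qed.

(** Heine-Borel in the square [[-1, 1]^2]: each box of the finite subcover contains at most its own
    centre. The radii are halved because boxes are measured coordinatewise. *)
Lemma Finite_of_locally_finite (Z : C -> Prop) :
  (forall w, Z w -> (Cmod w <= 1)%R) ->
  (forall w0, exists r, (0 < r)%R /\ forall w, Z w -> (Cmod (w - w0) < r)%R -> w = w0) ->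
  Finite_sets.Finite C Z.
Proof.
  intros Hb Hloc.
  assert (Hd : forall x y : R, exists r : posreal,
    forall w, Z w -> (Cmod (w - (x, y)) < 2 * r)%R -> w = (x, y)).
  { intros x y. destruct (Hloc (x, y)) as [r [Hr H]].
    assert (Hr2 : (0 < r / 2)%R) by lra. exists (mkposreal _ Hr2). simpl.
    intros w Hw Hlt. apply H; [exact Hw | lra]. }
  destruct (constructive_indefinite_description
    (fun f : R -> R -> posreal => forall x y w, Z w ->
       (Cmod (w - (x, y)) < 2 * f x y)%R -> w = (x, y))) as [f Hf].
  { exists (fun x y => proj1_sig (constructive_indefinite_description _ (Hd x y))).
    intros x y. exact (proj2_sig (constructive_indefinite_description _ (Hd x y))). }
  (* The gauge must be a function, hence the choice made just before, and the conclusion is doubly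
     negated, hence [NNPP]. *)
  pose proof (compactness_list 2 ((-1)%R, ((-1)%R, tt)) (1%R, (1%R, tt))
    (fun t => f (fst t) (fst (snd t)))) as Hcomp.
  apply NNPP in Hcomp. destruct Hcomp as [l Hl].
  assert (Hfin : forall l : list C, Finite_sets.Finite C (fun w => List.In w l)).
  { clear. induction l as [| a l IH].
    - replace (fun w : C => List.In w nil) with (Empty_set C); [constructor |].
      apply Extensionality_Ensembles. split; intros x Hx; destruct Hx.
    - replace (fun w : C => List.In w (a :: l)) with (Ensembles.Add C (fun w => List.In w l) a).
      + now apply Finite_sets_facts.Add_preserves_Finite.
      + apply Extensionality_Ensembles. split; intros x Hx.
        * destruct Hx as [x Hx | x Hx]; [right; exact Hx | left; now destruct Hx].
        * destruct Hx as [-> | Hx]; [right; constructor | left; exact Hx]. }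
  apply Finite_sets_facts.Finite_downward_closed
    with (fun w => List.In w (map (fun t : Compactness.Tn 2 R => (fst t, fst (snd t)) : C) l)).
  - apply Hfin.
  - intros w Hw. red.
    pose proof (Hb w Hw) as H1.
    destruct (Hl (Re w, (Im w, tt))) as [[x [y []]] [Hin [_ Hclose]]].
    + pose proof (re_le_Cmod w) as HR. pose proof (im_le_Cmod w) as HI.
      assert (HR' : (Rabs (Re w) <= 1)%R) by lra. assert (HI' : (Rabs (Im w) <= 1)%R) by lra.
      apply Rabs_le_between in HR'. apply Rabs_le_between in HI'.
      simpl. repeat split; lra.
    + simpl in Hclose. destruct Hclose as [Hx [Hy _]].
      apply in_map_iff. exists (x, (y, tt)). split; [| exact Hin]. simpl.
      symmetry. apply Hf; [exact Hw |].
      apply Cmod_le_components; destruct w; simpl in *; assumption.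
Qed.

Lemma finite_zeros (c : nat -> C) :
  sqrt_exp_decay c -> c 0%nat <> 0 ->
  Finite_sets.Finite C (fun w => (Cmod w <= 1)%R /\ ev c w = 0).
Proof.
  intros Hs Hc0. apply Finite_of_locally_finite; [now intros w [H _] |].
  intros w0. destruct (Rle_dec (Cmod w0) 1) as [H | H].
  - destruct (isolated_zero c w0 Hs Hc0 H) as [r [Hr Hi]].
    exists r. split; [exact Hr |]. intros w [Hw Hz] Hd. now apply Hi.
  - exists (Cmod w0 - 1)%R. split; [lra |]. intros w [Hw _] Hd. exfalso.
    pose proof (Cmod_rev_triangle w0 w) as Ht.
    replace (w0 - w) with (- (w - w0)) in Ht by ring. rewrite Cmod_opp in Ht. lra.
Qed.

(** * Derivatives in [z] *)

(** The coefficients of [(i / 2) (w d/dw - 2)] applied to [ev c]. *)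
Definition sderiv (c : nat -> C) : nat -> C :=
  sscal (Ci / 2) (splus (seuler c) (sscal (- (2)) c)).

Lemma rapid_deriv (c : nat -> C) : rapid c -> rapid (sderiv c).
Proof.
  intros Hc. apply rapid_scal, rapid_plus; [now apply rapid_euler | now apply rapid_scal].
Qed.

Lemma rapid_iter_deriv (k : nat) (c : nat -> C) :
  rapid c -> rapid (Nat.iter k sderiv c).
Proof. intros Hc. induction k; [exact Hc |]. now apply rapid_deriv. Qed.

Lemma ev_deriv (c : nat -> C) (w : C) :
  rapid c -> (Cmod w <= 1)%R ->
  ev (sderiv c) w = Ci / 2 * (w * ev (sdiv w c) w - 2 * ev c w).
Proof.
  intros Hc Hw. unfold sderiv.
  rewrite ev_scal, ev_plus, ev_scal, ev_euler;
    auto using rapid_plus, rapid_euler, rapid_scal. ring.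
Qed.

Lemma sderiv_lin (w0 : C) (c : nat -> C) :
  sderiv (slin w0 c) = splus (sscal (Ci / 2) (sshift c)) (slin w0 (sderiv c)).
Proof.
  unfold sderiv. rewrite slin_euler. apply functional_extensionality.
  intros [| m]; unfold slin, splus, sscal; simpl sshift; ring.
Qed.

(** Differentiating [(w - w0)^(k + 1)] times a series leaves a common factor [(w - w0)^k], by the
    Leibniz rule. *)
Lemma sderiv_iter_lin (w0 : C) (k : nat) (c : nat -> C) :
  sderiv (Nat.iter (S k) (slin w0) c) =
  Nat.iter k (slin w0)
    (splus (sscal (RtoC (INR (S k)) * (Ci / 2)) (sshift c)) (slin w0 (sderiv c))).
Proof.
  induction k as [| k IH].
  - simpl Nat.iter. rewrite sderiv_lin. simpl INR. f_equal. f_equal. ring.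
  - change (Nat.iter (S (S k)) (slin w0) c) with (slin w0 (Nat.iter (S k) (slin w0) c)).
    rewrite sderiv_lin, IH.
    assert (Hshift : forall j d, sshift (Nat.iter j (slin w0) d) = Nat.iter j (slin w0) (sshift d)).
    { induction j as [| j IHj]; intro d; [reflexivity |]. simpl. rewrite <- IHj.
      apply functional_extensionality. intros [| m]; unfold slin, splus, sscal; simpl; [ring |].
      destruct m; simpl; ring. }
    assert (Hlin : forall j x d e, splus (sscal x (Nat.iter j (slin w0) d)) (Nat.iter j (slin w0) e)
        = Nat.iter j (slin w0) (splus (sscal x d) e)).
    { induction j as [| j IHj]; intros x d e; [reflexivity |]. simpl. rewrite <- IHj.
      apply functional_extensionality. intros [| m]; unfold slin, splus, sscal; simpl; ring. }
    rewrite Hshift.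
    change (slin w0 (Nat.iter k (slin w0)
      (splus (sscal (RtoC (INR (S k)) * (Ci / 2)) (sshift c)) (slin w0 (sderiv c)))))
      with (Nat.iter (S k) (slin w0)
      (splus (sscal (RtoC (INR (S k)) * (Ci / 2)) (sshift c)) (slin w0 (sderiv c)))).
    rewrite Hlin. f_equal. apply functional_extensionality. intros m.
    rewrite (S_INR (S k)), RtoC_plus. unfold splus, sscal. ring.
Qed.

(** One derivative lowers the order of vanishing by one, and the new quotient takes the value
    [(k + 1) (i / 2) w0 e(w0)] at [w0]. It is non-zero because [w0 <> 0], as is the case for
    [w0 = e^{iz/2}]. *)
Lemma iter_deriv_order (w0 : C) (k : nat) (c e : nat -> C) :
  (Cmod w0 <= 1)%R -> w0 <> 0 -> rapid e -> ev e w0 <> 0 ->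
  c = Nat.iter k (slin w0) e ->
  (forall j, (j < k)%nat -> ev (Nat.iter j sderiv c) w0 = 0) /\
  ev (Nat.iter k sderiv c) w0 <> 0.
Proof.
  intros Hw0 Hne. revert c e. induction k as [| k IH]; intros c e He Hev Hc.
  - subst c. split; [intros; lia | exact Hev].
  - destruct (IH (sderiv c)
      (splus (sscal (RtoC (INR (S k)) * (Ci / 2)) (sshift e)) (slin w0 (sderiv e)))) as [H1 H2].
    + apply rapid_plus; [now apply rapid_scal, rapid_shift | now apply rapid_lin, rapid_deriv].
    + rewrite ev_plus, ev_scal, ev_shift, ev_lin;
        auto using rapid_scal, rapid_shift, rapid_lin, rapid_deriv.
      replace (RtoC (INR (S k)) * (Ci / 2) * (w0 * ev e w0) + (w0 - w0) * ev (sderiv e) w0)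
        with (RtoC (INR (S k)) * (Ci * (/ 2 * (w0 * ev e w0)))) by (field; intro H; injection H; lra).
      repeat apply Cmult_neq_0; auto using Ci_nz.
      * intro H. injection H. change (INR (S k) <> 0%R). apply not_0_INR. lia.
      * intro H.
        assert (E : RtoC 1 = 2 * / 2) by (field; intro H'; injection H'; lra).
        rewrite H, Cmult_0_r in E. injection E. lra.
    + subst c. apply sderiv_iter_lin.
    + split.
      * intros [| j] Hj.
        -- subst c. simpl. rewrite ev_lin by auto using rapid_iter_lin. ring.
        -- rewrite Nat.iter_succ_r. apply H1. lia.
      * rewrite Nat.iter_succ_r. exact H2.
Qed.

(** * Complex differentiability with quadratic remainder *)

Lemma exp_quadratic (a : R) : (Rabs a <= / 2)%R -> (0 <= exp a - 1 - a <= 2 * a ^ 2)%R.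
Proof.
  intros Ha. apply Rabs_le_between in Ha. pose proof (exp_ineq1_le a) as H1.
  split; [lra |]. pose proof (exp_ineq1_le (- a)) as H2. rewrite exp_Ropp in H2.
  pose proof (exp_pos a) as H3.
  assert (H4 : (exp a <= / (1 - a))%R).
  { rewrite <- (Rinv_inv (exp a)). apply Rinv_le_contravar; lra. }
  assert (H5 : (/ (1 - a) = 1 + a + a ^ 2 / (1 - a))%R) by (field; lra).
  assert (H6 : (a ^ 2 / (1 - a) <= 2 * a ^ 2)%R).
  { apply Rle_div_l; [lra |]. nra. }
  lra.
Qed.

Lemma cos_quadratic (b : R) : (Rabs (cos b - 1) <= b ^ 2 / 2)%R.
Proof.
  replace b with (2 * (b / 2))%R at 1 by field. rewrite cos_2a_sin.
  assert (H : (sin (b / 2) ^ 2 <= (b / 2) ^ 2)%R).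
  { assert (Hs : (Rabs (sin (b / 2)) <= Rabs (b / 2))%R).
    { destruct (MVT_gen sin 0 (b / 2) cos) as [x [_ Hx]].
      - intros x _. auto_derive; [trivial | ring].
      - intros x _. apply continuity_sin.
      - rewrite sin_0 in Hx. replace (sin (b / 2)) with (cos x * (b / 2))%R by lra.
        rewrite Rabs_mult. pose proof (COS_bound x) as Hc.
        assert (Rabs (cos x) <= 1)%R by (apply Rabs_le_between; lra).
        pose proof (Rabs_pos (b / 2)). nra. }
    rewrite <- (pow2_abs (sin (b / 2))), <- (pow2_abs (b / 2)).
    apply pow_incr. split; [apply Rabs_pos | exact Hs]. }
  rewrite Rabs_left1; nra.
Qed.

Lemma sin_quadratic (b : R) : (Rabs b <= 1)%R -> (Rabs (sin b - b) <= b ^ 2)%R.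
Proof.
  intros Hb. destruct (MVT_gen (fun t => sin t - t)%R 0 b (fun t => cos t - 1)%R) as [x [Hx E]].
  - intros x _. auto_derive; [trivial | ring].
  - intros x _. apply continuity_pt_minus; [apply continuity_sin | apply continuity_pt_id].
  - rewrite sin_0 in E. replace (sin b - b)%R with ((cos x - 1) * b)%R by lra.
    rewrite Rabs_mult. pose proof (cos_quadratic x) as Hc.
    assert (Hxb : (x ^ 2 <= Rabs b ^ 2)%R).
    { rewrite pow2_abs. destruct (Rle_dec 0 b).
      - rewrite Rmin_left, Rmax_right in Hx by lra. nra.
      - rewrite Rmin_right, Rmax_left in Hx by lra. nra. }
    rewrite <- (pow2_abs b). pose proof (Rabs_pos b). pose proof (Rabs_pos (cos x - 1)). nra.
Qed.

Lemma Cexp_plus (x y : C) : Cexp (x + y) = Cexp x * Cexp y.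
Proof.
  unfold Cexp. rewrite re_plus. replace (Im (x + y)) with (Im x + Im y)%R by reflexivity.
  rewrite exp_plus, cos_plus, sin_plus. apply C_ext; simpl; ring.
Qed.

Lemma Cmod_Cexp (z : C) : Cmod (Cexp z) = exp (Re z).
Proof.
  unfold Cexp. rewrite Cmod_mult.
  replace (RtoC (cos (Im z)) + Ci * RtoC (sin (Im z))) with (cis (Im z))
    by (apply C_ext; simpl; ring).
  rewrite Cmod_cis, Cmod_R, Rabs_pos_eq; [ring | left; apply exp_pos].
Qed.

Lemma Cexp_0 : Cexp 0 = 1.
Proof. unfold Cexp. simpl. rewrite exp_0, cos_0, sin_0. apply C_ext; simpl; ring. Qed.

Lemma Cmod_le_sum (z : C) : (Cmod z <= Rabs (Re z) + Rabs (Im z))%R.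
Proof.
  replace z with (RtoC (Re z) + Ci * RtoC (Im z)) at 1 by (apply C_ext; destruct z; simpl; ring).
  eapply Rle_trans; [apply Cmod_triangle |]. rewrite Cmod_mult, Cmod_Ci, !Cmod_R. lra.
Qed.

Lemma Cexp_quadratic (x : C) :
  (Cmod x <= / 2)%R -> (Cmod (Cexp x - 1 - x) <= 8 * Cmod x ^ 2)%R.
Proof.
  intros Hx. pose proof (re_le_Cmod x) as Ha. pose proof (im_le_Cmod x) as Hb.
  pose proof (Cmod2_alt x) as Hm. destruct x as [a b]. simpl Re in *. simpl Im in *.
  pose proof (exp_quadratic a ltac:(lra)) as He.
  pose proof (cos_quadratic b) as Hc. pose proof (sin_quadratic b ltac:(lra)) as Hs.
  set (r := Cmod (a, b)) in *.
  assert (Haa := Ha). assert (Hbb := Hb).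
  apply Rabs_le_between in Haa. apply Rabs_le_between in Hbb.
  apply Rabs_le_between in Hc. apply Rabs_le_between in Hs.
  pose proof (COS_bound b) as Hcb.
  pose proof (exp_pos a) as Hep.
  assert (He2 : (exp a <= 2)%R) by nra.
  eapply Rle_trans; [apply Cmod_le_sum |].
  replace (Re (Cexp (a, b) - 1 - (a, b)))
    with ((exp a - 1 - a) + exp a * (cos b - 1))%R by (simpl; ring).
  replace (Im (Cexp (a, b) - 1 - (a, b)))
    with (exp a * (sin b - b) + (exp a - 1) * b)%R by (simpl; ring).
  assert (H1 : (Rabs (exp a - 1 - a + exp a * (cos b - 1)) <= 2 * a ^ 2 + b ^ 2)%R)
    by (apply Rabs_le_between; split; nra).
  assert (Hea : (Rabs (exp a - 1) <= 2 * r)%R) by (apply Rabs_le_between; split; nra).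
  assert (H2 : (Rabs (exp a * (sin b - b) + (exp a - 1) * b) <= 2 * b ^ 2 + 2 * r ^ 2)%R).
  { eapply Rle_trans; [apply Rabs_triang |]. rewrite !Rabs_mult.
    assert (Hs' : (Rabs (sin b - b) <= b ^ 2)%R) by (apply Rabs_le_between; lra).
    rewrite (Rabs_pos_eq (exp a)) by lra.
    pose proof (Rabs_pos (sin b - b)). pose proof (Rabs_pos (exp a - 1)). pose proof (Rabs_pos b).
    apply Rplus_le_compat; nra. }
  nra.
Qed.

(** Differentiability with an explicit remainder, so that product and chain rules are plain
    inequalities; [qdiff_is_derive] converts to [is_derive] only once, at the end. *)
Definition qdiff (f : C -> C) (z l : C) : Prop :=
  exists B r, (0 <= B)%R /\ (0 < r)%R /\
    forall h, (Cmod h < r)%R -> (Cmod (f (z + h)%C - f z - l * h) <= B * Cmod h ^ 2)%R.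

Lemma qdiff_lipschitz (f : C -> C) (z l : C) :
  qdiff f z l ->
  exists B r, (0 <= B)%R /\ (0 < r)%R /\
    forall h, (Cmod h < r)%R -> (Cmod (f (z + h)%C - f z) <= B * Cmod h)%R.
Proof.
  intros (B & r & HB & Hr & H). exists (B * r + Cmod l)%R, r.
  pose proof (Cmod_ge_0 l). split; [nra |]. split; [exact Hr |]. intros h Hh.
  replace (f (z + h) - f z) with ((f (z + h) - f z - l * h) + l * h) by ring.
  eapply Rle_trans; [apply Cmod_triangle |]. rewrite Cmod_mult. specialize (H h Hh).
  pose proof (Cmod_ge_0 h). assert (B * Cmod h ^ 2 <= B * r * Cmod h)%R; [| lra].
  replace (B * Cmod h ^ 2)%R with (B * Cmod h * Cmod h)%R by ring.
  apply Rmult_le_compat_r; [assumption |]. apply Rmult_le_compat_l; lra.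
Qed.

Lemma qdiff_mult (f g : C -> C) (z l m : C) :
  qdiff f z l -> qdiff g z m -> qdiff (fun x => f x * g x) z (l * g z + f z * m).
Proof.
  intros Hf Hg. destruct (qdiff_lipschitz f z l Hf) as (L & rl & HL & Hrl & Hlip).
  destruct Hf as (A & ra & HA & Hra & Hf). destruct Hg as (B & rb & HB & Hrb & Hg).
  exists (A * Cmod (g z) + Cmod (f z) * B + L * (B * rb + Cmod m))%R, (Rmin rl (Rmin ra rb)).
  pose proof (Cmod_ge_0 (g z)) as Hgz. pose proof (Cmod_ge_0 (f z)) as Hfz.
  pose proof (Cmod_ge_0 m) as Hm.
  split; [repeat apply Rplus_le_le_0_compat; repeat apply Rmult_le_pos; nra |].
  split; [repeat apply Rmin_glb_lt; assumption |]. intros h Hh.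
  assert (H1 : (Cmod h < rl)%R) by (eapply Rlt_le_trans; [exact Hh | apply Rmin_l]).
  assert (H2 : (Cmod h < ra)%R) by (eapply Rlt_le_trans; [exact Hh |];
    eapply Rle_trans; [apply Rmin_r | apply Rmin_l]).
  assert (H3 : (Cmod h < rb)%R) by (eapply Rlt_le_trans; [exact Hh |];
    eapply Rle_trans; [apply Rmin_r | apply Rmin_r]).
  specialize (Hlip h H1). specialize (Hf h H2). specialize (Hg h H3).
  pose proof (Cmod_ge_0 h) as Hh0.
  replace (f (z + h) * g (z + h) - f z * g z - (l * g z + f z * m) * h)
    with ((f (z + h) - f z - l * h) * g z + f z * (g (z + h) - g z - m * h)
          + (f (z + h) - f z) * ((g (z + h) - g z - m * h) + m * h)) by ring.
  eapply Rle_trans; [apply Cmod_triangle |].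
  eapply Rle_trans; [apply Rplus_le_compat_r, Cmod_triangle |]. rewrite !Cmod_mult.
  assert (Hgm : (Cmod (g (z + h)%C - g z - m * h + m * h) <= (B * rb + Cmod m) * Cmod h)%R).
  { eapply Rle_trans; [apply Cmod_triangle |]. rewrite Cmod_mult.
    assert (B * Cmod h ^ 2 <= B * rb * Cmod h)%R; [| lra].
    replace (B * Cmod h ^ 2)%R with (B * Cmod h * Cmod h)%R by ring.
    apply Rmult_le_compat_r; [assumption |]. apply Rmult_le_compat_l; lra. }
  rewrite !Rmult_plus_distr_r. repeat apply Rplus_le_compat.
  - replace (A * Cmod (g z) * Cmod h ^ 2)%R with (A * Cmod h ^ 2 * Cmod (g z))%R by ring.
    now apply Rmult_le_compat_r.
  - rewrite Rmult_assoc. now apply Rmult_le_compat_l.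
  - replace (L * (B * rb + Cmod m) * Cmod h ^ 2)%R
      with (L * Cmod h * ((B * rb + Cmod m) * Cmod h))%R by ring.
    apply Rmult_le_compat; auto using Cmod_ge_0.
Qed.

Lemma qdiff_comp (f g : C -> C) (z l m : C) :
  qdiff f (g z) l -> qdiff g z m -> qdiff (fun x => f (g x)) z (l * m).
Proof.
  intros Hf Hg. destruct (qdiff_lipschitz g z m Hg) as (L & rl & HL & Hrl & Hlip).
  destruct Hf as (A & ra & HA & Hra & Hf). destruct Hg as (B & rb & HB & Hrb & Hg).
  pose proof (Cmod_ge_0 l) as Hl.
  exists (A * L ^ 2 + Cmod l * B)%R, (Rmin (ra / (L + 1)) (Rmin rl rb)).
  assert (Hq : (0 < ra / (L + 1))%R) by (apply Rdiv_lt_0_compat; lra).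
  split; [apply Rplus_le_le_0_compat; apply Rmult_le_pos; nra |].
  split; [repeat apply Rmin_glb_lt; assumption |]. intros h Hh.
  assert (H1 : (Cmod h < ra / (L + 1))%R) by (eapply Rlt_le_trans; [exact Hh | apply Rmin_l]).
  assert (H2 : (Cmod h < rl)%R) by (eapply Rlt_le_trans; [exact Hh |];
    eapply Rle_trans; [apply Rmin_r | apply Rmin_l]).
  assert (H3 : (Cmod h < rb)%R) by (eapply Rlt_le_trans; [exact Hh |];
    eapply Rle_trans; [apply Rmin_r | apply Rmin_r]).
  specialize (Hlip h H2). specialize (Hg h H3). pose proof (Cmod_ge_0 h) as Hh0.
  apply Rlt_div_r in H1; [| lra].
  assert (Hk : (Cmod (g (z + h)%C - g z) < ra)%R) by nra.
  specialize (Hf _ Hk). replace (g z + (g (z + h) - g z)) with (g (z + h)) in Hf by ring.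
  replace (f (g (z + h)) - f (g z) - l * m * h)
    with ((f (g (z + h)) - f (g z) - l * (g (z + h) - g z)) + l * (g (z + h) - g z - m * h)) by ring.
  eapply Rle_trans; [apply Cmod_triangle |]. rewrite Cmod_mult, Rmult_plus_distr_r.
  apply Rplus_le_compat.
  - eapply Rle_trans; [exact Hf |]. rewrite Rmult_assoc, <- Rpow_mult_distr.
    apply Rmult_le_compat_l; [exact HA |]. apply pow_incr. split; [apply Cmod_ge_0 | exact Hlip].
  - rewrite Rmult_assoc. now apply Rmult_le_compat_l.
Qed.

Lemma qdiff_Cexp_linear (a z : C) : qdiff (fun x => Cexp (a * x)) z (a * Cexp (a * z)).
Proof.
  pose proof (Cmod_ge_0 a) as Ha.
  exists (Cmod (Cexp (a * z)) * (8 * Cmod a ^ 2))%R, (/ (2 * (Cmod a + 1)))%R.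
  split; [apply Rmult_le_pos; [apply Cmod_ge_0 | nra] |].
  split; [apply Rinv_0_lt_compat; lra |]. intros h Hh.
  assert (Hah : (Cmod (a * h) <= / 2)%R).
  { rewrite Cmod_mult. pose proof (Cmod_ge_0 h).
    replace (/ (2 * (Cmod a + 1)))%R with ((/ 2) / (Cmod a + 1))%R in Hh by (field; lra).
    apply Rlt_div_r in Hh; [| lra]. nra. }
  replace (Cexp (a * (z + h)) - Cexp (a * z) - a * Cexp (a * z) * h)
    with (Cexp (a * z) * (Cexp (a * h) - 1 - a * h))
    by (replace (a * (z + h)) with (a * z + a * h) by ring; rewrite Cexp_plus; ring).
  rewrite Cmod_mult, Rmult_assoc. apply Rmult_le_compat_l; [apply Cmod_ge_0 |].
  eapply Rle_trans; [now apply Cexp_quadratic |]. rewrite Cmod_mult. apply Req_le. ring.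
Qed.

(** Dividing twice by [w + h - w] is a Taylor expansion whose remainder is [h^2] times a bounded
    series. The strict inequality keeps [w + h] in the closed disc for small [h]. *)
Lemma qdiff_ev (c : nat -> C) (w : C) :
  rapid c -> (Cmod w < 1)%R -> qdiff (ev c) w (ev (sdiv w c) w).
Proof.
  intros Hc Hw. assert (Hw' : (Cmod w <= 1)%R) by lra.
  pose proof (rapid_div w c Hw' Hc) as Hd.
  destruct (rapid_div w _ Hw' Hd 2%nat) as [B HB].
  exists B, (1 - Cmod w)%R. split; [now apply decay_nonneg in HB |]. split; [lra |].
  intros h Hh. assert (Hwh : (Cmod (w + h) <= 1)%R).
  { eapply Rle_trans; [apply Cmod_triangle | lra]. }
  rewrite (ev_div w (w + h) c), (ev_div w (w + h) (sdiv w c)) by assumption.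
  match goal with |- (Cmod ?x <= _)%R =>
    replace x with (ev (sdiv w (sdiv w c)) (w + h) * h ^ 2) by (simpl; ring) end.
  rewrite Cmod_mult, Cmod_pow. apply Rmult_le_compat_r; [apply pow_le, Cmod_ge_0 |].
  now apply ev_decay.
Qed.

Lemma qdiff_is_derive (f : C -> C) (z l : C) :
  qdiff f z l -> is_derive (K := C_AbsRing) (V := C_NormedModule) f z l.
Proof.
  intros (B & r & HB & Hr & H). split; [apply is_linear_scal_l |].
  intros x Hx.
  pose proof (@is_filter_lim_locally_unique C_AbsRing (AbsRing_NormedModule C_AbsRing) z x Hx)
    as E. subst x.
  intros eps. simpl.
  assert (Hd : (0 < Rmin r (eps / (B + 1)))%R).
  { apply Rmin_glb_lt; [exact Hr |]. apply Rdiv_lt_0_compat; [apply cond_pos | lra]. }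
  exists (mkposreal _ Hd). refine (fun (y : C) Hy => _).
  change (Cmod (y - z) < Rmin r (eps / (B + 1)))%R in Hy.
  change (Cmod (f y - f z - (y - z) * l) <= eps * Cmod (y - z))%R.
  assert (H1 : (Cmod (y - z) < r)%R) by (eapply Rlt_le_trans; [exact Hy | apply Rmin_l]).
  assert (H2 : (Cmod (y - z) < eps / (B + 1))%R)
    by (eapply Rlt_le_trans; [exact Hy | apply Rmin_r]).
  specialize (H _ H1). replace (z + (y - z)) with y in H by ring.
  replace (f y - f z - (y - z) * l) with (f y - f z - l * (y - z)) by ring.
  eapply Rle_trans; [exact H |]. apply Rlt_div_r in H2; [| lra].
  pose proof (Cmod_ge_0 (y - z)). nra.
Qed.

Lemma Cmod_Cexp_upper (z : C) : (0 <= Im z)%R -> (Cmod (Cexp (Ci / 2 * z)) <= 1)%R.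
Proof.
  intros Hz. rewrite Cmod_Cexp, <- exp_0. apply exp_le.
  replace (Re (Ci / 2 * z)) with (- (Im z / 2))%R; [lra |].
  destruct z as [x y]. simpl. field.
Qed.

Lemma Cmod_Cexp_upper_lt (z : C) : (0 < Im z)%R -> (Cmod (Cexp (Ci / 2 * z)) < 1)%R.
Proof.
  intros Hz. rewrite Cmod_Cexp, <- exp_0. apply exp_increasing.
  replace (Re (Ci / 2 * z)) with (- (Im z / 2))%R; [lra |].
  destruct z as [x y]. simpl. field.
Qed.

(** This is [w^-2 ev c w] with [w = e^{iz/2}]; the prefactor accounts for the [- 2] in [sderiv]. *)
Definition wave (c : nat -> C) (z : C) : C := Cexp (- Ci * z) * ev c (Cexp (Ci / 2 * z)).

Lemma wave_derive (c : nat -> C) (z : C) :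
  rapid c -> (0 < Im z)%R ->
  is_derive (K := C_AbsRing) (V := C_NormedModule) (wave c) z (wave (sderiv c) z).
Proof.
  intros Hc Hz. apply qdiff_is_derive.
  pose proof (Cmod_Cexp_upper_lt z Hz) as Hw.
  replace (wave (sderiv c) z) with
    (- Ci * Cexp (- Ci * z) * ev c (Cexp (Ci / 2 * z)) +
     Cexp (- Ci * z) * (ev (sdiv (Cexp (Ci / 2 * z)) c) (Cexp (Ci / 2 * z)) *
                        (Ci / 2 * Cexp (Ci / 2 * z)))).
  - apply (qdiff_mult (fun x => Cexp (- Ci * x)) (fun x => ev c (Cexp (Ci / 2 * x))));
      [apply qdiff_Cexp_linear |].
    apply (qdiff_comp (ev c) (fun x => Cexp (Ci / 2 * x)));
      [now apply qdiff_ev | apply qdiff_Cexp_linear].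
  - unfold wave. rewrite ev_deriv by (assumption || lra). field.
Qed.

(** Increments are restricted to the closed upper half-plane, which corresponds to the closed disc,
    the only place where [ev c] is controlled. *)
Lemma wave_boundary (c : nat -> C) (z : C) :
  rapid c -> (0 <= Im z)%R ->
  exists B r, (0 <= B)%R /\ (0 < r)%R /\
    forall h, (Cmod h < r)%R -> (0 <= Im (z + h))%R ->
      (Cmod (wave c (z + h) - wave c z) <= B * Cmod h)%R.
Proof.
  intros Hc Hz. set (w := Cexp (Ci / 2 * z)).
  destruct (qdiff_lipschitz _ _ _ (qdiff_Cexp_linear (- Ci) z)) as (A & ra & HA & Hra & HE).
  destruct (qdiff_lipschitz _ _ _ (qdiff_Cexp_linear (Ci / 2) z)) as (A' & rb & HA' & Hrb & HW).
  destruct (ev_lipschitz w c (Cmod_Cexp_upper z Hz) Hc) as (L & HL & Hlip).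
  destruct (Hc 2%nat) as [M HM]. pose proof (decay_nonneg _ _ _ HM) as HM0.
  pose proof (Cmod_ge_0 (Cexp (- Ci * z))) as He.
  exists (A * M + Cmod (Cexp (- Ci * z)) * (L * A'))%R, (Rmin ra rb).
  split; [apply Rplus_le_le_0_compat; repeat apply Rmult_le_pos; assumption |].
  split; [now apply Rmin_glb_lt |]. intros h Hh Him.
  assert (H1 : (Cmod h < ra)%R) by (eapply Rlt_le_trans; [exact Hh | apply Rmin_l]).
  assert (H2 : (Cmod h < rb)%R) by (eapply Rlt_le_trans; [exact Hh | apply Rmin_r]).
  specialize (HE h H1). specialize (HW h H2). cbn beta in HE, HW. fold w in HW.
  pose proof (Cmod_Cexp_upper _ Him) as Hw'.
  specialize (Hlip _ Hw'). destruct (ev_decay _ _ _ HM Hw') as [_ Hev].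
  unfold wave. fold w. set (w' := Cexp (Ci / 2 * (z + h))) in *.
  replace (Cexp (- Ci * (z + h)) * ev c w' - Cexp (- Ci * z) * ev c w)
    with ((Cexp (- Ci * (z + h)) - Cexp (- Ci * z)) * ev c w'
          + Cexp (- Ci * z) * (ev c w' - ev c w)) by ring.
  eapply Rle_trans; [apply Cmod_triangle |]. rewrite !Cmod_mult, Rmult_plus_distr_r.
  pose proof (Cmod_ge_0 h).
  apply Rplus_le_compat.
  - replace (A * M * Cmod h)%R with (A * Cmod h * M)%R by ring.
    apply Rmult_le_compat; auto using Cmod_ge_0.
  - rewrite Rmult_assoc. apply Rmult_le_compat_l; [exact He |].
    eapply Rle_trans; [exact Hlip |]. rewrite Rmult_assoc.
    apply Rmult_le_compat_l; assumption.
Qed.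

Lemma wave_extended_derivatives (F : C -> C) (c : nat -> C) :
  rapid c -> (forall z, (0 <= Im z)%R -> F z = wave c z) ->
  extended_derivatives F (fun k => wave (Nat.iter k sderiv c)).
Proof.
  intros Hc HF. split; [intros z Hz; now rewrite HF |]. split.
  - intros k z Hz. simpl. apply wave_derive; [now apply rapid_iter_deriv | exact Hz].
  - intros k z Hz.
    destruct (wave_boundary (Nat.iter k sderiv c) z) as (B & r & HB & Hr & H);
      [now apply rapid_iter_deriv | lra |].
    apply filterlim_locally. intros eps.
    (* Balls of [locally] in [C] are products of intervals; half the radius keeps the modulus below
       the target. *)
    assert (Hd : (0 < Rmin r (eps / (B + 1)) / 2)%R).
    { apply Rdiv_lt_0_compat; [| lra]. apply Rmin_glb_lt; [exact Hr |].
      apply Rdiv_lt_0_compat; [apply cond_pos | lra]. }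
    exists (mkposreal _ Hd). refine (fun (y : C) Hy Him => _).
    assert (Hyz : (Cmod (y - z) < Rmin r (eps / (B + 1)))%R).
    { replace (Rmin r (eps / (B + 1)))%R with (2 * (Rmin r (eps / (B + 1)) / 2))%R by field.
      destruct Hy as [Hy1 Hy2]. apply Cmod_le_components; [exact Hy1 | exact Hy2]. }
    assert (H1 : (Cmod (y - z) < r)%R) by (eapply Rlt_le_trans; [exact Hyz | apply Rmin_l]).
    assert (H2 : (Cmod (y - z) < eps / (B + 1))%R)
      by (eapply Rlt_le_trans; [exact Hyz | apply Rmin_r]).
    specialize (H _ H1). replace (z + (y - z)) with y in H by ring.
    specialize (H (Rlt_le _ _ Him)). apply Rlt_div_r in H2; [| lra].
    assert (Hlt : (Cmod (wave (Nat.iter k sderiv c) y - wave (Nat.iter k sderiv c) z) < eps)%R).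
    { pose proof (Cmod_ge_0 (y - z)). nra. }
    apply C_NormedModule_mixin_compat1. exact Hlt.
Qed.

Lemma wave_multiplicity (F : C -> C) (c : nat -> C) (z : C) :
  sqrt_exp_decay c -> c 0%nat <> 0 ->
  (forall z, (0 <= Im z)%R -> F z = wave c z) -> (0 <= Im z)%R ->
  exists k, zero_multiplicity F z k.
Proof.
  intros Hs Hc0 HF Hz. pose proof (sqrt_exp_decay_rapid c Hs) as Hc.
  set (w := Cexp (Ci / 2 * z)). pose proof (Cmod_Cexp_upper z Hz) as Hw. fold w in Hw.
  assert (Hne : forall x, Cexp x <> 0).
  { intros x E. apply (f_equal Cmod) in E. rewrite Cmod_Cexp, Cmod_0 in E.
    pose proof (exp_pos (Re x)). lra. }
  destruct (finite_order c w Hs Hc0 Hw) as [k [Hk1 Hk2]].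
  destruct (iter_deriv_order w k c (sdivn w k c) Hw (Hne _)) as [H1 H2]; auto using rapid_divn, slin_divn.
  exists k. exists (fun k => wave (Nat.iter k sderiv c)).
  split; [now apply wave_extended_derivatives |]. unfold wave. fold w. split.
  - intros j Hj. rewrite H1 by exact Hj. ring.
  - apply Cmult_neq_0; [apply Hne | exact H2].
Qed.

(** * Coefficients of size [exp (- kappa sqrt m)] *)

(** The argument is real because the kernels are estimated with the combined index [m + 4 n]. *)
Definition esqrt (kappa x : R) : R := exp (- (kappa * sqrt x)).

Lemma esqrt_pos (kappa x : R) : (0 < esqrt kappa x)%R.
Proof. apply exp_pos. Qed.

Lemma esqrt_decr (kappa x y : R) :
  (0 < kappa)%R -> (x <= y)%R -> (esqrt kappa y <= esqrt kappa x)%R.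
Proof.
  intros Hk Hxy. apply exp_le. apply Ropp_le_contravar.
  apply Rmult_le_compat_l; [lra |]. now apply sqrt_le_1_alt.
Qed.

Lemma esqrt_0 (kappa : R) : esqrt kappa 0 = 1%R.
Proof. unfold esqrt. rewrite sqrt_0, Rmult_0_r, Ropp_0. apply exp_0. Qed.

Lemma esqrt_le_1 (kappa x : R) : (0 < kappa)%R -> (esqrt kappa x <= 1)%R.
Proof.
  intros Hk. unfold esqrt. rewrite <- exp_0. apply exp_le.
  pose proof (sqrt_pos x). nra.
Qed.

Lemma sqrt_succ_le (x : R) : (0 <= x)%R -> (sqrt (x + 1) <= sqrt x + 1)%R.
Proof.
  intros Hx. apply Rsqr_incr_0; [| apply sqrt_pos | pose proof (sqrt_pos x); lra].
  rewrite Rsqr_sqrt by lra. unfold Rsqr. pose proof (sqrt_pos x).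
  pose proof (sqrt_sqrt x Hx). lra.
Qed.

Lemma esqrt_succ (kappa x : R) :
  (0 < kappa)%R -> (0 <= x)%R -> (esqrt kappa x <= exp kappa * esqrt kappa (x + 1))%R.
Proof.
  intros Hk Hx. unfold esqrt. rewrite <- exp_plus. apply exp_le.
  pose proof (sqrt_succ_le x Hx). nra.
Qed.

Definition edecay (kappa : R) (c : nat -> C) : Prop :=
  exists B, (0 <= B)%R /\ forall m, (Cmod (c m) <= B * esqrt kappa (INR m))%R.

Lemma edecay_sqrt_exp (kappa : R) (c : nat -> C) :
  (0 < kappa)%R -> edecay kappa c -> sqrt_exp_decay c.
Proof. intros Hk [B [HB H]]. now exists B, kappa. Qed.

Lemma edecay_rapid (kappa : R) (c : nat -> C) : (0 < kappa)%R -> edecay kappa c -> rapid c.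
Proof. intros Hk H. now apply sqrt_exp_decay_rapid, edecay_sqrt_exp with kappa. Qed.

Lemma edecay_plus (kappa : R) (c d : nat -> C) :
  edecay kappa c -> edecay kappa d -> edecay kappa (splus c d).
Proof.
  intros [B [HB H]] [B' [HB' H']]. exists (B + B')%R. split; [lra |]. intro m.
  eapply Rle_trans; [apply Cmod_triangle |]. rewrite Rmult_plus_distr_r.
  now apply Rplus_le_compat.
Qed.

Lemma edecay_scal (kappa : R) (x : C) (c : nat -> C) :
  edecay kappa c -> edecay kappa (sscal x c).
Proof.
  intros [B [HB H]]. exists (Cmod x * B)%R. pose proof (Cmod_ge_0 x). split; [nra |].
  intro m. unfold sscal. rewrite Cmod_mult, Rmult_assoc. now apply Rmult_le_compat_l.
Qed.

Lemma edecay_shift (kappa : R) (c : nat -> C) :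
  (0 < kappa)%R -> edecay kappa c -> edecay kappa (sshift c).
Proof.
  intros Hk [B [HB H]]. exists (B * exp kappa)%R. pose proof (exp_pos kappa).
  split; [nra |]. intros [| m]; simpl sshift.
  - rewrite Cmod_0. apply Rmult_le_pos; [nra | left; apply esqrt_pos].
  - eapply Rle_trans; [apply H |]. rewrite Rmult_assoc. apply Rmult_le_compat_l; [exact HB |].
    rewrite S_INR. apply esqrt_succ; [exact Hk | apply pos_INR].
Qed.

Lemma edecay_iter_shift (kappa : R) (j : nat) (c : nat -> C) :
  (0 < kappa)%R -> edecay kappa c -> edecay kappa (Nat.iter j sshift c).
Proof. intros Hk Hc. induction j; [exact Hc |]. now apply edecay_shift. Qed.

(** * Cauchy products *)

Definition sconv (c d : nat -> C) (m : nat) : C := csum (fun k => c k * d (m - k)%nat) (S m).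

Lemma csum_ext_lt (f g : nat -> C) (n : nat) :
  (forall k, (k < n)%nat -> f k = g k) -> csum f n = csum g n.
Proof.
  intros H. induction n as [| n IH]; [reflexivity |]. simpl. rewrite IH, H; auto.
Qed.

Lemma Cmod_csum_le_lt (f : nat -> C) (B : R) (n : nat) :
  (forall k, (k < n)%nat -> Cmod (f k) <= B)%R -> (Cmod (csum f n) <= INR n * B)%R.
Proof.
  intros H. induction n as [| n IH].
  - simpl. rewrite Cmod_0. lra.
  - simpl csum. rewrite S_INR. eapply Rle_trans; [apply Cmod_triangle |].
    specialize (IH (fun k Hk => H k ltac:(lia))). specialize (H n ltac:(lia)). lra.
Qed.

Lemma sqrt_subadd (x y : R) : (0 <= x)%R -> (0 <= y)%R -> (sqrt (x + y) <= sqrt x + sqrt y)%R.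
Proof.
  intros Hx Hy. pose proof (sqrt_pos x). pose proof (sqrt_pos y).
  apply Rsqr_incr_0; [| apply sqrt_pos | lra].
  rewrite Rsqr_sqrt by lra. unfold Rsqr.
  pose proof (sqrt_sqrt x Hx). pose proof (sqrt_sqrt y Hy). nra.
Qed.

(** By subadditivity of the square root every term of the convolution is bounded by a multiple of
    [esqrt kappa m]. The number [m + 1] of terms is paid for with half of the rate. *)
Lemma edecay_conv (kappa : R) (c d : nat -> C) :
  (0 < kappa)%R -> edecay kappa c -> edecay kappa d -> edecay (kappa / 2) (sconv c d).
Proof.
  intros Hk [B [HB H]] [B' [HB' H']].
  set (Q := (1 + 2 / (kappa / 2) ^ 2)%R).
  assert (HQ : (0 <= 2 / (kappa / 2) ^ 2)%R) by (apply Rdiv_le_0_compat; nra).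
  exists (B * B' * Q)%R. split; [unfold Q; apply Rmult_le_pos; nra |]. intro m. unfold sconv.
  eapply Rle_trans.
  { apply Cmod_csum_le_lt with (B := (B * B' * esqrt kappa (INR m))%R). intros k Hkm.
    rewrite Cmod_mult. apply Rle_trans with ((B * esqrt kappa (INR k)) * (B' * esqrt kappa (INR (m - k))))%R.
    - apply Rmult_le_compat; auto using Cmod_ge_0.
    - replace (B * esqrt kappa (INR k) * (B' * esqrt kappa (INR (m - k))))%R
        with (B * B' * (esqrt kappa (INR k) * esqrt kappa (INR (m - k))))%R by ring.
      apply Rmult_le_compat_l; [nra |]. unfold esqrt. rewrite <- exp_plus. apply exp_le.
      pose proof (sqrt_subadd (INR k) (INR (m - k)) (pos_INR _) (pos_INR _)) as Hs.
      rewrite <- plus_INR in Hs. replace (k + (m - k))%nat with m in Hs by lia. nra. }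
  replace (INR (S m) * (B * B' * esqrt kappa (INR m)))%R
    with (B * B' * (INR (S m) * esqrt kappa (INR m)))%R by ring.
  rewrite (Rmult_assoc (B * B')). apply Rmult_le_compat_l; [nra |].
  set (x := (kappa / 2 * sqrt (INR m))%R).
  assert (E : esqrt kappa (INR m) = (esqrt (kappa / 2) (INR m) * esqrt (kappa / 2) (INR m))%R).
  { unfold esqrt. rewrite <- exp_plus. f_equal. field. }
  rewrite E, <- Rmult_assoc. apply Rmult_le_compat_r; [left; apply esqrt_pos |].
  assert (Hx : (0 <= x)%R) by (unfold x; pose proof (sqrt_pos (INR m)); apply Rmult_le_pos; lra).
  change (esqrt (kappa / 2) (INR m)) with (exp (- x)). rewrite exp_Ropp.
  apply Rle_div_l; [apply exp_pos |].
  pose proof (pow_le_exp x 2 Hx) as H2. simpl (INR (fact 2)) in H2.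
  assert (Hm : (x ^ 2 = (kappa / 2) ^ 2 * INR m)%R).
  { unfold x. rewrite Rpow_mult_distr, pow2_sqrt; [reflexivity | apply pos_INR]. }
  rewrite Hm in H2. pose proof (exp_ineq1_le x) as H3. rewrite S_INR.
  assert (Hk2 : (0 < (kappa / 2) ^ 2)%R) by (apply pow_lt; lra).
  assert (H4 : (INR m <= 2 / (kappa / 2) ^ 2 * exp x)%R).
  { replace (2 / (kappa / 2) ^ 2 * exp x)%R with ((2 * exp x) / (kappa / 2) ^ 2)%R by (field; lra).
    apply Rle_div_r; lra. }
  unfold Q. lra.
Qed.

Lemma Re_csum (f : nat -> C) (n : nat) : Re (csum f (S n)) = sum_f_R0 (fun k => Re (f k)) n.
Proof.
  induction n as [| n IH]; [simpl; apply Rplus_0_l |].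
  change (csum f (S (S n))) with (csum f (S n) + f (S n)). rewrite re_plus, IH. reflexivity.
Qed.

Lemma Im_csum (f : nat -> C) (n : nat) : Im (csum f (S n)) = sum_f_R0 (fun k => Im (f k)) n.
Proof.
  induction n as [| n IH]; [simpl; apply Rplus_0_l |].
  change (csum f (S (S n))) with (csum f (S n) + f (S n)).
  replace (Im (csum f (S n) + f (S n))) with (Im (csum f (S n)) + Im (f (S n)))%R by reflexivity.
  rewrite IH. reflexivity.
Qed.

Lemma Series_cauchy (a b : nat -> R) :
  ex_series (fun n => Rabs (a n)) -> ex_series (fun n => Rabs (b n)) ->
  is_series (fun n => sum_f_R0 (fun k => (a k * b (n - k)%nat)%R) n) (Series a * Series b)%R.
Proof.
  intros Ha Hb. apply is_series_mult; auto; apply Series_correct; now apply ex_series_Rabs.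
Qed.

Lemma CSeries_cauchy (u v : nat -> C) :
  abs_conv u -> abs_conv v -> CSeries (sconv u v) = CSeries u * CSeries v.
Proof.
  intros Hu Hv.
  assert (HR : forall u, abs_conv u -> ex_series (fun n => Rabs (Re (u n)))).
  { intros x Hx. apply (@ex_series_le R_AbsRing R_CompleteNormedModule _ _) with (2 := Hx).
    intro n. change (Rabs (Rabs (Re (x n))) <= Cmod (x n))%R. rewrite Rabs_Rabsolu. apply re_le_Cmod. }
  assert (HI : forall u, abs_conv u -> ex_series (fun n => Rabs (Im (u n)))).
  { intros x Hx. apply (@ex_series_le R_AbsRing R_CompleteNormedModule _ _) with (2 := Hx).
    intro n. change (Rabs (Rabs (Im (x n))) <= Cmod (x n))%R. rewrite Rabs_Rabsolu. apply im_le_Cmod. }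
  apply C_ext.
  - rewrite re_mult, !re_CSeries, !im_CSeries. apply is_series_unique.
    eapply is_series_ext; [| apply (is_series_minus (V := R_NormedModule));
      [apply (Series_cauchy _ _ (HR u Hu) (HR v Hv)) | apply (Series_cauchy _ _ (HI u Hu) (HI v Hv))]].
    intro n. unfold sconv. rewrite Re_csum. change plus with Rplus. change opp with Ropp.
    cbn beta. symmetry. etransitivity; [apply sum_eq; intros i _; apply re_mult |].
    apply minus_sum.
  - rewrite im_mult, !re_CSeries, !im_CSeries. apply is_series_unique.
    eapply is_series_ext; [| apply (is_series_plus (V := R_NormedModule));
      [apply (Series_cauchy _ _ (HR u Hu) (HI v Hv)) | apply (Series_cauchy _ _ (HI u Hu) (HR v Hv))]].
    intro n. unfold sconv. rewrite Im_csum. change plus with Rplus.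
    cbn beta. symmetry. etransitivity; [apply sum_eq; intros i _; apply im_mult |].
    apply sum_plus.
Qed.

Lemma ev_conv (c d : nat -> C) (w : C) :
  rapid c -> rapid d -> (Cmod w <= 1)%R -> ev (sconv c d) w = ev c w * ev d w.
Proof.
  intros Hc Hd Hw. unfold ev. rewrite <- CSeries_cauchy by now apply rapid_abs_conv.
  apply CSeries_ext. intro m. unfold sconv.
  rewrite Cmult_comm, <- csum_scal. apply csum_ext_lt. intros k Hk.
  replace m with (k + (m - k))%nat at 1 by lia. rewrite Cpow_add_r. ring.
Qed.

Lemma sconv_0 (c d : nat -> C) : sconv c d 0 = c 0%nat * d 0%nat.
Proof. unfold sconv. simpl. ring. Qed.

(** * The Jost kernels *)

(** The leading [1] of the Jost bracket is stored at index [0], so that [ev] gives the whole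
    bracket. *)
Definition kap (a p q : Z -> C) (n : Z) (m : nat) : C :=
  match m with O => 1 | _ => K_plus a p q m n end.

(** The common form of the summands in the five cases of [K_plus]: shifts produce zero at negative
    indices and the value [1] at index [0] supplies the inhomogeneous terms. *)
Definition kap_src (a p q : Z -> C) (r : Z) : nat -> C :=
  splus (sscal (1 - a r * a r) (Nat.iter 4 sshift (kap a p q (r + 1)%Z)))
    (splus (sscal (h a q r) (Nat.iter 2 sshift (kap a p q r)))
      (splus (sscal (2 * p r) (Nat.iter 1 sshift (kap a p q r)))
             (sscal (2 * p r) (Nat.iter 3 sshift (kap a p q r))))).

Lemma sum_ge_ext (n : Z) (u v : Z -> C) : (forall r, u r = v r) -> sum_ge n u = sum_ge n v.
Proof. intros H. apply CSeries_ext. intro. apply H. Qed.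

(** Valid for divergent series too, as [Series_scal_l] is; [K_plus_S] uses it before any convergence
    is known. *)
Lemma CSeries_scal_R (x : R) (u : nat -> C) :
  CSeries (fun k => RtoC x * u k) = RtoC x * CSeries u.
Proof.
  unfold CSeries. apply C_ext; simpl.
  - rewrite Rmult_0_l, Rminus_0_r, <- Series_scal_l. apply Series_ext. intro n. destruct (u n). simpl. ring.
  - rewrite Rmult_0_l, Rplus_0_r, <- Series_scal_l. apply Series_ext. intro n. destruct (u n). simpl. ring.
Qed.

(** The shifted term outside the sum uses [K_plus], which is zero at index [0], and not [kap]: the
    fourth kernel contains no additional [1]. *)
Lemma K_plus_S (a p q : Z -> C) (m : nat) (n : Z) :
  K_plus a p q (S m) n =
  Nat.iter 4 sshift (fun m => K_plus a p q m (n + 1)%Z) (S m)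
  + sum_ge (n + 1) (fun r => kap_src a p q r (S m)).
Proof.
  destruct m as [| [| [| [| m]]]].
  - change (K_plus a p q 1 n) with (2 * sum_ge (n + 1) p).
    simpl Nat.iter. rewrite Cplus_0_l. unfold sum_ge. rewrite <- CSeries_scal_R.
    apply CSeries_ext. intro j. unfold kap_src, splus, sscal.
    cbn [Nat.iter sshift kap nat_rect]. ring.
  - change (K_plus a p q 2 n)
      with (sum_ge (n + 1) (fun r => h a q r + 2 * p r * K_plus a p q 1 r)).
    simpl Nat.iter. rewrite Cplus_0_l. apply sum_ge_ext. intro r.
    unfold kap_src, splus, sscal.
    cbn [Nat.iter sshift kap nat_rect]. ring.
  - change (K_plus a p q 3 n)
      with (sum_ge (n + 1) (fun r => h a q r * K_plus a p q 1 r + 2 * p r * (K_plus a p q 2 r + 1))).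
    simpl Nat.iter. rewrite Cplus_0_l. apply sum_ge_ext. intro r.
    unfold kap_src, splus, sscal. cbn [Nat.iter sshift kap nat_rect]. ring.
  - change (K_plus a p q 4 n)
      with (sum_ge (n + 1) (fun r => (1 - a r * a r) + h a q r * K_plus a p q 2 r
        + 2 * p r * (K_plus a p q 3 r + K_plus a p q 1 r))).
    simpl Nat.iter. rewrite Cplus_0_l. apply sum_ge_ext. intro r.
    unfold kap_src, splus, sscal. cbn [Nat.iter sshift kap nat_rect]. ring.
  - change (K_plus a p q (S (S (S (S (S m))))) n)
      with (K_plus a p q (S m) (n + 1)%Z + sum_ge (n + 1) (fun r =>
          (1 - a r * a r) * K_plus a p q (S m) (r + 1)%Z
          + h a q r * K_plus a p q (S (S (S m))) r
          + 2 * p r * (K_plus a p q (S (S m)) r + K_plus a p q (S (S (S (S m)))) r))).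
    f_equal. apply sum_ge_ext. intro r.
    unfold kap_src, splus, sscal. cbn [Nat.iter sshift kap nat_rect]. ring.
Qed.

Lemma iter_shift_spec (j m : nat) (c : nat -> C) :
  Nat.iter j sshift c m = if (m <? j)%nat then 0 else c (m - j)%nat.
Proof.
  revert m. induction j as [| j IH]; intro m; [simpl; now rewrite Nat.sub_0_r |].
  destruct m as [| m]; simpl; [reflexivity |]. rewrite IH. reflexivity.
Qed.

(** [tau r = 2 / (r (r + 1) (r + 2))] is the second difference of [1 / (n + 1)]. *)
Definition tau (r : Z) : R := (2 / (IZR r * (IZR r + 1) * (IZR r + 2)))%R.

(** The quarter leaves room for the four terms of [kap_src], the factor [tau r] makes double sums
    telescope, and the argument [4 r] matches the weight [m + 4 n] of the kernels. *)
Definition small_coef (kappa : R) (r : Z) (x : C) : Prop :=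
  (Cmod x <= tau r / 4 * esqrt kappa (4 * IZR r))%R.

Definition small_from (kappa : R) (n0 : Z) (a p q : Z -> C) : Prop :=
  (0 <= n0)%Z /\ forall r, (n0 < r)%Z ->
    small_coef kappa r (1 - a r) /\ small_coef kappa r (1 - a r * a r) /\
    small_coef kappa r (h a q r) /\ small_coef kappa r (2 * p r) /\
    small_coef kappa r (1 - a (r - 1)%Z).

Lemma tau_pos (r : Z) : (0 < r)%Z -> (0 < tau r)%R.
Proof.
  intros H. apply IZR_lt in H. unfold tau. apply Rdiv_lt_0_compat; [lra |].
  repeat apply Rmult_lt_0_compat; lra.
Qed.

Lemma tau_telescope (n : Z) (j : nat) :
  (0 <= n)%Z ->
  tau (n + 1 + Z.of_nat j) =
  (/ ((IZR n + 1 + INR j) * (IZR n + 2 + INR j))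
   - / ((IZR n + 1 + INR (S j)) * (IZR n + 2 + INR (S j))))%R.
Proof.
  intros H. apply IZR_le in H. pose proof (pos_INR j). unfold tau.
  rewrite !plus_IZR, <- INR_IZR_INZ, S_INR. field. lra.
Qed.

(** Bounding by [esqrt (m + 4 n)] rather than [esqrt m] makes the shift
    [(n, m) -> (n + 1, m - 4)] in the recursion harmless. *)
Lemma K_plus_bound (kappa : R) (n0 : Z) (a p q : Z -> C) :
  (0 < kappa)%R -> small_from kappa n0 a p q ->
  forall M n, (n0 <= n)%Z ->
    (Cmod (K_plus a p q M n) <= / (IZR n + 1) * esqrt kappa (INR M + 4 * IZR n))%R /\
    (forall r, (n < r)%Z -> (Cmod (kap_src a p q r M) <= tau r * esqrt kappa (INR M + 4 * IZR n))%R) /\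
    abs_conv (fun j => kap_src a p q (n + 1 + Z.of_nat j) M).
Proof.
  intros Hk [Hn0 Hsm] M. induction M as [M IH] using lt_wf_ind. intros n Hn.
  assert (Hn' : (0 <= IZR n)%R) by (apply (IZR_le 0); lia).
  assert (Hsrc : forall r, (n < r)%Z ->
     (Cmod (kap_src a p q r M) <= tau r * esqrt kappa (INR M + 4 * IZR n))%R).
  { intros r Hr.
    assert (Hterm : forall (x : C) (r' : Z) (j : nat), small_coef kappa r x -> (r <= r')%Z ->
       (1 <= j <= 4)%nat ->
       (Cmod (x * Nat.iter j sshift (kap a p q r') M)
        <= tau r / 4 * esqrt kappa (INR M + 4 * IZR n))%R).
    { intros x r' j Hx Hr' Hj. rewrite iter_shift_spec. pose proof (tau_pos r ltac:(lia)) as Ht.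
      assert (Hrn : (IZR n + 1 <= IZR r)%R) by (rewrite <- plus_IZR; apply IZR_le; lia).
      assert (Hrr : (IZR r <= IZR r')%R) by (apply IZR_le; lia).
      destruct (Nat.ltb_spec M j) as [HMj | HMj].
      - rewrite Cmult_0_r, Cmod_0. apply Rmult_le_pos; [lra | left; apply esqrt_pos].
      - destruct (M - j)%nat as [| m'] eqn:Em.
        (* The entry is the leading [1], so the decay comes from the coefficient: [M <= 4] and
           [r >= n + 1] give [4 r >= M + 4 n]. *)
        + simpl kap. rewrite Cmult_1_r. eapply Rle_trans; [exact Hx |].
          apply Rmult_le_compat_l; [lra |]. apply esqrt_decr; [exact Hk |].
          assert (HM4 : (INR M <= INR 4)%R) by (apply le_INR; lia). simpl (INR 4) in HM4. lra.
        (* Here the kernel provides the decay and the coefficient contributes only [tau r / 4]. *)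
        + change (kap a p q r' (S m')) with (K_plus a p q (S m') r').
          destruct (IH (S m') ltac:(lia) r' ltac:(lia)) as [HK _].
          rewrite Cmod_mult.
          assert (HK1 : (Cmod (K_plus a p q (S m') r') <= esqrt kappa (INR M + 4 * IZR n))%R).
          { eapply Rle_trans; [exact HK |].
            apply Rle_trans with (1 * esqrt kappa (INR (S m') + 4 * IZR r'))%R.
            - apply Rmult_le_compat_r; [left; apply esqrt_pos |].
              rewrite <- Rinv_1. apply Rinv_le_contravar; lra.
            - rewrite Rmult_1_l. apply esqrt_decr; [exact Hk |].
              assert (HM4 : (INR M <= INR (S m') + INR 4)%R)
                by (rewrite <- plus_INR; apply le_INR; lia).
              simpl (INR 4) in HM4.
              lra. }
          apply Rmult_le_compat; auto using Cmod_ge_0.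
          eapply Rle_trans; [exact Hx |]. rewrite <- (Rmult_1_r (tau r / 4)) at 2.
          apply Rmult_le_compat_l; [lra | now apply esqrt_le_1]. }
    destruct (Hsm r ltac:(lia)) as (_ & H1 & H2 & H3 & _).
    unfold kap_src, splus, sscal.
    pose proof (Hterm _ (r + 1)%Z 4%nat H1 ltac:(lia) ltac:(lia)) as B1.
    pose proof (Hterm _ r 2%nat H2 ltac:(lia) ltac:(lia)) as B2.
    pose proof (Hterm _ r 1%nat H3 ltac:(lia) ltac:(lia)) as B3.
    pose proof (Hterm _ r 3%nat H3 ltac:(lia) ltac:(lia)) as B4.
    eapply Rle_trans; [apply Cmod_triangle |].
    eapply Rle_trans; [apply Rplus_le_compat_l, Cmod_triangle |].
    eapply Rle_trans; [apply Rplus_le_compat_l, Rplus_le_compat_l, Cmod_triangle |].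
    lra. }
  destruct (CSeries_telescope (fun j => kap_src a p q (n + 1 + Z.of_nat j) M)
    (fun j => esqrt kappa (INR M + 4 * IZR n)
              * / ((IZR n + 1 + INR j) * (IZR n + 2 + INR j)))%R) as [Hconv Hsum].
  - intro j. rewrite <- Rmult_minus_distr_l, <- tau_telescope by lia.
    rewrite Rmult_comm. apply Hsrc. lia.
  - intro j. pose proof (pos_INR j). apply Rmult_le_pos; [left; apply esqrt_pos |].
    left. apply Rinv_0_lt_compat. nra.
  - split; [| split; [exact Hsrc | exact Hconv]].
    destruct M as [| M].
    + change (K_plus a p q 0 n) with (RtoC 0). rewrite Cmod_0.
      apply Rmult_le_pos; [left; apply Rinv_0_lt_compat; lra | left; apply esqrt_pos].
    + rewrite K_plus_S, iter_shift_spec.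
      eapply Rle_trans; [apply Cmod_triangle |].
      set (E := esqrt kappa (INR (S M) + 4 * IZR n)) in *.
      assert (HE : (0 < E)%R) by apply esqrt_pos.
      assert (H1 : (Cmod (if (S M <? 4)%nat then 0 else K_plus a p q (S M - 4) (n + 1))
                    <= / (IZR n + 2) * E)%R).
      { destruct (Nat.ltb_spec (S M) 4) as [H4 | H4].
        - rewrite Cmod_0. apply Rmult_le_pos; [left; apply Rinv_0_lt_compat; lra | lra].
        - destruct (IH (S M - 4)%nat ltac:(lia) (n + 1)%Z ltac:(lia)) as [HK _].
          rewrite plus_IZR, minus_INR in HK by lia.
          replace (IZR n + 1 + 1)%R with (IZR n + 2)%R in HK by ring.
          replace (INR (S M) - INR 4 + 4 * (IZR n + 1))%R
            with (INR (S M) + 4 * IZR n)%R in HK by (simpl (INR 4); ring).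
          exact HK. }
      apply Rle_trans with (/ (IZR n + 2) * E + E * / ((IZR n + 1 + 0) * (IZR n + 2 + 0)))%R.
      * apply Rplus_le_compat; [exact H1 | exact Hsum].
      (* The induction closes exactly: [1 / (n + 2) + 1 / ((n + 1) (n + 2)) = 1 / (n + 1)]. *)
      * apply Req_le. field. lra.
Qed.

Lemma abs_conv_Z (u : Z -> C) (n1 : Z) :
  (forall n, (n1 < n)%Z -> abs_conv (fun j => u (n + Z.of_nat j)%Z)) ->
  forall n, abs_conv (fun j => u (n + Z.of_nat j)%Z).
Proof.
  intros H.
  assert (Hk : forall (k : nat) n, (n1 < n + Z.of_nat k)%Z -> abs_conv (fun j => u (n + Z.of_nat j)%Z)).
  { induction k as [| k IH]; intros n Hn; [apply H; lia |].
    apply abs_conv_incr_1.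
    replace (fun k0 => u (n + Z.of_nat (S k0))%Z) with (fun j => u (n + 1 + Z.of_nat j)%Z).
    - apply IH. lia.
    - apply functional_extensionality. intro j. f_equal. lia. }
  intro n. apply (Hk (Z.to_nat (n1 - n + 1))). lia.
Qed.

Lemma sum_ge_split (u : Z -> C) (n : Z) :
  abs_conv (fun j => u (n + Z.of_nat j)%Z) -> sum_ge n u = u n + sum_ge (n + 1) u.
Proof.
  intros H. unfold sum_ge. rewrite CSeries_incr_1 by exact H. f_equal.
  - f_equal. simpl. lia.
  - apply CSeries_ext. intro j. f_equal. lia.
Qed.

(** Subtracting the summation formulas at [n - 1] and [n] cancels the common tail. The result
    carries the estimates from large [n] down to every [n]. *)
Lemma kap_rec (kappa : R) (n0 : Z) (a p q : Z -> C) (n : Z) :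
  (0 < kappa)%R -> small_from kappa n0 a p q ->
  kap a p q (n - 1) =
  splus (kap a p q n)
    (splus (Nat.iter 4 sshift (kap a p q n))
      (splus (sscal (- (1)) (Nat.iter 4 sshift (kap a p q (n + 1)))) (kap_src a p q n))).
Proof.
  intros Hk Hsm. apply functional_extensionality. intros [| m].
  - unfold splus, sscal, kap_src, splus, sscal. simpl. ring.
  - change (kap a p q (n - 1) (S m)) with (K_plus a p q (S m) (n - 1)).
    unfold splus, sscal. change (kap a p q n (S m)) with (K_plus a p q (S m) n).
    rewrite !K_plus_S. replace (n - 1 + 1)%Z with n by lia.
    rewrite (sum_ge_split (fun r => kap_src a p q r (S m)) n).
    + rewrite !iter_shift_spec. destruct (Nat.ltb_spec (S m) 4) as [H | H]; [ring |].
      (* At index [4] the entries of [kap] are [1] where those of [K_plus] are [0]; they occur with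
         opposite signs at [n] and [n + 1] and cancel. *)
      destruct (S m - 4)%nat as [| k]; unfold kap; [simpl K_plus |]; ring.
    + apply (abs_conv_Z (fun r => kap_src a p q r (S m)) n0). intros k Hk'.
      replace k with (k - 1 + 1)%Z by lia.
      apply (K_plus_bound kappa n0 a p q Hk Hsm (S m) (k - 1)). lia.
Qed.

Lemma kap_edecay_uniform (kappa : R) (n0 : Z) (a p q : Z -> C) (n : Z) (m : nat) :
  (0 < kappa)%R -> small_from kappa n0 a p q -> (n0 <= n)%Z ->
  (Cmod (kap a p q n m) <= esqrt kappa (INR m))%R.
Proof.
  intros Hk Hsm Hn. destruct m as [| m].
  - simpl. rewrite Cmod_1, esqrt_0. lra.
  - destruct (K_plus_bound kappa n0 a p q Hk Hsm (S m) n Hn) as [H _].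
    assert (Hn' : (0 <= IZR n)%R) by (apply (IZR_le 0); destruct Hsm; lia).
    eapply Rle_trans; [exact H |]. rewrite <- (Rmult_1_l (esqrt kappa (INR (S m)))).
    apply Rmult_le_compat.
    + left. apply Rinv_0_lt_compat. lra.
    + left. apply esqrt_pos.
    + rewrite <- Rinv_1. apply Rinv_le_contravar; lra.
    + apply esqrt_decr; [exact Hk | lra].
Qed.

Lemma Z_downward_ind (P : Z -> Prop) (n0 : Z) :
  (forall n, (n0 <= n)%Z -> P n) -> (forall n, P n -> P (n + 1)%Z -> P (n - 1)%Z) ->
  forall n, P n.
Proof.
  intros H0 Hstep.
  assert (H : forall k : nat, forall n, (n0 <= n + Z.of_nat k)%Z -> P n).
  { induction k as [| k IH]; intros n Hn; [apply H0; lia |].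
    replace n with (n + 1 - 1)%Z by lia. apply Hstep; apply IH; lia. }
  intro n. apply (H (Z.to_nat (n0 - n))). lia.
Qed.

Lemma kap_edecay (kappa : R) (n0 : Z) (a p q : Z -> C) (n : Z) :
  (0 < kappa)%R -> small_from kappa n0 a p q -> edecay kappa (kap a p q n).
Proof.
  intros Hk Hsm. revert n. apply (Z_downward_ind _ n0).
  - intros n Hn. exists 1%R. split; [lra |]. intro m. rewrite Rmult_1_l.
    exact (kap_edecay_uniform kappa n0 a p q n m Hk Hsm Hn).
  - intros n Hn Hn1. rewrite (kap_rec kappa n0) by assumption. unfold kap_src.
    repeat apply edecay_plus; try apply edecay_scal; try apply edecay_iter_shift; assumption.
Qed.

Lemma ev_iter_shift (j : nat) (c : nat -> C) (w : C) :
  rapid c -> (Cmod w <= 1)%R -> ev (Nat.iter j sshift c) w = w ^ j * ev c w.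
Proof.
  intros Hc Hw. assert (Hr : forall j, rapid (Nat.iter j sshift c)).
  { induction j0; [exact Hc | now apply rapid_shift]. }
  induction j as [| j IH]; [simpl; ring |]. simpl. rewrite ev_shift, IH by auto. ring.
Qed.

(** The generating function of [kap_rec]: the equation [L y = 0] at [lambda = w + / w], stripped of
    the factors [alpha_n] and [e^{inz}]. *)
Lemma ev_kap_rec (kappa : R) (n0 : Z) (a p q : Z -> C) (n : Z) (w : C) :
  (0 < kappa)%R -> small_from kappa n0 a p q -> (Cmod w <= 1)%R ->
  ev (kap a p q (n - 1)) w =
  ev (kap a p q n) w * (1 + w ^ 4 + h a q n * w ^ 2 + 2 * p n * (w + w ^ 3))
  - a n * a n * w ^ 4 * ev (kap a p q (n + 1)) w.
Proof.
  intros Hk Hsm Hw. pose proof (fun n => edecay_rapid kappa _ Hk (kap_edecay kappa n0 a p q n Hk Hsm)) as Hr.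
  assert (Hs : forall j n, rapid (Nat.iter j sshift (kap a p q n))).
  { induction j; intro k; [apply Hr | apply rapid_shift, IHj]. }
  rewrite (kap_rec kappa n0) by assumption. unfold kap_src.
  repeat (rewrite ev_plus || rewrite ev_scal || rewrite ev_iter_shift);
    auto 10 using rapid_plus, rapid_scal.
  ring.
Qed.

(** * Smallness of the coefficients and the infinite products *)

(** Half of the decay [exp (- eps sqrt r)] pays for the polynomial factor [tau r]. The other half is
    [esqrt (eps / 4) (4 r)], since [sqrt (4 r) = 2 sqrt r]. *)
Lemma small_from_exists (eps H : R) (a p q : Z -> C) :
  (0 < eps)%R -> (0 <= H)%R ->
  (forall r, (0 <= r)%Z ->
     Cmod (1 - a r) + Cmod (p r) + Cmod (q r) <= H * esqrt eps (IZR r))%R ->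
  exists n0, small_from (eps / 4) n0 a p q.
Proof.
  intros He HH Hd.
  (* One constant for all five coefficients: [1 - a^2] and [h] are covered by [2 + H], and moving
     from index [r - 1] to [r] costs [exp eps]. *)
  set (H1 := (H * (2 + H) * exp eps)%R).
  assert (HH1 : (0 <= H1)%R).
  { unfold H1. pose proof (exp_pos eps). apply Rmult_le_pos; nra. }
  (* The eighth Taylor term of [exp (eps / 2 * sqrt r)] is [D r^4], which exceeds the cubic
     [12 H1 r^3] once [r >= X]. *)
  set (D := ((eps / 2) ^ 8 / INR (fact 8))%R).
  assert (HD : (0 < D)%R) by (apply Rdiv_lt_0_compat; [apply pow_lt; lra | apply INR_fact_lt_0]).
  set (X := (12 * H1 / D)%R).
  exists (Z.max 1 (up X)). split; [lia |]. intros r Hr.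
  assert (HrX : (X <= IZR r)%R).
  { destruct (archimed X) as [Hup _]. assert (IZR (up X) <= IZR r)%R by (apply IZR_le; lia). lra. }
  assert (Hr1 : (1 <= IZR r)%R) by (apply (IZR_le 1); lia).
  assert (Hr3 : (H1 * (2 * (IZR r * (IZR r + 1) * (IZR r + 2))) <= exp (eps / 2 * sqrt (IZR r)))%R).
  { apply Rle_trans with (D * IZR r ^ 4)%R.
    - apply Rle_trans with (12 * H1 * IZR r ^ 3)%R.
      + replace (12 * H1 * IZR r ^ 3)%R with (H1 * (12 * IZR r ^ 3))%R by ring.
        apply Rmult_le_compat_l; [exact HH1 |]. nra.
      + assert (HX : (12 * H1 <= D * IZR r)%R).
        { unfold X in HrX. apply Rle_div_l in HrX; lra. }
        replace (D * IZR r ^ 4)%R with (D * IZR r * IZR r ^ 3)%R by ring.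
        apply Rmult_le_compat_r; [apply pow_le; lra | exact HX].
    - assert (Hs : (0 <= eps / 2 * sqrt (IZR r))%R)
        by (apply Rmult_le_pos; [lra | apply sqrt_pos]).
      pose proof (pow_le_exp _ 8 Hs) as H8.
      replace ((eps / 2 * sqrt (IZR r)) ^ 8)%R with ((eps / 2) ^ 8 * IZR r ^ 4)%R in H8.
      + unfold D. unfold Rdiv at 1. rewrite Rmult_assoc, (Rmult_comm (/ _)), <- Rmult_assoc.
        apply Rle_div_l; [apply INR_fact_lt_0 | lra].
      + rewrite Rpow_mult_distr. f_equal. change 8%nat with (2 * 4)%nat.
        rewrite pow_mult, pow2_sqrt; lra. }
  set (T := (H * (2 + H) * esqrt eps (IZR (r - 1)))%R).
  assert (HT : (T <= tau r / 4 * esqrt (eps / 4) (4 * IZR r))%R).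
  { assert (Hss : (sqrt (4 * IZR r) = 2 * sqrt (IZR r))%R).
    { rewrite sqrt_mult by lra. f_equal. replace 4%R with (2 * 2)%R by ring.
      apply sqrt_square. lra. }
    pose proof (esqrt_succ eps (IZR (r - 1)) He) as Hsucc.
    rewrite minus_IZR in Hsucc. specialize (Hsucc ltac:(lra)).
    replace (IZR r - 1 + 1)%R with (IZR r) in Hsucc by ring.
    apply Rle_trans with (H1 * esqrt eps (IZR r))%R.
    { unfold T, H1. rewrite minus_IZR, (Rmult_assoc (H * (2 + H)) (exp eps)).
      apply Rmult_le_compat_l; [nra | exact Hsucc]. }
    replace (esqrt (eps / 4) (4 * IZR r)) with (exp (- (eps / 2 * sqrt (IZR r)))).
    2: { unfold esqrt. rewrite Hss. f_equal. field. }
    replace (esqrt eps (IZR r)) with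
      (exp (- (eps / 2 * sqrt (IZR r))) * exp (- (eps / 2 * sqrt (IZR r))))%R.
    2: { unfold esqrt. rewrite <- exp_plus. f_equal. field. }
    rewrite <- Rmult_assoc. apply Rmult_le_compat_r; [left; apply exp_pos |].
    clearbody H1. rewrite exp_Ropp. apply Rle_div_l; [apply exp_pos |]. unfold tau.
    assert (Hpos : (0 < IZR r * (IZR r + 1) * (IZR r + 2))%R) by (repeat apply Rmult_lt_0_compat; lra).
    replace (2 / (IZR r * (IZR r + 1) * (IZR r + 2)) / 4 * exp (eps / 2 * sqrt (IZR r)))%R
      with (exp (eps / 2 * sqrt (IZR r)) / (2 * (IZR r * (IZR r + 1) * (IZR r + 2))))%R by (field; lra).
    apply Rle_div_r; [apply Rmult_lt_0_compat; [lra | exact Hpos] | exact Hr3]. }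
  assert (Ht0 : (Cmod (1 - a r) + Cmod (p r) + Cmod (q r) <= H * esqrt eps (IZR (r - 1)))%R).
  { eapply Rle_trans; [apply Hd; lia |]. apply Rmult_le_compat_l; [exact HH |].
    apply esqrt_decr; [exact He |]. apply IZR_le. lia. }
  pose proof (Hd (r - 1)%Z ltac:(lia)) as Ht1.
  pose proof (Cmod_ge_0 (1 - a r)). pose proof (Cmod_ge_0 (p r)). pose proof (Cmod_ge_0 (q r)).
  pose proof (Cmod_ge_0 (1 - a (r - 1)%Z)). pose proof (Cmod_ge_0 (p (r - 1)%Z)).
  pose proof (Cmod_ge_0 (q (r - 1)%Z)).
  set (e := esqrt eps (IZR (r - 1))) in *.
  assert (Hep : (0 < e <= 1)%R) by (split; [apply esqrt_pos | now apply esqrt_le_1]).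
  assert (HHe : (0 <= H * e)%R) by (apply Rmult_le_pos; lra).
  assert (HTe : (T = 2 * (H * e) + H * (H * e))%R) by (unfold T; ring).
  assert (HHH : (0 <= H * (H * e))%R) by now apply Rmult_le_pos.
  unfold small_coef. repeat split; (eapply Rle_trans; [| exact HT]); rewrite HTe.
  - lra.
  - replace (1 - a r * a r) with ((1 - a r) * (2 + - (1 - a r))) by ring. rewrite Cmod_mult.
    assert (Hc : (Cmod (2 + - (1 - a r)) <= 2 + H)%R).
    { eapply Rle_trans; [apply Cmod_triangle |]. rewrite Cmod_opp, Cmod_R, Rabs_pos_eq by lra. nra. }
    assert (Cmod (1 - a r) <= H * e)%R by lra.
    apply Rle_trans with ((H * e) * (2 + H))%R; [| lra].
    apply Rmult_le_compat; auto using Cmod_ge_0.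
  - unfold h. replace (2 - a r - a (r - 1)%Z + q r) with ((1 - a r) + (1 - a (r - 1)%Z) + q r) by ring.
    eapply Rle_trans; [apply Cmod_triangle |].
    eapply Rle_trans; [apply Rplus_le_compat_r, Cmod_triangle |]. lra.
  - rewrite Cmod_mult, Cmod_R, Rabs_pos_eq by lra. lra.
  - lra.
Qed.

(** * Infinite products and the normalising factors *)

Definition has_clim (P : nat -> C) (l : C) : Prop :=
  is_lim_seq (fun k => Re (P k)) (Re l) /\ is_lim_seq (fun k => Im (P k)) (Im l).

Lemma has_clim_CLim_seq (P : nat -> C) (l : C) : has_clim P l -> CLim_seq P = l.
Proof.
  intros [H1 H2]. unfold CLim_seq.
  rewrite (is_lim_seq_unique _ _ H1), (is_lim_seq_unique _ _ H2). now destruct l.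
Qed.

Lemma has_clim_scal (c : C) (P : nat -> C) (l : C) :
  has_clim P l -> has_clim (fun k => c * P k) (c * l).
Proof.
  intros [H1 H2]. split.
  - rewrite re_mult. apply is_lim_seq_ext with (fun k => Re c * Re (P k) - Im c * Im (P k))%R.
    + intro. now rewrite re_mult.
    + apply is_lim_seq_minus'; now apply (is_lim_seq_scal_l _ _ (Rbar.Finite _)).
  - rewrite im_mult. apply is_lim_seq_ext with (fun k => Re c * Im (P k) + Im c * Re (P k))%R.
    + intro. now rewrite im_mult.
    + apply is_lim_seq_plus'; now apply (is_lim_seq_scal_l _ _ (Rbar.Finite _)).
Qed.

Lemma Cprod_shift (u : nat -> C) (k : nat) :
  Cprod u (S k) = u 0%nat * Cprod (fun j => u (S j)) k.
Proof.
  induction k as [| k IH]; [simpl; ring |].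
  change (Cprod u (S (S k))) with (Cprod u (S k) * u (S k)). rewrite IH. simpl. ring.
Qed.

(** A factor at distance [x] from [1] sends a bound [E - 1] to [E (1 + x) - 1], and [1 + x] is at
    most the exponential of the increment of [s]. *)
Lemma Cprod_near_1 (u : nat -> C) (s : nat -> R) :
  (forall j, Cmod (1 - u j) <= s j - s (S j))%R ->
  forall k, (Cmod (Cprod u k - 1) <= exp (s 0%nat - s k) - 1)%R.
Proof.
  intros Hu. induction k as [| k IH].
  - simpl. replace (1 - 1) with (RtoC 0) by ring. rewrite Cmod_0, Rminus_diag, exp_0. lra.
  - simpl Cprod.
    replace (Cprod u k * u k - 1) with ((Cprod u k - 1) * (1 + - (1 - u k)) + - (1 - u k)) by ring.
    eapply Rle_trans; [apply Cmod_triangle |]. rewrite Cmod_mult, Cmod_opp.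
    set (x := Cmod (1 - u k)). specialize (Hu k). fold x in Hu.
    assert (Hx0 : (0 <= x)%R) by apply Cmod_ge_0.
    assert (Hx : (Cmod (1 + - (1 - u k)) <= 1 + x)%R).
    { eapply Rle_trans; [apply Cmod_triangle |]. rewrite Cmod_opp, Cmod_1. fold x. lra. }
    assert (H1 : (Cmod (Cprod u k - 1) * Cmod (1 + - (1 - u k)) <= (exp (s 0%nat - s k) - 1) * (1 + x))%R)
      by (apply Rmult_le_compat; auto using Cmod_ge_0).
    replace (s 0%nat - s (S k))%R with ((s 0%nat - s k) + (s k - s (S k)))%R by ring.
    rewrite exp_plus. pose proof (exp_ineq1_le (s k - s (S k))).
    pose proof (exp_pos (s 0%nat - s k)). nra.
Qed.

Lemma Cprod_converges (u : nat -> C) (s : nat -> R) :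
  (forall j, Cmod (1 - u j) <= s j - s (S j))%R -> (forall j, 0 <= s j)%R ->
  exists l, has_clim (Cprod u) l.
Proof.
  intros Hu Hs. pose proof (Cprod_near_1 u s Hu) as Hn.
  assert (Hb : forall k, (Cmod (Cprod u k) <= exp (s 0%nat))%R).
  { intro k. replace (Cprod u k) with ((Cprod u k - 1) + 1) by ring.
    eapply Rle_trans; [apply Cmod_triangle |]. rewrite Cmod_1. specialize (Hn k).
    assert (exp (s 0%nat - s k) <= exp (s 0%nat))%R by (apply exp_le; specialize (Hs k); lra). lra. }
  set (d := fun k => Cprod u (S k) - Cprod u k).
  destruct (CSeries_telescope d (fun k => exp (s 0%nat) * s k)%R) as [Hd _].
  - intro j. unfold d. simpl Cprod.
    replace (Cprod u j * u j - Cprod u j) with (Cprod u j * (- (1 - u j))) by ring.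
    rewrite Cmod_mult, Cmod_opp, <- Rmult_minus_distr_l.
    apply Rmult_le_compat; auto using Cmod_ge_0.
  - intro j. pose proof (exp_pos (s 0%nat)). specialize (Hs j). nra.
  - assert (Hsum : forall k, Cprod u k = 1 + csum d k).
    { induction k as [| k IH]; [simpl; ring |]. simpl csum. unfold d at 2.
      rewrite Cplus_assoc, <- IH. ring. }
    exists (1 + CSeries d). split; apply is_lim_seq_incr_1.
    + apply is_lim_seq_ext with (fun k => 1 + sum_n (fun j => Re (d j)) k)%R.
      * intro k. rewrite Hsum, re_plus, Re_csum, sum_n_Reals. reflexivity.
      * rewrite re_plus, re_CSeries. apply is_lim_seq_plus'; [apply is_lim_seq_const |].
        apply (Series_correct _ (abs_conv_Re d Hd)).
    + apply is_lim_seq_ext with (fun k => 0 + sum_n (fun j => Im (d j)) k)%R.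
      * intro k. rewrite Hsum.
        replace (Im (1 + csum d (S k))) with (0 + Im (csum d (S k)))%R by reflexivity.
        rewrite Im_csum, sum_n_Reals. reflexivity.
      * replace (Im (1 + CSeries d)) with (0 + Series (fun j => Im (d j)))%R by reflexivity.
        apply is_lim_seq_plus'; [apply is_lim_seq_const |].
        apply (Series_correct _ (abs_conv_Im d Hd)).
Qed.

(** The majorant starts at most at [1 / 8], and [exp (1 / 8) <= 8 / 7], so all partial products lie
    within [1 / 7] of [1]. A bound on real parts passes to the limit and excludes zero. *)
Lemma prod_ge_large (kappa : R) (n0 : Z) (a p q : Z -> C) (n : Z) :
  (0 < kappa)%R -> small_from kappa n0 a p q -> (n0 < n)%Z ->
  (exists l, has_clim (Cprod (fun j => a (n + Z.of_nat j)%Z)) l) /\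
  (/ 2 <= Re (prod_ge n a))%R.
Proof.
  intros Hk [Hn0 Hsm] Hn.
  set (u := fun j : nat => a (n + Z.of_nat j)%Z).
  set (m := (n - 1)%Z). assert (Hm0 : (0 <= IZR m)%R) by (apply (IZR_le 0); unfold m; lia).
  set (s := fun j : nat => (/ 4 * / ((IZR m + 1 + INR j) * (IZR m + 2 + INR j)))%R).
  assert (Hu : forall j, (Cmod (1 - u j) <= s j - s (S j))%R).
  { intro j. unfold s. rewrite <- Rmult_minus_distr_l, <- tau_telescope by (unfold m; lia).
    unfold u. replace (n + Z.of_nat j)%Z with (m + 1 + Z.of_nat j)%Z by (unfold m; lia).
    destruct (Hsm (m + 1 + Z.of_nat j)%Z ltac:(unfold m; lia)) as [H _].
    eapply Rle_trans; [exact H |].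
    pose proof (tau_pos (m + 1 + Z.of_nat j) ltac:(unfold m; lia)).
    pose proof (esqrt_le_1 kappa (4 * IZR (m + 1 + Z.of_nat j)) Hk). nra. }
  assert (Hs : forall j, (0 <= s j)%R).
  { intro j. unfold s. pose proof (pos_INR j). apply Rmult_le_pos; [lra |].
    left. apply Rinv_0_lt_compat. nra. }
  destruct (Cprod_converges u s Hu Hs) as [l Hl]. split; [now exists l |].
  unfold prod_ge. fold u. rewrite (has_clim_CLim_seq _ _ Hl).
  apply (is_lim_seq_le (fun _ => / 2)%R (fun k => Re (Cprod u k)) (/ 2)%R (Re l));
    [| apply is_lim_seq_const | apply Hl].
  intro k. pose proof (Cprod_near_1 u s Hu k) as H1.
  assert (Hs0 : (s 0%nat <= / 8)%R).
  { unfold s. simpl INR. rewrite !Rplus_0_r.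
    assert (/ ((IZR m + 1) * (IZR m + 2)) <= / 2)%R by (apply Rinv_le_contravar; nra). lra. }
  assert (He : (exp (s 0%nat - s k) <= 8 / 7)%R).
  { apply Rle_trans with (exp (/ 8)); [apply exp_le; specialize (Hs k); lra |].
    pose proof (exp_ineq1_le (- / 8)) as H. rewrite exp_Ropp in H.
    pose proof (exp_pos (/ 8)). rewrite <- (Rinv_inv (exp (/ 8))).
    replace (8 / 7)%R with (/ (7 / 8))%R by field. apply Rinv_le_contravar; lra. }
  pose proof (re_le_Cmod (Cprod u k - 1)) as H2.
  replace (Re (Cprod u k - 1)) with (Re (Cprod u k) - 1)%R in H2
    by (unfold Cminus; rewrite re_plus; simpl; ring).
  assert (H3 : (Rabs (Re (Cprod u k) - 1) <= / 7)%R) by lra.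
  apply Rabs_le_between in H3. lra.
Qed.

(** Convergence and non-vanishing descend from large [n], one factor [a n <> 0] at a time. *)
Lemma prod_ge_spec (kappa : R) (n0 : Z) (a p q : Z -> C) (n : Z) :
  (0 < kappa)%R -> small_from kappa n0 a p q -> (forall n, a n <> 0) ->
  prod_ge n a = a n * prod_ge (n + 1) a /\ prod_ge n a <> 0.
Proof.
  intros Hk Hsm Ha.
  assert (Hshift : forall n l, has_clim (Cprod (fun j => a (n + 1 + Z.of_nat j)%Z)) l ->
     has_clim (Cprod (fun j => a (n + Z.of_nat j)%Z)) (a n * l)).
  { intros k l Hl. apply (has_clim_scal (a k)) in Hl.
    assert (E : forall i, Cprod (fun j => a (k + Z.of_nat j)%Z) (S i)
       = a k * Cprod (fun j => a (k + 1 + Z.of_nat j)%Z) i).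
    { intro i. rewrite Cprod_shift. f_equal; [f_equal; simpl; lia |].
      f_equal. apply functional_extensionality. intro j. f_equal. lia. }
    destruct Hl as [H1 H2]. split; apply is_lim_seq_incr_1.
    - apply is_lim_seq_ext with (2 := H1). intro i. now rewrite E.
    - apply is_lim_seq_ext with (2 := H2). intro i. now rewrite E. }
  assert (Hall : forall n, exists l, has_clim (Cprod (fun j => a (n + Z.of_nat j)%Z)) l).
  { apply (Z_downward_ind _ (n0 + 1)).
    - intros k Hk'. apply (prod_ge_large kappa n0 a p q k Hk Hsm). lia.
    - intros k [l Hl] _. exists (a (k - 1)%Z * l). apply Hshift.
      now replace (k - 1 + 1)%Z with k by lia. }
  assert (Hrec : forall n, prod_ge n a = a n * prod_ge (n + 1) a).
  { intro k. destruct (Hall (k + 1)%Z) as [l Hl]. unfold prod_ge.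
    rewrite (has_clim_CLim_seq _ _ Hl). apply has_clim_CLim_seq. now apply Hshift. }
  split; [apply Hrec |]. revert n. apply (Z_downward_ind _ (n0 + 1)).
  - intros k Hk' E. destruct (prod_ge_large kappa n0 a p q k Hk Hsm ltac:(lia)) as [_ H].
    rewrite E in H. simpl in H. lra.
  - intros k H _. rewrite Hrec. replace (k - 1 + 1)%Z with k by lia. now apply Cmult_neq_0.
Qed.

Lemma powerRZ_m1_abs (n : Z) : Rabs (powerRZ (-1) n) = 1%R.
Proof.
  destruct n; simpl; [apply Rabs_R1 | apply pow_1_abs |].
  rewrite Rabs_inv, pow_1_abs. apply Rinv_1.
Qed.

Lemma alpha_plus_spec (kappa : R) (n0 : Z) (a p q : Z -> C) (n : Z) :
  (0 < kappa)%R -> small_from kappa n0 a p q -> (forall n, a n <> 0) ->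
  alpha_plus a (n + 1) = - a n * alpha_plus a n /\ alpha_plus a n <> 0.
Proof.
  intros Hk Hsm Ha. destruct (prod_ge_spec kappa n0 a p q n Hk Hsm Ha) as [E1 H1].
  destruct (prod_ge_spec kappa n0 a p q (n + 1) Hk Hsm Ha) as [_ H2].
  unfold alpha_plus. split.
  - rewrite E1, powerRZ_add by lra. simpl (powerRZ (-1) 1).
    replace (powerRZ (-1) n * (-1 * 1))%R with (- powerRZ (-1) n)%R by ring.
    rewrite RtoC_opp. field. split; [exact H2 | apply Ha].
  - intro E. apply (f_equal Cmod) in E.
    rewrite Cmod_mult, Cmod_R, powerRZ_m1_abs, Cmod_inv, Cmod_0, Rmult_1_l in E by exact H1.
    apply Cmod_gt_0 in H1. apply Rinv_0_lt_compat in H1. lra.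
Qed.

Lemma alpha_plus_bound (kappa : R) (n0 : Z) (a p q : Z -> C) (n : Z) :
  (0 < kappa)%R -> small_from kappa n0 a p q -> (forall n, a n <> 0) -> (n0 < n)%Z ->
  (Cmod (alpha_plus a n) <= 2)%R.
Proof.
  intros Hk Hsm Ha Hn. destruct (prod_ge_spec kappa n0 a p q n Hk Hsm Ha) as [_ H1].
  destruct (prod_ge_large kappa n0 a p q n Hk Hsm Hn) as [_ H2].
  unfold alpha_plus. rewrite Cmod_mult, Cmod_R, powerRZ_m1_abs, Rmult_1_l, Cmod_inv by exact H1.
  rewrite <- (Rinv_inv 2). apply Rinv_le_contravar; [lra |].
  eapply Rle_trans; [exact H2 |]. eapply Rle_trans; [apply Rle_abs | apply re_le_Cmod].
Qed.

(** * Jost solutions and square-summable solutions *)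

Lemma Cexp_neq_0 (z : C) : Cexp z <> 0.
Proof.
  intro E. apply (f_equal Cmod) in E. rewrite Cmod_Cexp, Cmod_0 in E.
  pose proof (exp_pos (Re z)). lra.
Qed.

Lemma Cexp_pow (z : C) (n : nat) : Cexp z ^ n = Cexp (RtoC (INR n) * z).
Proof.
  induction n as [| n IH].
  - simpl. rewrite Cmult_0_l. symmetry. apply Cexp_0.
  - rewrite Cpow_S, IH, <- Cexp_plus, S_INR, RtoC_plus. f_equal. ring.
Qed.

Lemma Cexp_opp (z : C) : Cexp (- z) = / Cexp z.
Proof.
  assert (E : Cexp (- z) * Cexp z = 1).
  { rewrite <- Cexp_plus. replace (- z + z) with (RtoC 0) by ring. apply Cexp_0. }
  replace (/ Cexp z) with (Cexp (- z) * Cexp z * / Cexp z) by (rewrite E; ring).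
  field. apply Cexp_neq_0.
Qed.

Lemma two_Ccos_half (z : C) :
  2 * Ccos (z / 2) = Cexp (Ci / 2 * z) + / Cexp (Ci / 2 * z).
Proof.
  unfold Ccos. rewrite Cexp_opp.
  replace (Ci * (z / 2)) with (Ci / 2 * z) by field. field. apply Cexp_neq_0.
Qed.

Lemma f_plus_eq (kappa : R) (n0 : Z) (a p q : Z -> C) (z : C) (n : Z) :
  (0 < kappa)%R -> small_from kappa n0 a p q -> (0 <= Im z)%R ->
  f_plus a p q z n =
  alpha_plus a n * Cexp (Ci * RtoC (IZR n) * z) * ev (kap a p q n) (Cexp (Ci / 2 * z)).
Proof.
  intros Hk Hsm Hz. unfold f_plus. f_equal.
  set (w := Cexp (Ci / 2 * z)). unfold ev. rewrite (CSeries_incr_1 (fun m => kap a p q n m * w ^ m)).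
  - apply (f_equal2 Cplus); [simpl; ring |]. apply CSeries_ext. intro j.
    unfold w. rewrite Cexp_pow. apply (f_equal2 Cmult); [reflexivity |]. f_equal. field.
  - apply rapid_abs_conv; [| now apply Cmod_Cexp_upper].
    apply (edecay_rapid kappa); [exact Hk | now apply (kap_edecay kappa n0)].
Qed.

Lemma L_eq (a p q : Z -> C) (lambda : C) (y : Z -> C) (n : Z) :
  L a p q lambda y n =
  a n * y (n + 1)%Z + a (n - 1)%Z * y (n - 1)%Z
  + (h a q n - 2 + 2 * lambda * p n + lambda * lambda) * y n.
Proof.
  unfold L, Delta, h.
  replace (n + 1 - 1)%Z with n by lia. replace (n - 1 + 1)%Z with n by lia. ring.
Qed.

Definition solution (a p q : Z -> C) (lambda : C) (y : Z -> C) : Prop :=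
  forall n, L a p q lambda y n = 0.

(** With [lambda = w + / w] one has [w^2 (lambda^2 - 2) = 1 + w^4] and [w^2 lambda = w + w^3];
    together with [alpha_(n+1) = - a_n alpha_n] this reduces the equation to [ev_kap_rec]. *)
Lemma f_plus_solution (kappa : R) (n0 : Z) (a p q : Z -> C) (z : C) :
  (0 < kappa)%R -> small_from kappa n0 a p q -> (forall n, a n <> 0) -> (0 <= Im z)%R ->
  solution a p q (2 * Ccos (z / 2)) (f_plus a p q z).
Proof.
  intros Hk Hsm Ha Hz n. rewrite L_eq, two_Ccos_half.
  rewrite !(f_plus_eq kappa n0) by assumption.
  pose proof (ev_kap_rec kappa n0 a p q n _ Hk Hsm (Cmod_Cexp_upper z Hz)) as HF.
  set (w := Cexp (Ci / 2 * z)) in *.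
  assert (Hw : w <> 0) by apply Cexp_neq_0.
  assert (HX : forall k, Cexp (Ci * RtoC (IZR (k + 1)) * z) = Cexp (Ci * RtoC (IZR k) * z) * w ^ 2).
  { intro k. unfold w. rewrite Cexp_pow, <- Cexp_plus. f_equal. rewrite plus_IZR, RtoC_plus.
    simpl (INR 2). rewrite RtoC_plus. field. }
  destruct (alpha_plus_spec kappa n0 a p q n Hk Hsm Ha) as [E1 _].
  destruct (alpha_plus_spec kappa n0 a p q (n - 1) Hk Hsm Ha) as [E2 H2].
  pose proof (HX (n - 1)%Z) as HX'. replace (n - 1 + 1)%Z with n in * by lia.
  rewrite HX, E1. rewrite HX', E2, HF.
  set (X := Cexp (Ci * RtoC (IZR (n - 1)) * z)).
  set (F := ev (kap a p q n) w). set (F' := ev (kap a p q (n + 1)) w).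
  field. exact Hw.
Qed.

(** The reflection [n -> - n] exchanges the two Jost solutions; [a n] belongs to
    the edge from [n] to [n + 1], hence the extra shift. *)
Definition refl (u : Z -> C) (n : Z) : C := u (- n)%Z.
Definition refl1 (u : Z -> C) (n : Z) : C := u (- n - 1)%Z.

Lemma sum_le_refl (n : Z) (u v : Z -> C) :
  (forall r, u (- r)%Z = v r) -> sum_le (n - 1) u = sum_ge (- n + 1) v.
Proof.
  intros H. apply CSeries_ext. intro j. rewrite <- H. f_equal. lia.
Qed.

Lemma h_refl (a q : Z -> C) (r : Z) : h a q (- r) = h (refl1 a) (refl q) r.
Proof.
  unfold h, refl, refl1. replace (- (r - 1) - 1)%Z with (- r)%Z by lia. ring.
Qed.

Lemma K_minus_refl (a p q : Z -> C) (m : nat) (n : Z) :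
  K_minus a p q m n = K_plus (refl1 a) (refl p) (refl q) m (- n).
Proof.
  revert n. induction m as [m IH] using lt_wf_ind. intro n.
  assert (IH' : forall k r, (k < m)%nat ->
    K_minus a p q k (- r) = K_plus (refl1 a) (refl p) (refl q) k r).
  { intros k r Hk. rewrite IH by exact Hk. f_equal. lia. }
  destruct m as [| [| [| [| [| m]]]]].
  - reflexivity.
  - change (K_minus a p q 1 n) with (2 * sum_le (n - 1) p).
    change (K_plus (refl1 a) (refl p) (refl q) 1 (- n)) with (2 * sum_ge (- n + 1) (refl p)).
    f_equal. now apply sum_le_refl.
  - change (K_minus a p q 2 n)
      with (sum_le (n - 1) (fun r => h a q r + 2 * p r * K_minus a p q 1 r)).
    change (K_plus (refl1 a) (refl p) (refl q) 2 (- n))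
      with (sum_ge (- n + 1) (fun r => h (refl1 a) (refl q) r
              + 2 * refl p r * K_plus (refl1 a) (refl p) (refl q) 1 r)).
    apply sum_le_refl. intro r. cbv beta. now rewrite h_refl, IH' by lia.
  - change (K_minus a p q 3 n)
      with (sum_le (n - 1) (fun r => h a q r * K_minus a p q 1 r
              + 2 * p r * (K_minus a p q 2 r + 1))).
    change (K_plus (refl1 a) (refl p) (refl q) 3 (- n))
      with (sum_ge (- n + 1) (fun r =>
              h (refl1 a) (refl q) r * K_plus (refl1 a) (refl p) (refl q) 1 r
              + 2 * refl p r * (K_plus (refl1 a) (refl p) (refl q) 2 r + 1))).
    apply sum_le_refl. intro r. cbv beta. now rewrite h_refl, !IH' by lia.
  - change (K_minus a p q 4 n)
      with (sum_le (n - 1) (fun r => (1 - a (r - 1)%Z * a (r - 1)%Z)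
              + h a q r * K_minus a p q 2 r
              + 2 * p r * (K_minus a p q 3 r + K_minus a p q 1 r))).
    change (K_plus (refl1 a) (refl p) (refl q) 4 (- n))
      with (sum_ge (- n + 1) (fun r => (1 - refl1 a r * refl1 a r)
              + h (refl1 a) (refl q) r * K_plus (refl1 a) (refl p) (refl q) 2 r
              + 2 * refl p r * (K_plus (refl1 a) (refl p) (refl q) 3 r
                                + K_plus (refl1 a) (refl p) (refl q) 1 r))).
    apply sum_le_refl. intro r. cbv beta. now rewrite h_refl, !IH' by lia.
  - change (K_minus a p q (S (S (S (S (S m))))) n)
      with (K_minus a p q (S m) (n - 1)%Z + sum_le (n - 1) (fun r =>
          (1 - a (r - 1)%Z * a (r - 1)%Z) * K_minus a p q (S m) (r - 1)%Z
          + h a q r * K_minus a p q (S (S (S m))) r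
          + 2 * p r * (K_minus a p q (S (S m)) r + K_minus a p q (S (S (S (S m)))) r))).
    change (K_plus (refl1 a) (refl p) (refl q) (S (S (S (S (S m))))) (- n))
      with (K_plus (refl1 a) (refl p) (refl q) (S m) (- n + 1)%Z + sum_ge (- n + 1) (fun r =>
          (1 - refl1 a r * refl1 a r) * K_plus (refl1 a) (refl p) (refl q) (S m) (r + 1)%Z
          + h (refl1 a) (refl q) r * K_plus (refl1 a) (refl p) (refl q) (S (S (S m))) r
          + 2 * refl p r * (K_plus (refl1 a) (refl p) (refl q) (S (S m)) r
                            + K_plus (refl1 a) (refl p) (refl q) (S (S (S (S m)))) r))).
    apply (f_equal2 Cplus).
    + rewrite IH by lia. now replace (- (n - 1))%Z with (- n + 1)%Z by lia.
    + apply sum_le_refl. intro r. cbv beta.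
      replace (- r - 1)%Z with (- (r + 1))%Z by lia. rewrite h_refl, !IH' by lia.
      unfold refl1. now replace (- (r + 1))%Z with (- r - 1)%Z by lia.
Qed.

Lemma f_minus_refl (a p q : Z -> C) (z : C) (n : Z) :
  f_minus a p q z n = f_plus (refl1 a) (refl p) (refl q) z (- n).
Proof.
  unfold f_minus, f_plus. f_equal; [f_equal |].
  - unfold alpha_minus, alpha_plus. f_equal.
    + f_equal.
      destruct n as [| n | n]; simpl; [reflexivity | |].
      * rewrite <- pow_inv. f_equal. field.
      * rewrite <- pow_inv. f_equal. field.
    + f_equal. unfold prod_le, prod_ge. f_equal. f_equal.
      apply functional_extensionality. intro j. unfold refl1. f_equal. lia.
  - f_equal. rewrite opp_IZR, RtoC_opp. ring.
  - f_equal. apply CSeries_ext. intro j. now rewrite K_minus_refl.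
Qed.

Lemma L_refl (a p q : Z -> C) (lambda : C) (y : Z -> C) (n : Z) :
  L (refl1 a) (refl p) (refl q) lambda (refl y) n = L a p q lambda y (- n).
Proof.
  rewrite !L_eq, h_refl. unfold refl, refl1.
  replace (- (n - 1) - 1)%Z with (- n)%Z by lia.
  replace (- (n + 1))%Z with (- n - 1)%Z by lia.
  replace (- (n - 1))%Z with (- n + 1)%Z by lia. ring.
Qed.

Lemma solution_refl (a p q : Z -> C) (lambda : C) (y : Z -> C) :
  solution (refl1 a) (refl p) (refl q) lambda (refl y) <-> solution a p q lambda y.
Proof.
  split; intros H n.
  - replace n with (- - n)%Z by lia. rewrite <- L_refl. apply H.
  - rewrite L_refl. apply H.
Qed.

(** * Wronskians and decaying solutions *)

Lemma wronskian_step (a p q : Z -> C) (lambda : C) (u v : Z -> C) (n : Z) :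
  solution a p q lambda u -> solution a p q lambda v ->
  wronskian a u v n = wronskian a u v (n - 1).
Proof.
  intros Hu Hv. specialize (Hu n). specialize (Hv n). rewrite L_eq in Hu, Hv.
  unfold wronskian. replace (n - 1 + 1)%Z with n by lia.
  set (c := h a q n - 2 + 2 * lambda * p n + lambda * lambda) in *.
  assert (Eu : a n * u (n + 1)%Z = - (a (n - 1)%Z * u (n - 1)%Z + c * u n)).
  { replace (a n * u (n + 1)%Z)
      with ((a n * u (n + 1)%Z + a (n - 1)%Z * u (n - 1)%Z + c * u n)
            - (a (n - 1)%Z * u (n - 1)%Z + c * u n)) by ring. rewrite Hu. ring. }
  assert (Ev : a n * v (n + 1)%Z = - (a (n - 1)%Z * v (n - 1)%Z + c * v n)).
  { replace (a n * v (n + 1)%Z)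
      with ((a n * v (n + 1)%Z + a (n - 1)%Z * v (n - 1)%Z + c * v n)
            - (a (n - 1)%Z * v (n - 1)%Z + c * v n)) by ring. rewrite Hv. ring. }
  replace (a n * (u n * v (n + 1)%Z - u (n + 1)%Z * v n))
    with (u n * (a n * v (n + 1)%Z) - (a n * u (n + 1)%Z) * v n) by ring.
  rewrite Eu, Ev. ring.
Qed.

Lemma wronskian_const (a p q : Z -> C) (lambda : C) (u v : Z -> C) (n m : Z) :
  solution a p q lambda u -> solution a p q lambda v ->
  wronskian a u v n = wronskian a u v m.
Proof.
  intros Hu Hv.
  assert (H : forall (k : nat) i, wronskian a u v (i + Z.of_nat k) = wronskian a u v i).
  { induction k as [| k IH]; intro i; [f_equal; lia |].
    rewrite (wronskian_step a p q lambda) by assumption. rewrite <- (IH i). f_equal. lia. }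
  destruct (Z.le_ge_cases n m).
  - rewrite <- (H (Z.to_nat (m - n)) n). f_equal. lia.
  - rewrite <- (H (Z.to_nat (n - m)) m). f_equal. lia.
Qed.

(** Decay at plus infinity only; decay at minus infinity is expressed through [refl]. *)
Definition vanishes (y : Z -> C) : Prop :=
  forall e, (0 < e)%R -> exists N, forall n, (N <= n)%Z -> (Cmod (y n) < e)%R.

Lemma l2Z_vanishes (y : Z -> C) : l2Z y -> vanishes y /\ vanishes (refl y).
Proof.
  assert (H : forall u : Z -> C,
    ex_series (fun k : nat => (Cmod (u (Z.of_nat k)) ^ 2)%R) -> vanishes u).
  { intros u Hu e He. apply ex_series_lim_0 in Hu.
    apply is_lim_seq_spec in Hu.
    destruct (Hu (mkposreal (e ^ 2) (pow_lt e 2 He))) as [N HN]. simpl in HN.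
    exists (Z.of_nat N). intros n Hn.
    specialize (HN (Z.to_nat n) ltac:(lia)). rewrite Z2Nat.id in HN by lia.
    rewrite Rminus_0_r, Rabs_pos_eq in HN by (pose proof (Cmod_ge_0 (u n)); nra).
    apply Rsqr_incrst_0; [unfold Rsqr; lra | apply Cmod_ge_0 | lra]. }
  intros [H1 H2]. split; apply H; assumption.
Qed.

(** The bound on [kap] is uniform for [n >= n0], so the bracket stays bounded while
    [|e^{inz}| = |w|^(2 n)] tends to zero. *)
Lemma f_plus_vanishes (kappa : R) (n0 : Z) (a p q : Z -> C) (z : C) :
  (0 < kappa)%R -> small_from kappa n0 a p q -> (forall n, a n <> 0) -> (0 < Im z)%R ->
  vanishes (f_plus a p q z).
Proof.
  intros Hk Hsm Ha Hz e He.
  pose proof (Cmod_Cexp_upper_lt z Hz) as Hw. set (w := Cexp (Ci / 2 * z)) in *.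
  set (A := (1 * (exp kappa / kappa ^ 2) ^ 2 * INR (fact (2 * 2)))%R).
  assert (HF : forall n, (n0 <= n)%Z -> (Cmod (ev (kap a p q n) w) <= A)%R).
  { intros n Hn. apply ev_decay; [| lra].
    apply (sqrt_exp_decay_decay 1 kappa); [lra | exact Hk |].
    intro m. rewrite Rmult_1_l. now apply (kap_edecay_uniform kappa n0 a p q n m). }
  assert (HA : (0 <= A)%R).
  { eapply Rle_trans; [apply Cmod_ge_0 | apply (HF n0); lia]. }
  destruct (pow_small_exists (Cmod w) (e / (2 * A + 1))) as [N HN].
  - split; [apply Cmod_ge_0 | exact Hw].
  - apply Rdiv_lt_0_compat; lra.
  - exists (Z.max (n0 + 1) (Z.of_nat N)). intros n Hn.
    assert (Hn0 : (0 <= n0)%Z) by apply Hsm.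
    rewrite (f_plus_eq kappa n0) by (assumption || lra). fold w.
    rewrite !Cmod_mult.
    assert (HX : (Cmod (Cexp (Ci * RtoC (IZR n) * z)) <= Cmod w ^ N)%R).
    { replace (Ci * RtoC (IZR n) * z) with (RtoC (INR (2 * Z.to_nat n)) * (Ci / 2 * z)).
      - rewrite <- Cexp_pow. fold w. rewrite Cmod_pow.
        replace (2 * Z.to_nat n)%nat with (N + (2 * Z.to_nat n - N))%nat by lia.
        rewrite pow_add. pose proof (pow_le (Cmod w) N (Cmod_ge_0 w)).
        pose proof (Cmod_ge_0 w).
        assert (Cmod w ^ (2 * Z.to_nat n - N) <= 1)%R
          by (rewrite <- (pow1 (2 * Z.to_nat n - N)); apply pow_incr; lra).
        nra.
      - rewrite mult_INR, (INR_IZR_INZ (Z.to_nat n)), Z2Nat.id by lia.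
        replace (INR 2) with 2%R by (simpl; ring). rewrite RtoC_mult. field. }
    pose proof (alpha_plus_bound kappa n0 a p q n Hk Hsm Ha ltac:(lia)) as Hal.
    specialize (HF n ltac:(lia)). apply Rlt_div_r in HN; [| lra].
    pose proof (pow_le (Cmod w) N (Cmod_ge_0 w)) as Hp.
    apply Rle_lt_trans with (2 * Cmod w ^ N * A)%R; [| nra].
    apply Rmult_le_compat; auto using Cmod_ge_0.
    + apply Rmult_le_pos; apply Cmod_ge_0.
    + apply Rmult_le_compat; auto using Cmod_ge_0.
Qed.

Lemma wronskian_vanishing (kappa : R) (n0 : Z) (a p q : Z -> C) (lambda : C) (u v : Z -> C) (n : Z) :
  (0 < kappa)%R -> small_from kappa n0 a p q ->
  solution a p q lambda u -> solution a p q lambda v -> vanishes u -> vanishes v ->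
  wronskian a u v n = 0.
Proof.
  intros Hk [Hn0 Hsm] Hu Hv Vu Vv. apply Cmod_eq_0.
  apply Rle_antisym; [| apply Cmod_ge_0]. apply le_epsilon. intros e He.
  (* Each of the two products is at most [1 * (e / 4)], and [|a m| <= 2] brings the total to [e]. *)
  assert (Hr : (0 < Rmin 1 (e / 4))%R) by (apply Rmin_glb_lt; lra).
  destruct (Vu _ Hr) as [N1 H1]. destruct (Vv _ Hr) as [N2 H2].
  set (m := Z.max (n0 + 1) (Z.max N1 N2)).
  rewrite (wronskian_const a p q lambda u v n m) by assumption. unfold wronskian.
  assert (Ham : (Cmod (a m) <= 2)%R).
  { destruct (Hsm m ltac:(unfold m; lia)) as [Hs _]. unfold small_coef in Hs.
    assert (Hm1 : (1 <= IZR m)%R) by (apply (IZR_le 1); unfold m; lia).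
    assert (Ht : (tau m <= 1)%R).
    { unfold tau. apply Rle_div_l; [repeat apply Rmult_lt_0_compat; lra |].
      assert (1 <= IZR m * (IZR m + 1))%R by nra. nra. }
    pose proof (tau_pos m ltac:(unfold m; lia)).
    pose proof (esqrt_le_1 kappa (4 * IZR m) Hk). pose proof (esqrt_pos kappa (4 * IZR m)).
    replace (a m) with (1 + - (1 - a m)) by ring.
    eapply Rle_trans; [apply Cmod_triangle |]. rewrite Cmod_opp, Cmod_1. nra. }
  pose proof (H1 m ltac:(unfold m; lia)) as U0. pose proof (H1 (m + 1)%Z ltac:(unfold m; lia)) as U1.
  pose proof (H2 m ltac:(unfold m; lia)) as V0. pose proof (H2 (m + 1)%Z ltac:(unfold m; lia)) as V1.
  pose proof (Rmin_l 1 (e / 4)) as R1. pose proof (Rmin_r 1 (e / 4)) as R2.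
  assert (Hb : (Cmod (u m * v (m + 1)%Z - u (m + 1)%Z * v m) <= e / 2)%R).
  { unfold Cminus. eapply Rle_trans; [apply Cmod_triangle |]. rewrite Cmod_opp, !Cmod_mult.
    pose proof (Cmod_ge_0 (u m)). pose proof (Cmod_ge_0 (u (m + 1)%Z)).
    pose proof (Cmod_ge_0 (v m)). pose proof (Cmod_ge_0 (v (m + 1)%Z)). nra. }
  rewrite Cmod_mult. pose proof (Cmod_ge_0 (a m)).
  pose proof (Cmod_ge_0 (u m * v (m + 1)%Z - u (m + 1)%Z * v m)). nra.
Qed.

(** On the continuous spectrum the equation reads [u_n - mu^-1 u_(n-1) = r_n] with
    [u_n = y_(n+1) - mu y_n], [|mu| = 1] and [r_n] small; summing both first-order
    recurrences from infinity halves any bound on a decaying [y]. *)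
Lemma unit_solution_trivial (kappa : R) (n0 : Z) (a p q : Z -> C) (w : C) (y : Z -> C) :
  (0 < kappa)%R -> small_from kappa n0 a p q -> (forall n, a n <> 0) ->
  Cmod w = 1%R -> solution a p q (w + / w) y -> vanishes y ->
  forall n, y n = 0.
Proof.
  intros Hk [Hn0 Hsm] Ha Hw Hy Hv.
  assert (Hw0 : w <> 0) by (intro E; rewrite E, Cmod_0 in Hw; lra).
  (* With vanishing [p], [q] and [a = 1] the equation has characteristic roots [mu] and [/ mu],
     because [lambda^2 - 2 = w^2 + w^-2]. *)
  set (mu := - w ^ 2).
  assert (Hmu : Cmod mu = 1%R) by (unfold mu; rewrite Cmod_opp, Cmod_pow, Hw; ring).
  assert (Hmu0 : mu <> 0) by (intro E; rewrite E, Cmod_0 in Hmu; lra).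
  set (r := fun n => (1 - a n) * y (n + 1)%Z + (1 - a (n - 1)%Z) * y (n - 1)%Z
                     - h a q n * y n - 2 * p n * ((w + / w) * y n)).
  assert (Hr : forall n, y (n + 1)%Z - (mu + / mu) * y n + y (n - 1)%Z = r n).
  { intro n. specialize (Hy n). rewrite L_eq in Hy.
    replace (y (n + 1)%Z - (mu + / mu) * y n + y (n - 1)%Z)
      with (r n + (a n * y (n + 1)%Z + a (n - 1)%Z * y (n - 1)%Z +
         (h a q n - 2 + 2 * (w + / w) * p n + (w + / w) * (w + / w)) * y n)).
    - rewrite Hy. ring.
    - unfold r, mu. field. exact Hw0. }
  set (u := fun n => y (n + 1)%Z - mu * y n).
  assert (Hu : forall n, u (n - 1)%Z = mu * (u n - r n)).
  { intro n. rewrite <- Hr. unfold u. replace (n - 1 + 1)%Z with n by lia. field. exact Hmu0. }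
  destruct (Hv 1%R Rlt_0_1) as [N1 HN1].
  (* For [n >= 3] one has [1 / (n + 1) <= 1 / 4], which turns the final bound [2 S / (n + 1)] into
     [S / 2]. *)
  set (N := Z.max (Z.max n0 3) N1).
  assert (HN3 : forall n, (N <= n)%Z -> (3 <= IZR n)%R) by (intros; apply (IZR_le 3); unfold N in *; lia).
  assert (Vu : forall e, (0 < e)%R -> exists M, forall n, (M <= n)%Z -> (Cmod (u n) < e)%R).
  { intros e He. destruct (Hv (e / 2)%R) as [M HM]; [lra |]. exists M. intros n Hn. unfold u.
    unfold Cminus. eapply Rle_lt_trans; [apply Cmod_triangle |].
    rewrite Cmod_opp, Cmod_mult, Hmu.
    pose proof (HM n Hn). pose proof (HM (n + 1)%Z ltac:(lia)). lra. }
  assert (Hhalf : forall S, (0 <= S)%R -> (forall n, (N <= n)%Z -> (Cmod (y n) <= S)%R) ->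
    forall n, (N <= n)%Z -> (Cmod (y n) <= S * / 2)%R).
  { intros S HS HyS.
    assert (Hrb : forall n, (N < n)%Z -> (Cmod (r n) <= 2 * S * tau n)%R).
    { intros n Hn. destruct (Hsm n ltac:(unfold N in *; lia)) as (C1 & _ & C3 & C4 & C5).
      pose proof (tau_pos n ltac:(unfold N in *; lia)) as Ht.
      assert (Hc : forall x s, small_coef kappa n x -> (Cmod s <= S)%R ->
        (Cmod (x * s) <= tau n / 4 * S)%R).
      { intros x s Hx Hs. rewrite Cmod_mult. apply Rmult_le_compat; auto using Cmod_ge_0.
        unfold small_coef in Hx. pose proof (esqrt_le_1 kappa (4 * IZR n) Hk). nra. }
      pose proof (HyS n ltac:(lia)) as Y0. pose proof (HyS (n + 1)%Z ltac:(lia)) as Y1.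
      pose proof (HyS (n - 1)%Z ltac:(lia)) as Y2.
      (* As [|w + / w| <= 2], the [p]-term counts as two quarters of [tau n * S]; with the other
         three terms this is five quarters, below [2 S tau n]. *)
      assert (Y3 : (Cmod (/ 2 * ((w + / w) * y n)) <= S)%R).
      { rewrite !Cmod_mult, Cmod_inv, Cmod_R, Rabs_pos_eq by (lra || (intro E; injection E; lra)).
        assert (Cmod (w + / w) <= 2)%R.
        { eapply Rle_trans; [apply Cmod_triangle |]. rewrite Cmod_inv, Hw, Rinv_1 by exact Hw0. lra. }
        pose proof (Cmod_ge_0 (w + / w)). pose proof (Cmod_ge_0 (y n)). nra. }
      unfold r. replace ((1 - a n) * y (n + 1)%Z + (1 - a (n - 1)%Z) * y (n - 1)%Z - h a q n * y n
            - 2 * p n * ((w + / w) * y n))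
        with ((1 - a n) * y (n + 1)%Z + (1 - a (n - 1)%Z) * y (n - 1)%Z + - (h a q n * y n)
            + - (2 * p n * (/ 2 * ((w + / w) * y n)) + 2 * p n * (/ 2 * ((w + / w) * y n)))) by (field; exact Hw0).
      eapply Rle_trans; [apply Cmod_triangle |].
      eapply Rle_trans; [apply Rplus_le_compat_r, Cmod_triangle |].
      eapply Rle_trans; [apply Rplus_le_compat_r, Rplus_le_compat_r, Cmod_triangle |].
      rewrite !Cmod_opp.
      eapply Rle_trans; [apply Rplus_le_compat_l, Cmod_triangle |].
      pose proof (Hc _ _ C1 Y1). pose proof (Hc _ _ C5 Y2). pose proof (Hc _ _ C3 Y0).
      pose proof (Hc _ _ C4 Y3). nra. }
    (* [sg] is the tail sum of [tau], and [bt] below is the tail sum of [sg]: one for each of the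
       two first-order recurrences. *)
    set (sg := fun n : Z => (/ ((IZR n + 1) * (IZR n + 2)))%R).
    assert (Hsg : forall n, (0 <= n)%Z -> (tau (n + 1) = sg n - sg (n + 1)%Z)%R).
    { intros n Hn. pose proof (tau_telescope n 0 Hn) as E.
      replace (n + 1 + Z.of_nat 0)%Z with (n + 1)%Z in E by lia. rewrite E.
      unfold sg. rewrite plus_IZR. simpl INR. f_equal; [| f_equal]; f_equal; ring. }
    assert (Hsgpos : forall n, (N <= n)%Z -> (0 < sg n)%R).
    { intros n Hn. specialize (HN3 n Hn). unfold sg. apply Rinv_0_lt_compat. nra. }
    assert (Hub : forall n, (N <= n)%Z -> (Cmod (u n) <= 2 * S * sg n)%R).
    { intros n Hn.
      assert (Hj : forall j : nat,
        (Cmod (u n) <= Cmod (u (n + Z.of_nat j)%Z) + 2 * S * (sg n - sg (n + Z.of_nat j)%Z))%R).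
      { induction j as [| j IH].
        - replace (n + Z.of_nat 0)%Z with n by lia. lra.
        - replace (n + Z.of_nat (Datatypes.S j))%Z with (n + Z.of_nat j + 1)%Z by lia.
          set (k := (n + Z.of_nat j)%Z) in *.
          pose proof (Hu (k + 1)%Z) as E. replace (k + 1 - 1)%Z with k in E by lia.
          apply (f_equal Cmod) in E. rewrite Cmod_mult, Hmu, Rmult_1_l in E.
          pose proof (Cmod_triangle (u (k + 1)%Z) (- r (k + 1)%Z)) as Ht. rewrite Cmod_opp in Ht.
          pose proof (Hrb (k + 1)%Z ltac:(unfold k; lia)) as Hb.
          rewrite Hsg in Hb by (unfold k, N in *; lia).
          unfold Cminus in E. lra. }
      apply le_epsilon. intros e He. destruct (Vu e He) as [M HM].
      specialize (Hj (Z.to_nat (M - n))). specialize (HM (n + Z.of_nat (Z.to_nat (M - n)))%Z ltac:(lia)).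
      pose proof (Hsgpos (n + Z.of_nat (Z.to_nat (M - n)))%Z ltac:(lia)). nra. }
    set (bt := fun n : Z => (/ (IZR n + 1))%R).
    assert (Hbt : forall n, (N <= n)%Z -> (sg n = bt n - bt (n + 1)%Z)%R).
    { intros n Hn. specialize (HN3 n Hn). unfold sg, bt. rewrite plus_IZR. field. lra. }
    intros n Hn.
    assert (Hj : forall j : nat,
      (Cmod (y n) <= Cmod (y (n + Z.of_nat j)%Z) + 2 * S * (bt n - bt (n + Z.of_nat j)%Z))%R).
    { induction j as [| j IH].
      - replace (n + Z.of_nat 0)%Z with n by lia. lra.
      - replace (n + Z.of_nat (Datatypes.S j))%Z with (n + Z.of_nat j + 1)%Z by lia.
        set (k := (n + Z.of_nat j)%Z) in *.
        assert (E : Cmod (mu * y k) = Cmod (y (k + 1)%Z + - u k)) by (f_equal; unfold u; ring).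
        rewrite Cmod_mult, Hmu, Rmult_1_l in E.
        pose proof (Cmod_triangle (y (k + 1)%Z) (- u k)) as Ht. rewrite Cmod_opp in Ht.
        pose proof (Hub k ltac:(unfold k; lia)) as Hb. rewrite Hbt in Hb by (unfold k; lia). lra. }
    apply le_epsilon. intros e He. destruct (Hv e He) as [M HM].
    specialize (Hj (Z.to_nat (M - n))). specialize (HM (n + Z.of_nat (Z.to_nat (M - n)))%Z ltac:(lia)).
    assert (H1 : (bt n <= / 4)%R) by (unfold bt; specialize (HN3 n Hn); apply Rinv_le_contravar; lra).
    assert (H2 : (0 < bt (n + Z.of_nat (Z.to_nat (M - n)))%Z)%R).
    { unfold bt. apply Rinv_0_lt_compat. pose proof (HN3 (n + Z.of_nat (Z.to_nat (M - n)))%Z ltac:(lia)). lra. }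
    nra. }
  assert (Hpow : forall (k : nat) n, (N <= n)%Z -> (Cmod (y n) <= 1 * (/ 2) ^ k)%R).
  { induction k as [| k IH]; intros n Hn.
    - simpl. rewrite Rmult_1_r. left. apply HN1. unfold N in *. lia.
    - simpl pow. rewrite (Rmult_comm (/ 2)), <- Rmult_assoc. apply Hhalf; auto.
      apply Rmult_le_pos; [lra | apply pow_le; lra]. }
  apply (Z_downward_ind _ N).
  - intros n Hn. apply Cmod_eq_0. apply Rle_antisym; [| apply Cmod_ge_0].
    apply (pow_bound_zero (/ 2) 1); [lra |]. intro k. now apply Hpow.
  - intros n E0 E1. specialize (Hy n). rewrite L_eq, E0, E1 in Hy.
    replace (y (n - 1)%Z) with (/ a (n - 1)%Z * (a n * 0 + a (n - 1)%Z * y (n - 1)%Z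
       + (h a q n - 2 + 2 * (w + / w) * p n + (w + / w) * (w + / w)) * 0)).
    + rewrite Hy. ring.
    + field. split; [exact Hw0 | apply Ha].
Qed.

(** * The theorem *)

(** The range of the angle is dictated by [P_plus]: [z] has real part [2 t], which must lie in
    [[- PI, 3 * PI]]. *)
Lemma unit_angle (x y : R) :
  (x ^ 2 + y ^ 2 = 1)%R ->
  exists t, (- (PI / 2) <= t <= 3 * (PI / 2))%R /\ cos t = x /\ sin t = y.
Proof.
  intros H. assert (Hx : (-1 <= x <= 1)%R) by nra.
  pose proof (acos_bound x) as Hb. pose proof PI_RGT_0 as HP.
  assert (Hc : cos (acos x) = x) by (apply cos_acos; lra).
  assert (Hs : sin (acos x) = sqrt (1 - x²)) by (apply sin_acos; lra).
  destruct (Rle_dec 0 y) as [Hy | Hy].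
  - exists (acos x). split; [lra |]. split; [exact Hc |].
    rewrite Hs. replace (1 - x²)%R with (y²)%R by (unfold Rsqr; lra). now apply sqrt_Rsqr.
  - assert (Hsy : sin (- acos x) = y).
    { rewrite sin_neg, Hs. replace (1 - x²)%R with ((- y)²)%R by (unfold Rsqr; lra).
      rewrite sqrt_Rsqr; lra. }
    destruct (Rle_dec (acos x) (PI / 2)) as [Ha | Ha].
    + exists (- acos x)%R. split; [lra |]. split; [now rewrite cos_neg | exact Hsy].
    + exists (- acos x + 2 * PI)%R. split; [lra |].
      rewrite cos_plus, sin_plus, cos_2PI, sin_2PI, cos_neg, Hsy. split; lra.
Qed.

Lemma polar (w : C) :
  w <> 0 -> exists t, (- (PI / 2) <= t <= 3 * (PI / 2))%R /\ w = RtoC (Cmod w) * cis t.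
Proof.
  intros Hw. apply Cmod_gt_0 in Hw. pose proof (Cmod2_alt w) as H2.
  destruct (unit_angle (Re w / Cmod w) (Im w / Cmod w)) as (t & Ht & Hc & Hs).
  - replace ((Re w / Cmod w) ^ 2 + (Im w / Cmod w) ^ 2)%R
      with ((Re w ^ 2 + Im w ^ 2) / Cmod w ^ 2)%R by (field; lra).
    rewrite <- H2. field. lra.
  - exists t. split; [exact Ht |]. unfold cis. rewrite Hc, Hs.
    apply C_ext; [rewrite re_scal_l | rewrite im_mult]; simpl; field; lra.
Qed.

Lemma Csqrt_exists (z : C) : exists s, s * s = z.
Proof.
  destruct (classic (z = 0)) as [-> | Hz]; [exists 0; ring |].
  destruct (polar z Hz) as (t & _ & E). exists (RtoC (sqrt (Cmod z)) * cis (t / 2)).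
  replace (RtoC (sqrt (Cmod z)) * cis (t / 2) * (RtoC (sqrt (Cmod z)) * cis (t / 2)))
    with (RtoC (sqrt (Cmod z)) * RtoC (sqrt (Cmod z)) * (cis (t / 2) * cis (t / 2))) by ring.
  rewrite <- cis_plus, <- RtoC_mult, sqrt_sqrt by apply Cmod_ge_0.
  replace (t / 2 + t / 2)%R with t by field. now symmetry.
Qed.

(** The roots of [w^2 - lambda w + 1] have product [1], so one of them lies in the closed disc. *)
Lemma joukowski_surjective (lambda : C) :
  exists w : C, w <> 0 /\ (Cmod w <= 1)%R /\ lambda = w + / w.
Proof.
  destruct (Csqrt_exists (lambda * lambda - 4)) as [s Hs].
  set (w := (lambda + s) / 2). set (w' := (lambda - s) / 2).
  assert (E : w * w' = 1).
  { unfold w, w'. replace ((lambda + s) / 2 * ((lambda - s) / 2))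
      with ((lambda * lambda - s * s) / 4) by field. rewrite Hs. field. }
  assert (Hw : w <> 0) by (intro H; rewrite H, Cmult_0_l in E; injection E; lra).
  assert (Hw' : w' <> 0) by (intro H; rewrite H, Cmult_0_r in E; injection E; lra).
  assert (Ei : / w = w').
  { replace w' with (/ w * (w * w')) by (field; exact Hw). rewrite E. ring. }
  assert (Ei' : / w' = w).
  { replace w with (/ w' * (w * w')) by (field; exact Hw'). rewrite E. ring. }
  assert (Es : lambda = w + w') by (unfold w, w'; field).
  destruct (Rle_dec (Cmod w) 1) as [H | H].
  - exists w. rewrite Ei. auto.
  - exists w'. rewrite Ei'. split; [exact Hw' |]. split; [| rewrite Es; ring].
    apply (f_equal Cmod) in E. rewrite Cmod_mult, Cmod_1 in E.
    pose proof (Cmod_ge_0 w'). nra.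
Qed.

Lemma Cexp_surjective (w : C) :
  w <> 0 -> exists z, (- PI <= Re z <= 3 * PI)%R /\ Im z = (- 2 * ln (Cmod w))%R /\
    Cexp (Ci / 2 * z) = w.
Proof.
  intros Hw. destruct (polar w Hw) as (t & Ht & E). apply Cmod_gt_0 in Hw.
  exists (2 * t, - 2 * ln (Cmod w))%R. cbn [Re Im fst snd]. split; [lra |]. split; [reflexivity |].
  rewrite E at 2. unfold Cexp, cis.
  replace (Re (Ci / 2 * (2 * t, - 2 * ln (Cmod w))%R)) with (ln (Cmod w)) by (simpl; field).
  replace (Im (Ci / 2 * (2 * t, - 2 * ln (Cmod w))%R)) with t by (simpl; field).
  rewrite exp_ln by exact Hw. apply C_ext; simpl; ring.
Qed.

Lemma Zabs_power_ge_sqrt (n : Z) (delta : R) :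
  (1 / 2 <= delta)%R -> (sqrt (IZR (Z.abs n)) <= Zabs_power n delta)%R.
Proof.
  intros H. unfold Zabs_power. destruct (Z.eq_dec n 0) as [-> | Hn].
  - simpl. rewrite sqrt_0. lra.
  - assert (H1 : (1 <= IZR (Z.abs n))%R) by (apply (IZR_le 1); lia).
    rewrite <- Rpower_sqrt by lra. apply Rle_Rpower; lra.
Qed.

Lemma coefficient_decay (a p q : Z -> C) (eps delta : R) :
  (0 < eps)%R -> (1 / 2 <= delta)%R ->
  bound (fun x : R => exists n : Z,
     x = (exp (eps * Zabs_power n delta)
          * (Cmod (1 - a n) + Cmod (p n) + Cmod (q n)))%R) ->
  exists H, (0 <= H)%R /\ forall n,
    (Cmod (1 - a n) + Cmod (p n) + Cmod (q n) <= H * esqrt eps (IZR (Z.abs n)))%R.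
Proof.
  intros He Hd [M HM]. exists (Rmax 0 M). split; [apply Rmax_l |]. intro n.
  assert (Hn : (exp (eps * Zabs_power n delta)
     * (Cmod (1 - a n) + Cmod (p n) + Cmod (q n)) <= M)%R) by (apply HM; now exists n).
  set (t := (Cmod (1 - a n) + Cmod (p n) + Cmod (q n))%R) in *.
  assert (Ht : (0 <= t)%R).
  { unfold t. pose proof (Cmod_ge_0 (1 - a n)). pose proof (Cmod_ge_0 (p n)).
    pose proof (Cmod_ge_0 (q n)). lra. }
  unfold esqrt. rewrite exp_Ropp. apply Rle_div_r; [apply exp_pos |].
  apply Rle_trans with M; [| apply Rmax_r]. eapply Rle_trans; [| exact Hn].
  rewrite Rmult_comm. apply Rmult_le_compat_r; [exact Ht |]. apply exp_le.
  apply Rmult_le_compat_l; [lra |]. now apply Zabs_power_ge_sqrt.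
Qed.

(** The coefficients of [w^2 Phi] in powers of [w = e^{iz/2}]; [a'], [p'], [q']
    are the reflected coefficients. *)
Definition phi_coef (a p q a' p' q' : Z -> C) : nat -> C :=
  splus
    (sscal (a 0%Z * alpha_plus a' 0 * alpha_plus a 1)
       (Nat.iter 4 sshift (sconv (kap a' p' q' 0) (kap a p q 1))))
    (sscal (- (a 0%Z * alpha_plus a' (-1) * alpha_plus a 0))
       (sconv (kap a' p' q' (-1)) (kap a p q 0))).

(** The two products in the Wronskian carry [e^{iz} = w^2] and [e^{-iz} = w^-2]. Factoring out
    [w^-2] leaves the first one multiplied by [w^4], hence its four shifts in [phi_coef]. *)
Lemma Phi_wave (kappa : R) (n0 n1 : Z) (a p q : Z -> C) (z : C) :
  (0 < kappa)%R -> small_from kappa n0 a p q ->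
  small_from kappa n1 (refl1 a) (refl p) (refl q) -> (0 <= Im z)%R ->
  Phi a p q z = wave (phi_coef a p q (refl1 a) (refl p) (refl q)) z.
Proof.
  intros Hk Hsm Hsm' Hz. unfold Phi, wronskian. rewrite !f_minus_refl.
  rewrite !(f_plus_eq kappa n0 a p q) by assumption.
  rewrite !(f_plus_eq kappa n1 (refl1 a)) by assumption.
  simpl (- (0 + 1))%Z. simpl (0 + 1)%Z. simpl (- 0)%Z.
  unfold wave, phi_coef. pose proof (Cmod_Cexp_upper z Hz) as Hw.
  assert (E1 : Cexp (Ci * RtoC (IZR (-1)) * z) = Cexp (- Ci * z)) by (f_equal; ring).
  assert (E2 : Cexp (Ci * RtoC (IZR 1) * z) = Cexp (- Ci * z) * Cexp (Ci / 2 * z) ^ 4).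
  { rewrite Cexp_pow, <- Cexp_plus. f_equal. simpl (INR 4).
    replace (1 + 1 + 1 + 1)%R with 4%R by ring. field. }
  assert (E0 : Cexp (Ci * RtoC (IZR 0) * z) = 1).
  { replace (Ci * RtoC (IZR 0) * z) with (RtoC 0) by ring. apply Cexp_0. }
  rewrite E0, E1, E2. set (w := Cexp (Ci / 2 * z)) in *.
  assert (R : forall n, edecay kappa (kap a p q n)) by (intro; now apply (kap_edecay kappa n0)).
  assert (R' : forall n, edecay kappa (kap (refl1 a) (refl p) (refl q) n))
    by (intro; now apply (kap_edecay kappa n1)).
  assert (RC : forall n m, rapid (sconv (kap (refl1 a) (refl p) (refl q) n) (kap a p q m))).
  { intros n m. apply (edecay_rapid (kappa / 2)); [lra | now apply edecay_conv]. }
  assert (RC4 : forall n m, rapid (Nat.iter 4 sshift (sconv (kap (refl1 a) (refl p) (refl q) n) (kap a p q m)))).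
  { intros n m. simpl. auto using rapid_shift. }
  rewrite ev_plus, !ev_scal, ev_iter_shift, !ev_conv by
    (eauto using rapid_scal, edecay_rapid).
  ring.
Qed.

Lemma phi_coef_edecay (kappa : R) (n0 n1 : Z) (a p q : Z -> C) :
  (0 < kappa)%R -> small_from kappa n0 a p q ->
  small_from kappa n1 (refl1 a) (refl p) (refl q) ->
  edecay (kappa / 2) (phi_coef a p q (refl1 a) (refl p) (refl q)).
Proof.
  intros Hk Hsm Hsm'.
  assert (R : forall n m, edecay (kappa / 2)
      (sconv (kap (refl1 a) (refl p) (refl q) n) (kap a p q m))).
  { intros n m. apply edecay_conv; [exact Hk | |].
    - now apply (kap_edecay kappa n1).
    - now apply (kap_edecay kappa n0). }
  apply edecay_plus; apply edecay_scal; [apply edecay_iter_shift; [lra |] |]; apply R.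
Qed.

(** The shifts remove the first product at index [0]; in the second both kernels start with [1], so
    only the non-zero prefactor remains. *)
Lemma phi_coef_0 (kappa : R) (n0 n1 : Z) (a p q : Z -> C) :
  (0 < kappa)%R -> small_from kappa n0 a p q ->
  small_from kappa n1 (refl1 a) (refl p) (refl q) -> (forall n, a n <> 0) ->
  phi_coef a p q (refl1 a) (refl p) (refl q) 0 <> 0.
Proof.
  intros Hk Hsm Hsm' Ha. unfold phi_coef, splus, sscal. rewrite sconv_0. simpl.
  assert (H1 : alpha_plus (refl1 a) (-1) <> 0).
  { apply (alpha_plus_spec kappa n1 (refl1 a) (refl p) (refl q)); auto. intro. apply Ha. }
  assert (H2 : alpha_plus a 0 <> 0) by now apply (alpha_plus_spec kappa n0 a p q).
  pose proof (Cmult_neq_0 _ _ (Cmult_neq_0 _ _ (Ha 0%Z) H1) H2) as H.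
  intro E. apply H.
  set (x := a 0%Z * alpha_plus (refl1 a) (-1) * alpha_plus a 0) in *.
  match type of E with ?lhs = _ => replace lhs with (- x) in E by ring end.
  replace x with (- - x) by ring. rewrite E. ring.
Qed.

(** The eigenvector and [f_plus] both decay at plus infinity, so their constant Wronskian is zero;
    the same holds for [f_minus] at minus infinity. *)
Lemma eigenvalue_zero (kappa : R) (n0 n1 : Z) (a p q : Z -> C) (lambda : C) :
  (0 < kappa)%R -> small_from kappa n0 a p q ->
  small_from kappa n1 (refl1 a) (refl p) (refl q) -> (forall n, a n <> 0) ->
  eigenvalue a p q lambda ->
  exists z, P_plus z /\ lambda = 2 * Ccos (z / 2) /\ Phi a p q z = 0.
Proof.
  intros Hk Hsm Hsm' Ha (y & Hl2 & [m Hm] & Hy).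
  assert (Ha' : forall n, refl1 a n <> 0) by (intro; apply Ha).
  destruct (l2Z_vanishes y Hl2) as [V V'].
  destruct (joukowski_surjective lambda) as (w & Hw0 & Hw & El).
  destruct (Rle_lt_or_eq_dec _ _ Hw) as [Hlt | Heq].
  2: { exfalso. apply Hm. rewrite El in Hy.
       exact (unit_solution_trivial kappa n0 a p q w y Hk Hsm Ha Heq Hy V m). }
  destruct (Cexp_surjective w Hw0) as (z & Hre & Him & Ez). exists z.
  assert (Hz : (0 < Im z)%R).
  { rewrite Him. apply Cmod_gt_0 in Hw0.
    assert (ln (Cmod w) < 0)%R by (rewrite <- ln_1; now apply ln_increasing). lra. }
  assert (Elz : lambda = 2 * Ccos (z / 2)) by (rewrite two_Ccos_half, Ez; exact El).
  split; [now split |]. split; [exact Elz |].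
  pose proof (f_plus_solution kappa n0 a p q z Hk Hsm Ha (Rlt_le _ _ Hz)) as S1.
  pose proof (f_plus_solution kappa n1 _ _ _ z Hk Hsm' Ha' (Rlt_le _ _ Hz)) as S2.
  pose proof (f_plus_vanishes kappa n0 a p q z Hk Hsm Ha Hz) as V1.
  pose proof (f_plus_vanishes kappa n1 _ _ _ z Hk Hsm' Ha' Hz) as V2.
  rewrite <- Elz in S1, S2.
  assert (Efm : f_plus (refl1 a) (refl p) (refl q) z = refl (f_minus a p q z)).
  { apply functional_extensionality. intro n.
    change (refl (f_minus a p q z) n) with (f_minus a p q z (- n)).
    rewrite f_minus_refl. f_equal. lia. }
  rewrite Efm in S2, V2. apply (proj1 (solution_refl a p q lambda _)) in S2.
  assert (W1 : wronskian a y (f_plus a p q z) m = 0)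
    by exact (wronskian_vanishing kappa n0 a p q lambda _ _ m Hk Hsm Hy S1 V V1).
  assert (W2 : wronskian a y (f_minus a p q z) m = 0).
  { assert (W2 : wronskian (refl1 a) (refl y) (refl (f_minus a p q z)) 0 = 0).
    { refine (wronskian_vanishing kappa n1 (refl1 a) (refl p) (refl q) lambda _ _ 0
        Hk Hsm' _ _ V' V2).
      - exact (proj2 (solution_refl a p q lambda y) Hy).
      - exact (proj2 (solution_refl a p q lambda (f_minus a p q z)) S2). }
    (* Reflection reverses the edge from [-1] to [0]: the reflected Wronskian at [0] is minus the
       original one at [-1]. *)
    rewrite (wronskian_const a p q lambda _ _ m (-1)) by assumption.
    unfold wronskian, refl, refl1 in *. simpl in *.
    match type of W2 with ?l = _ => match goal with |- ?r = _ => replace r with (- l) by ring end end.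
    rewrite W2. ring. }
  unfold Phi. rewrite (wronskian_const a p q lambda _ _ 0 m) by assumption.
  unfold wronskian in *.
  set (fp := f_plus a p q z) in *. set (fm := f_minus a p q z) in *.
  (* The identity [y W[fm, fp] = fm W[y, fp] - fp W[y, fm]] is used at an index where [y] is
     non-zero. *)
  replace (a m * (fm m * fp (m + 1)%Z - fm (m + 1)%Z * fp m))
    with (/ y m * (fm m * (a m * (y m * fp (m + 1)%Z - y (m + 1)%Z * fp m))
                   - fp m * (a m * (y m * fm (m + 1)%Z - y (m + 1)%Z * fm m)))) by (field; exact Hm).
  rewrite W1, W2. ring.
Qed.

Theorem theorem4 (a p q : Z -> C) (ha : forall n : Z, a n <> 0)
  (eps delta : R) (heps : (0 < eps)%R) (hdelta : (1 / 2 <= delta < 1)%R)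
  (hsup : bound (fun x : R => exists n : Z,
     x = (exp (eps * Zabs_power n delta)
          * (Cmod (1 - a n) + Cmod (p n) + Cmod (q n)))%R)) :
  Finite_sets.Finite C (eigenvalue a p q) /\
  Finite_sets.Finite C (spectral_singularity a p q) /\
  (forall lambda : C,
     eigenvalue a p q lambda \/ spectral_singularity a p q lambda ->
     finite_multiplicity a p q lambda).
Proof.
  destruct (coefficient_decay a p q eps delta heps (proj1 hdelta) hsup) as (H & HH & Hdec).
  assert (Hk : (0 < eps / 4)%R) by lra. set (kappa := (eps / 4)%R) in *.
  destruct (small_from_exists eps H a p q heps HH) as [n0 Hsm].
  { intros r Hr. rewrite <- (Z.abs_eq r) at 4 by exact Hr. apply Hdec. }
  (* The factor [2] arises because the reflected [a] is taken at [- r - 1] and the reflected [p],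
     [q] at [- r], so two instances of the hypothesis are added. *)
  destruct (small_from_exists eps (2 * H) (refl1 a) (refl p) (refl q) heps) as [n1 Hsm'];
    [lra | |].
  { intros r Hr. unfold refl, refl1.
    pose proof (Hdec (- r)%Z) as D1. pose proof (Hdec (- r - 1)%Z) as D2.
    replace (Z.abs (- r)) with r in D1 by lia. replace (Z.abs (- r - 1)) with (r + 1)%Z in D2 by lia.
    pose proof (esqrt_decr eps (IZR r) (IZR (r + 1)) heps ltac:(apply IZR_le; lia)) as D3.
    assert (D4 : (H * esqrt eps (IZR (r + 1)) <= H * esqrt eps (IZR r))%R)
      by now apply Rmult_le_compat_l.
    pose proof (Cmod_ge_0 (1 - a (- r)%Z)). pose proof (Cmod_ge_0 (p (- r - 1)%Z)).
    pose proof (Cmod_ge_0 (q (- r - 1)%Z)). lra. }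
  fold kappa in Hsm, Hsm'.
  set (c := phi_coef a p q (refl1 a) (refl p) (refl q)).
  assert (Hc : sqrt_exp_decay c).
  { apply (edecay_sqrt_exp (kappa / 2)); [lra | now apply (phi_coef_edecay kappa n0 n1)]. }
  assert (Hc0 : c 0%nat <> 0) by now apply (phi_coef_0 kappa n0 n1).
  assert (HPhi : forall z, (0 <= Im z)%R -> Phi a p q z = wave c z)
    by (intros; now apply (Phi_wave kappa n0 n1)).
  pose proof (finite_zeros c Hc Hc0) as Hfin.
  (* Both [lambda] and the vanishing of [Phi] depend on [z] only through [w], so eigenvalues and
     spectral singularities all lie in the image of one finite set under [w + / w]. *)
  assert (Hzero : forall lambda z, (0 <= Im z)%R -> lambda = 2 * Ccos (z / 2) -> Phi a p q z = 0 ->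
    Ensembles.In C (Image.Im C C (fun w => (Cmod w <= 1)%R /\ ev c w = 0) (fun w => w + / w)) lambda).
  { intros lambda z Hz El E0. rewrite HPhi in E0 by exact Hz.
    apply Image.Im_intro with (Cexp (Ci / 2 * z)); [| rewrite El; apply two_Ccos_half].
    split; [now apply Cmod_Cexp_upper |]. unfold wave in E0.
    apply NNPP. intro Hne. revert E0. apply Cmult_neq_0; [apply Cexp_neq_0 | exact Hne]. }
  assert (Hev : forall lambda, eigenvalue a p q lambda ->
    exists z, P_plus z /\ lambda = 2 * Ccos (z / 2) /\ Phi a p q z = 0)
    by (intro; now apply (eigenvalue_zero kappa n0 n1)).
  split; [| split].
  - eapply Finite_downward_closed; [apply Image.finite_image, Hfin |].
    intros lambda Hl. destruct (Hev lambda Hl) as (z & [_ Hz] & El & E0).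
    apply (Hzero lambda z); [lra | exact El | exact E0].
  - eapply Finite_downward_closed; [apply Image.finite_image, Hfin |].
    intros lambda (z & [Hz _] & El & E0). apply (Hzero lambda z); [lra | exact El | exact E0].
  - intros lambda Hl. split.
    + destruct Hl as [Hl | (z & Hz & Hl)].
      * destruct (Hev lambda Hl) as (z & Hz & Hl'). exists z. split; [now left | exact Hl'].
      * exists z. split; [now right | exact Hl].
    + intros z (Hz & _ & _). apply (wave_multiplicity _ c); auto.
      destruct Hz as [[_ Hz] | [Hz _]]; lra.
Qed.
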